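(* Let $\mathcal{G}$ be a Dixmier-Douady gerbe with connective structure $\mathcal{A}$ over a smooth manifold $M$, and for each vector field $\xi$ on $M$ let $\pi:\mathcal{L}_{(\mathcal{G},\mathcal{A})}(\xi)\to\mathcal{L}_{\mathcal{G}}(\xi)$ be the forgetful functor $(F_{\check\xi},\Theta_{\check\xi})\mapsto F_{\check\xi}$. For each vector field $\xi$ on $M$ and each $\hat\xi\in\mathcal{L}_{\mathcal{G}}(\xi)$, the set $\pi^{-1}(\hat\xi)$ of connective lifts extending $\hat\xi$ is a torsor for the group $i\Omega^1(M)$ of global (imaginary) 1-forms on $M$. For each $\check\xi\in\mathcal{L}_{(\mathcal{G},\mathcal{A})}(\xi)$, the automorphism group of $\check\xi$ is canonically isomorphic to the group of locally constant $i\mathbb{R}$-valued functions on $M$.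
   Context: $\mathbb{T}$ is the circle group with Lie algebra $i\mathbb{R}$; $\underline{\mathbb{T}}_M$, $\underline{i\mathbb{R}}_M$, $\underline{i\Omega}^1_M$ are the sheaves of smooth $\mathbb{T}$-valued functions, $i\mathbb{R}$-valued functions and imaginary 1-forms; $d\log(g)=g^{-1}dg$; $\pounds_\xi$ is the Lie derivative. For a sheaf of abelian groups $A$, an $A$-torsor is a sheaf of sets with an $A$-action, locally nonempty and simply transitive over open sets where sections exist; morphisms are equivariant sheaf maps. A presheaf of groupoids over $M$ is a pseudo-functor from the opposite of the category of open sets to groupoids; 1-morphisms are pseudo-natural transformations, 2-morphisms are modifications. It is a stack if for all $P,Q\in\mathcal{G}(U)$ the presheaf $\underline{\mathrm{Hom}}(P,Q)$ is a sheaf and for every open cover of every open $V$ the functor from $\mathcal{G}(V)$ to descent data is an equivalence. A gerbe with band $A$ is a stack with isomorphisms $\alpha_P:\underline{\mathrm{Aut}}(P)\to A|_U$ for $P\in\mathcal{G}(U)$, compatible with isomorphisms $P\to Q$, such that objects exist locally and any two objects are locally isomorphic. A Dixmier-Douady gerbe has band $\underline{\mathbb{T}}_M$. $\mathrm{B}(A)$ is the gerbe $U\mapsto\{A|_U\text{-torsors}\}$. A 1-morphism $\Phi$ of gerbes intertwines $\varphi:A\to B$ if $\alpha'_{\Phi(P)}\circ\Phi=\varphi\circ\alpha_P$ on $\underline{\mathrm{Aut}}(P)$. A connective structure on $\mathcal{G}$ is a 1-morphism $\mathcal{A}:\mathcal{G}\to\mathrm{B}(\underline{i\Omega}^1_M)$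 intertwining $-d\log$. $\mathcal{L}_{\mathcal{G}}(\xi)$ is the category of lifts of $\xi$: 1-morphisms $F:\mathcal{G}\to\mathrm{B}(\underline{i\mathbb{R}}_M)$ intertwining $-\iota_\xi d\log$, with 2-morphisms as morphisms. A connection $\nu$ on an $\underline{i\mathbb{R}}_U$-torsor $R$ is a sheaf map $A_\nu:R\to\underline{i\Omega}^1_U$ with $A_\nu(\sigma+f)=A_\nu(\sigma)+df$; connections form an $\underline{i\Omega}^1_U$-torsor via $A_{\nu+\alpha}=A_\nu+\alpha$. $\mathcal{A}^0_{\underline{i\mathbb{R}}}:\mathrm{B}(\underline{i\mathbb{R}}_M)\to\mathrm{B}(\underline{i\Omega}^1_M)$ sends a torsor to its torsor of connections. A connective lift of $\xi$ is a pair $\check\xi=(F_{\check\xi},\Theta_{\check\xi})$ with $F_{\check\xi}\in\mathcal{L}_{\mathcal{G}}(\xi)$ and $\Theta_{\check\xi}:\pounds_{-\xi}[\mathcal{A}]\Rightarrow\mathcal{A}^0_{\underline{i\mathbb{R}}}\circ F_{\check\xi}$ a 2-morphism ($\pounds_{-\xi}[\cdot]$ being the associated torsor construction for $\pounds_{-\xi}:\underline{i\Omega}^1_M\to\underline{i\Omega}^1_M$). Explicitly: for each $Q\in\mathcal{G}(U)$ and local section $\mu$ of $\mathcal{A}(Q)$, a local connection $\Theta_{\check\xi}(\mu)$ on $F_{\check\xi}(Q)$, natural in $Q$ and compatible with restrictions, with $\Theta_{\check\xi}(\mu+\alpha)=\Theta_{\check\xi}(\mu)-\pounds_\xi\alpha$.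 A 1-form $\alpha\in i\Omega^1(M)$ acts on connective lifts by $(F,\Theta)\mapsto(F,\Theta+\alpha)$, $(\Theta+\alpha)(\mu)=\Theta(\mu)+\alpha$. A morphism of connective lifts $\check\xi\to\check\xi'$ of $\xi$ is a 2-morphism $T:F_{\check\xi}\Rightarrow F_{\check\xi'}$ with $A_{\Theta_{\check\xi'}(\mu)}(T_Q(\sigma))=A_{\Theta_{\check\xi}(\mu)}(\sigma)$ for all $Q$, $\mu\in\mathcal{A}(Q)$, $\sigma\in F_{\check\xi}(Q)$. $\mathcal{L}_{(\mathcal{G},\mathcal{A})}(\xi)$ is the resulting category. *)

(* Defs.v *)
From HB Require Import structures.
From mathcomp Require Import all_boot all_order all_algebra.
From mathcomp Require Import ring.
From mathcomp Require Import boolp classical_sets functions cardinality.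
From mathcomp Require Import reals topology normedtype derive.

Set Implicit Arguments.
Unset Strict Implicit.
Unset Printing Implicit Defensive.

Import Order.TTheory GRing.Theory Num.Theory numFieldNormedType.Exports.

Local Open Scope classical_set_scope.
Local Open Scope ring_scope.
#[local] Obligation Tactic := idtac.

Section Smoothness.
Variables (R : realType) (n : nat).
Local Notation E := 'rV[R]_n.

Fixpoint class_C (k : nat) (A : set E) (f : E -> R) : Prop :=
  (forall x, A x -> {for x, continuous f}) /\
  match k with
  | 0 => True
  | k'.+1 => forall v : E,
      (forall x, A x -> derivable f x v) /\ class_C k' A ('D_v f)
  end.

Definition smooth_on (A : set E) (f : E -> R) : Prop := forall k, class_C k A f.

Lemma class_C_continuous k A f : class_C k A f ->
  forall x, A x -> {for x, continuous f}.
Proof. by case: k => [|k] []. Qed.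

Lemma class_C_local k A f :
  (forall x, A x -> exists B g,
     [/\ open B, B x, (forall y, B y -> g y = f y) & class_C k B g]) ->
  class_C k A f.
Proof.
elim: k A f => [|k IH] A f loc /=; split=> //.
- move=> x /loc[B [g [oB Bx gf [gC _]]]].
  have nfg : {near x, g =1 f}.
    by apply: filterS (open_nbhs_nbhs (conj oB Bx)) => y /gf.
  change (f @ x --> f x); rewrite -(gf _ Bx).
  exact: cvg_trans (near_eq_cvg nfg) (gC _ Bx).
- move=> x /loc[B [g [oB Bx gf [gC _]]]].
  have nfg : {near x, g =1 f}.
    by apply: filterS (open_nbhs_nbhs (conj oB Bx)) => y /gf.
  change (f @ x --> f x); rewrite -(gf _ Bx).
  exact: cvg_trans (near_eq_cvg nfg) (gC _ Bx).
- move=> v; split=> [x /loc[B [g [oB Bx gf [_ /(_ v)[dg _]]]]]|].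
    apply: near_eq_derivable (dg _ Bx).
    by apply: filterS (open_nbhs_nbhs (conj oB Bx)) => y /gf.
  apply: IH => x /loc[B [g [oB Bx gf [_ /(_ v)[_ dg]]]]].
  exists B, ('D_v g); split=> // y By; apply: near_eq_derive.
  by apply: filterS (open_nbhs_nbhs (conj oB By)) => z /gf.
Qed.

Lemma class_C_eq k A f g : open A -> (forall x, A x -> g x = f x) ->
  class_C k A g -> class_C k A f.
Proof. by move=> oA gf gC; apply: class_C_local => x Ax; exists A, g. Qed.

Lemma class_C_sub k A B f : A `<=` B -> class_C k B f -> class_C k A f.
Proof.
elim: k A B f => [|k IH] A B f AB /= [fC fD]; split=> //; try by move=> x /AB/fC.
by move=> v; have [dB DB] := fD v; split=> [x /AB/dB//|]; apply: IH DB.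
Qed.

Lemma class_CW k A f : class_C k.+1 A f -> class_C k A f.
Proof.
elim: k A f => [|k IH] A f /= [fC fD]; split=> // v.
by have [? ?] := fD v; split=> //; apply: IH.
Qed.

Lemma class_C_cst k A a : class_C k A (cst a).
Proof.
elim: k a => [|k IH] a; split=> //; try by move=> x _; apply: cst_continuous.
move=> v; split=> [x _|]; first exact: derivable_cst.
by have -> : 'D_v (cst a : E -> R) = cst 0 by apply/funext => x; rewrite derive_cst.
Qed.

Lemma class_CD k A f g : open A -> class_C k A f -> class_C k A g ->
  class_C k A (f \+ g).
Proof.
elim: k f g => [|k IH] f g oA /= [fC fD] [gC gD]; split=> //;
  try by move=> x Ax; apply: continuousD; [apply: fC|apply: gC].
move=> v; have [df Df] := fD v; have [dg Dg] := gD v; split.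
  by move=> x Ax; apply: derivableD; [apply: df|apply: dg].
apply: class_C_eq (IH _ _ oA Df Dg) => // x Ax /=.
by rewrite -deriveD //; [apply: df|apply: dg].
Qed.

Lemma class_CM k A f g : open A -> class_C k A f -> class_C k A g ->
  class_C k A (f \* g).
Proof.
elim: k f g => [|k IH] f g oA fk gk; have fk' := fk; have gk' := gk;
  move: fk gk => /= [fC fD] [gC gD]; split=> //;
  try by move=> x Ax; apply: continuousM; [apply: fC|apply: gC].
move=> v; have [df Df] := fD v; have [dg Dg] := gD v; split.
  by move=> x Ax; apply: derivableM; [apply: df|apply: dg].
have H := class_CD oA (IH _ _ oA (class_CW fk') Dg) (IH _ _ oA (class_CW gk') Df).
apply: class_C_eq H => // x Ax /=.
by rewrite (deriveM (df _ Ax) (dg _ Ax)).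
Qed.

End Smoothness.

Record chart (R : realType) (M : topologicalType) (n : nat) := Chart {
  ch_dom : set M;
  ch_cod : set 'rV[R]_n;
  ch_map : M -> 'rV[R]_n;
  ch_inv : 'rV[R]_n -> M;
  ch_dom_open : open ch_dom;
  ch_cod_open : open ch_cod;
  ch_map_fun : forall x, ch_dom x -> ch_cod (ch_map x);
  ch_inv_fun : forall y, ch_cod y -> ch_dom (ch_inv y);
  ch_mapK : forall x, ch_dom x -> ch_inv (ch_map x) = x;
  ch_invK : forall y, ch_cod y -> ch_map (ch_inv y) = y;
  ch_map_cont : forall x, ch_dom x -> {for x, continuous ch_map};
  ch_inv_cont : forall y, ch_cod y -> {for y, continuous ch_inv} }.

Record manifold (R : realType) (n : nat) := Manifold {
  mf_space :> topologicalType;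
  mf_hausdorff : hausdorff_space mf_space;
  mf_second_countable : @second_countable mf_space;
  mf_atlas : set (chart R mf_space n);
  mf_cover : forall x : mf_space, exists2 c, mf_atlas c & ch_dom c x;
  mf_compat : forall c d, mf_atlas c -> mf_atlas d -> forall i : 'I_n,
    smooth_on (ch_cod c `&` ch_inv c @^-1` ch_dom d)
      (fun y => ch_map d (ch_inv c y) ord0 i) }.

Record opens (T : topologicalType) := Opens {
  op_set :> set T;
  op_open : open op_set }.

Definition osub (T : topologicalType) (V U : opens T) : Prop :=
  op_set V `<=` op_set U.
Notation "V ⊑ U" := (osub V U) (at level 70).

Definition otop (T : topologicalType) : opens T := Opens (@openT T).
Definition ocap (T : topologicalType) (U V : opens T) : opens T :=
  Opens (openI (op_open U) (op_open V)).

Section OpenLemmas.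
Variable T : topologicalType.
Implicit Types U V W : opens T.
Lemma osub_refl U : U ⊑ U. Proof. by []. Qed.
Lemma osub_trans U V W : V ⊑ U -> W ⊑ V -> W ⊑ U.
Proof. by move=> VU WV x /WV/VU. Qed.
Lemma osub_top U : U ⊑ otop T. Proof. by []. Qed.
Lemma ocap_l U V : ocap U V ⊑ U. Proof. by move=> x []. Qed.
Lemma ocap_r U V : ocap U V ⊑ V. Proof. by move=> x []. Qed.
Lemma ocap_sub U V W : W ⊑ U -> W ⊑ V -> W ⊑ ocap U V.
Proof. by move=> WU WV x Wx; split; [apply: WU|apply: WV]. Qed.

Definition oelt U (x : T) (Ux : op_set U x) : U := exist _ x (mem_set Ux).

Definition oincl V U (h : V ⊑ U) (x : V) : U :=
  oelt (h _ (set_mem (valP x))).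

Definition ocover V (I : Type) (W : I -> opens T) : Prop :=
  (forall i, W i ⊑ V) /\ (forall x, op_set V x -> exists i, op_set (W i) x).
End OpenLemmas.
Arguments osub_refl {T} U.
Arguments osub_top {T} U.
Arguments ocap_l {T} U V.
Arguments ocap_r {T} U V.

Record absheaf (T : topologicalType) := AbSheaf {
  ab_sec :> opens T -> zmodType;
  ab_res : forall U V, V ⊑ U -> ab_sec U -> ab_sec V;
  ab_resD : forall U V (h : V ⊑ U) a b,
    ab_res h (a + b) = ab_res h a + ab_res h b;
  ab_res_id : forall U (h : U ⊑ U) a, ab_res h a = a;
  ab_res_comp : forall U V W (hVU : V ⊑ U) (hWV : W ⊑ V) (hWU : W ⊑ U) a,
    ab_res hWV (ab_res hVU a) = ab_res hWU a;
  ab_glue : forall U (I : Type) (W : I -> opens T) (a : forall i, ab_sec (W i)),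
    ocover U W ->
    (forall i j V (hi : V ⊑ W i) (hj : V ⊑ W j),
       ab_res hi (a i) = ab_res hj (a j)) ->
    exists! s : ab_sec U, forall i (h : W i ⊑ U), ab_res h s = a i }.

Record absheaf_hom (T : topologicalType) (A B : absheaf T) := AbSheafHom {
  ah_fun :> forall U, A U -> B U;
  ah_funD : forall U a b, ah_fun (a + b : A U) = ah_fun a + ah_fun b;
  ah_fun_res : forall U V (h : V ⊑ U) a,
    ah_fun (ab_res h a) = ab_res h (ah_fun a) }.

Section SmoothFunctions.
Variables (R : realType) (n : nat) (M : manifold R n).
Implicit Types U V W : opens M.

(* Read in the chart [c], the function [f] is smooth on the open set
   [c (U ∩ dom c)]; [h] is an arbitrary extension outside this set. *)
Definition is_smooth U (f : U -> R) : Prop :=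
  forall c, mf_atlas c -> exists2 h : 'rV[R]_n -> R,
    smooth_on (ch_cod c `&` ch_inv c @^-1` op_set U) h &
    forall x : U, ch_dom c (val x) -> f x = h (ch_map c (val x)).

Lemma chart_open U (c : chart R M n) :
  open (ch_cod c `&` ch_inv c @^-1` op_set U).
Proof.
rewrite openE => y [cy Uy]; apply: filterI.
  by apply: open_nbhs_nbhs; split=> //; apply: ch_cod_open.
have H : nbhs (ch_inv c y) (op_set U).
  by apply: open_nbhs_nbhs; split=> //; apply: op_open.
exact: (ch_inv_cont cy) H.
Qed.

Definition smooth_pred U : {pred (U -> R)} := fun f => `[< is_smooth f >].
Arguments smooth_pred : clear implicits.

Lemma smooth_subring U : GRing.subring_closed (smooth_pred U).
Proof.
have mul f g : is_smooth f -> is_smooth g -> is_smooth (U := U) (f * g).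
  move=> fs gs c ca; have [h hs hf] := fs c ca; have [k ks kg] := gs c ca.
  exists (h \* k) => [l|x xc].
    exact: class_CM (@chart_open U c) (hs l) (ks l).
  by rewrite -[LHS]/(f x * g x) hf ?kg.
have cs a : is_smooth (cst a : U -> R).
  by move=> c ca; exists (cst a) => // k; apply: class_C_cst.
split=> [|f g /asboolP fs /asboolP gs|f g /asboolP fs /asboolP gs]; apply/asboolP.
- exact: cs.
- move=> c ca; have [h hs hf] := fs c ca; have [k ks kg] := mul _ _ (cs (-1)) gs c ca.
  exists (h \+ k) => [l|x xc]; first exact: class_CD (@chart_open U c) (hs l) (ks l).
  by rewrite /= -hf // -kg // -[LHS]/(f x - g x) -[(cst _ * _) x]/(-1 * g x) mulN1r.
- exact: mul.
Qed.
HB.instance Definition _ U :=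
  GRing.isSubringClosed.Build (U -> R) (smooth_pred U) (@smooth_subring U).

(* Identifying t with i t, these functions, and the real 1-forms below, also
   stand for the smooth functions and the 1-forms with values in i R. *)
Record smooth U := Smooth {
  smooth_fun :> U -> R;
  smooth_funP : smooth_fun \in smooth_pred U }.
HB.instance Definition _ U := [isSub for @smooth_fun U].
HB.instance Definition _ U := [Choice of smooth U by <:].
HB.instance Definition _ U := GRing.SubChoice_isSubComPzRing.Build _ _ (smooth U)
  (@smooth_subring U).

Lemma smoothP U (f : smooth U) : is_smooth f.
Proof. exact/asboolP/smooth_funP. Qed.

Lemma smooth_ext U (f g : smooth U) : (forall x, f x = g x) -> f = g.
Proof. by move=> fg; apply: val_inj; apply/funext. Qed.

Lemma is_smooth_res U V (h : V ⊑ U) (f : smooth U) : f \o oincl h \in smooth_pred V.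
Proof.
apply/asboolP => c ca; have [k ks kf] := smoothP f ca.
exists k => [l|x xc]; last by rewrite /= kf.
by apply: class_C_sub (ks l) => y [? /h ?].
Qed.

Definition smooth_res U V (h : V ⊑ U) (f : smooth U) : smooth V :=
  Smooth (is_smooth_res h f).

Lemma is_smooth_cst U (a : R) : (cst a : U -> R) \in smooth_pred U.
Proof. by apply/asboolP => c ca; exists (cst a) => // k; apply: class_C_cst. Qed.
Definition smooth_cst U (a : R) : smooth U := Smooth (is_smooth_cst U a).


Lemma smooth_res_id U (h : U ⊑ U) (f : smooth U) : smooth_res h f = f.
Proof. by apply: smooth_ext => x /=; congr (f _); apply: val_inj. Qed.

Lemma smooth_res_comp U V W (hVU : V ⊑ U) (hWV : W ⊑ V) (hWU : W ⊑ U)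
  (f : smooth U) : smooth_res hWV (smooth_res hVU f) = smooth_res hWU f.
Proof. by apply: smooth_ext => x /=; congr (f _); apply: val_inj. Qed.

Lemma smooth_resD U V (h : V ⊑ U) (f g : smooth U) :
  smooth_res h (f + g) = smooth_res h f + smooth_res h g.
Proof. exact: smooth_ext. Qed.

Lemma smooth_resB U V (h : V ⊑ U) (f g : smooth U) :
  smooth_res h (f - g) = smooth_res h f - smooth_res h g.
Proof. exact: smooth_ext. Qed.

Lemma smooth_resM U V (h : V ⊑ U) (f g : smooth U) :
  smooth_res h (f * g) = smooth_res h f * smooth_res h g.
Proof. exact: smooth_ext. Qed.

Lemma smooth_res_cst U V (h : V ⊑ U) a :
  smooth_res h (smooth_cst U a) = smooth_cst V a.
Proof. exact: smooth_ext. Qed.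

Lemma smooth_locP U (I : Type) (W : I -> opens M) (f g : smooth U) :
  ocover U W -> (forall i (h : W i ⊑ U), smooth_res h f = smooth_res h g) ->
  f = g.
Proof.
case=> WU cov fg; apply: smooth_ext => x.
have [i Wx] := cov _ (set_mem (valP x)).
have := congr1 (fun k : smooth _ => k (oelt Wx)) (fg i (WU i)).
by rewrite /=; congr (f _ = g _); apply: val_inj.
Qed.

Lemma smooth_glue U (I : Type) (W : I -> opens M) (f : forall i, smooth (W i)) :
  ocover U W ->
  (forall i j V (hi : V ⊑ W i) (hj : V ⊑ W j),
     smooth_res hi (f i) = smooth_res hj (f j)) ->
  exists! g : smooth U, forall i (h : W i ⊑ U), smooth_res h g = f i.
Proof.
move=> cov fC; have [WU covx] := cov.
pose idx (x : U) := projT1 (cid (covx _ (set_mem (valP x)))).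
have idxP x : op_set (W (idx x)) (val x) := projT2 (cid (covx _ (set_mem (valP x)))).
pose g (x : U) : R := f (idx x) (oelt (idxP x)).
have gE i (x : U) (Wx : op_set (W i) (val x)) :
    g x = f i (oelt Wx).
  have Vx : op_set (ocap (W (idx x)) (W i)) (val x) by split.
  have := congr1 (fun k : smooth _ => k (oelt Vx))
    (fC (idx x) i _ (ocap_l _ _) (ocap_r _ _)).
  by rewrite /= /g; congr (_ = _); congr (f _ _); apply: val_inj.
have gs : g \in smooth_pred U.
  apply/asboolP => c ca.
  pose h (y : 'rV[R]_n) : R :=
    if pselect (op_set U (ch_inv c y)) is left Uy then g (oelt Uy) else 0.
  exists h => [k|x xc]; last first.
    rewrite /h; case: pselect => [Uy|[]]; last by rewrite ch_mapK //; exact: (set_mem (valP x)).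
    by congr (g _); apply: val_inj; rewrite /= ch_mapK.
  apply: class_C_local => y [cy Uy].
  have [i Wy] := covx _ Uy; have [k' ks kf] := smoothP (f i) ca.
  exists (ch_cod c `&` ch_inv c @^-1` op_set (W i)), k'; split=> //.
  - exact: chart_open.
  - move=> z [cz Wz]; rewrite /h; case: pselect => [Uz|[]]; last exact: WU Wz.
    have Wz' : op_set (W i) (val (oelt Uz)) by [].
    by rewrite (gE i _ Wz') (kf (oelt Wz')) /= ?ch_invK //; apply: ch_inv_fun.
have gf i (h : W i ⊑ U) : smooth_res h (Smooth gs) = f i.
  apply: smooth_ext => x /=.
  have Wx : op_set (W i) (val (oincl h x)) := set_mem (valP x).
  by rewrite (gE i _ Wx); congr (f _ _); apply: val_inj.
exists (Smooth gs); split=> // g' g'f.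
by apply: smooth_locP cov _ => i h; rewrite g'f gf.
Qed.

(* A vector field is a derivation of the sheaf of smooth functions. *)
Record vfield U := VField {
  vf_op : forall V, V ⊑ U -> smooth V -> smooth V;
  vf_opD : forall V (h : V ⊑ U) f g, vf_op h (f + g) = vf_op h f + vf_op h g;
  vf_opM : forall V (h : V ⊑ U) f g, vf_op h (f * g) = vf_op h f * g + f * vf_op h g;
  vf_op_cst : forall V (h : V ⊑ U) a, vf_op h (smooth_cst V a) = 0;
  vf_op_res : forall V W (hV : V ⊑ U) (hW : W ⊑ U) (h : W ⊑ V) f,
    smooth_res h (vf_op hV f) = vf_op hW (smooth_res h f) }.

Lemma vfield_ext U (X Y : vfield U) :
  (forall V (h : V ⊑ U) f, vf_op X h f = vf_op Y h f) -> X = Y.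
Proof.
case: X Y => [x a b c d] [y a' b' c' d'] /= xy.
have E : x = y by apply: functional_extensionality_dep => V;
  apply: functional_extensionality_dep => h; apply/funext => f; exact: xy.
by case: y / E a' b' c' d' {xy} => *; congr VField; apply: Prop_irrelevance.
Qed.

Lemma vf_op_irr U (X : vfield U) V (h h' : V ⊑ U) f : vf_op X h f = vf_op X h' f.
Proof. by rewrite (Prop_irrelevance h h'). Qed.

Lemma vf_opB U (X : vfield U) V (h : V ⊑ U) f g :
  vf_op X h (f - g) = vf_op X h f - vf_op X h g.
Proof. by apply/eqP; rewrite eq_sym subr_eq -vf_opD subrK. Qed.

Program Definition vf_add U (X Y : vfield U) : vfield U :=
  {| vf_op V h f := vf_op X h f + vf_op Y h f |}.
Next Obligation. by move=> * /=;  rewrite !vf_opD addrACA. Qed.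
Next Obligation. by move=> * /=; rewrite !vf_opM; ring. Qed.
Next Obligation. by move=> * /=; rewrite !vf_op_cst addr0. Qed.
Next Obligation.
by move=> U X Y V W hV hW h f /=; rewrite smooth_resD !(vf_op_res _ hV hW).
Qed.

Program Definition vf_scale U (a : smooth U) (X : vfield U) : vfield U :=
  {| vf_op V h f := smooth_res h a * vf_op X h f |}.
Next Obligation. by move=> * /=; rewrite !vf_opD mulrDr. Qed.
Next Obligation. by move=> * /=; rewrite !vf_opM; ring. Qed.
Next Obligation. by move=> * /=; rewrite !vf_op_cst mulr0. Qed.
Next Obligation.
move=> U a X V W hV hW h f /=.
by rewrite smooth_resM (vf_op_res _ hV hW) (smooth_res_comp hV h hW).
Qed.

Program Definition vf_bracket U (X Y : vfield U) : vfield U :=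
  {| vf_op V h f := vf_op X h (vf_op Y h f) - vf_op Y h (vf_op X h f) |}.
Next Obligation. by move=> * /=; rewrite !vf_opD; ring. Qed.
Next Obligation. by move=> * /=; rewrite !vf_opM !vf_opD !vf_opM; ring. Qed.
Next Obligation.
move=> U X Y V h a /=; have Z Z' : vf_op (U := U) Z' h 0 = 0.
  by have := vf_opB Z' h 0 0; rewrite !subrr.
by rewrite !vf_op_cst !Z subr0.
Qed.
Next Obligation.
by move=> U X Y V W hV hW h f /=; rewrite smooth_resB !(vf_op_res _ hV hW).
Qed.

Program Definition vf_restr U V (h : V ⊑ U) (X : vfield U) : vfield V :=
  {| vf_op W hW f := vf_op X (osub_trans h hW) f |}.
Next Obligation. by move=> * /=; rewrite vf_opD. Qed.
Next Obligation. by move=> * /=; rewrite vf_opM. Qed.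
Next Obligation. by move=> * /=; rewrite vf_op_cst. Qed.
Next Obligation. by move=> * /=; apply: vf_op_res. Qed.

(* A 1-form is a morphism of sheaves of modules, over the smooth functions, from
   vector fields to smooth functions. *)
Record form U := Form {
  fm_op : forall V, V ⊑ U -> vfield V -> smooth V;
  fm_opD : forall V (h : V ⊑ U) X Y,
    fm_op h (vf_add X Y) = fm_op h X + fm_op h Y;
  fm_opZ : forall V (h : V ⊑ U) a X, fm_op h (vf_scale a X) = a * fm_op h X;
  fm_op_res : forall V W (hV : V ⊑ U) (hW : W ⊑ U) (h : W ⊑ V) X,
    smooth_res h (fm_op hV X) = fm_op hW (vf_restr h X) }.

HB.instance Definition _ U := gen_eqMixin (form U).
HB.instance Definition _ U := gen_choiceMixin (form U).

Lemma form_ext U (a b : form U) :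
  (forall V (h : V ⊑ U) X, fm_op a h X = fm_op b h X) -> a = b.
Proof.
case: a b => [x a b c] [y a' b' c'] /= xy.
have E : x = y by apply: functional_extensionality_dep => V;
  apply: functional_extensionality_dep => h; apply/funext => f; exact: xy.
by case: y / E a' b' c' {xy} => *; congr Form; apply: Prop_irrelevance.
Qed.

Program Definition fm_zero U : form U := {| fm_op V h X := 0 |}.
Next Obligation. by move=> * /=; rewrite addr0. Qed.
Next Obligation. by move=> * /=; rewrite mulr0. Qed.
Next Obligation. by move=> * /=; apply: smooth_ext. Qed.

Program Definition fm_opp U (a : form U) : form U :=
  {| fm_op V h X := - fm_op a h X |}.
Next Obligation. by move=> * /=; rewrite fm_opD opprD. Qed.
Next Obligation. by move=> * /=; rewrite fm_opZ mulrN. Qed.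
Next Obligation.
by move=> U a V W hV hW h X /=; rewrite -(fm_op_res a hV hW h X); apply: smooth_ext.
Qed.

Program Definition fm_add U (a b : form U) : form U :=
  {| fm_op V h X := fm_op a h X + fm_op b h X |}.
Next Obligation. by move=> * /=; rewrite !fm_opD addrACA. Qed.
Next Obligation. by move=> * /=; rewrite !fm_opZ mulrDr. Qed.
Next Obligation.
by move=> U a b V W hV hW h X /=; rewrite smooth_resD !(fm_op_res _ hV hW).
Qed.

Section FormZmod.
Variable U : opens M.
Lemma fm_addA : associative (@fm_add U).
Proof. by move=> a b c; apply: form_ext => *; apply: addrA. Qed.
Lemma fm_addC : commutative (@fm_add U).
Proof. by move=> a b; apply: form_ext => *; apply: addrC. Qed.
Lemma fm_add0 : left_id (@fm_zero U) (@fm_add U).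
Proof. by move=> a; apply: form_ext => *; apply: add0r. Qed.
Lemma fm_addN : left_inverse (@fm_zero U) (@fm_opp U) (@fm_add U).
Proof. by move=> a; apply: form_ext => *; apply: addNr. Qed.
HB.instance Definition _ :=
  GRing.isZmodule.Build (form U) fm_addA fm_addC fm_add0 fm_addN.
End FormZmod.

Program Definition fm_scale U (f : smooth U) (a : form U) : form U :=
  {| fm_op V h X := smooth_res h f * fm_op a h X |}.
Next Obligation. by move=> * /=; rewrite !fm_opD mulrDr. Qed.
Next Obligation. by move=> * /=; rewrite !fm_opZ; ring. Qed.
Next Obligation.
move=> U f a V W hV hW h X /=.
by rewrite smooth_resM (fm_op_res _ hV hW) (smooth_res_comp hV h hW).
Qed.

Program Definition fm_res U V (h : V ⊑ U) (a : form U) : form V :=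
  {| fm_op W hW X := fm_op a (osub_trans h hW) X |}.
Next Obligation. by move=> * /=; rewrite fm_opD. Qed.
Next Obligation. by move=> * /=; rewrite fm_opZ. Qed.
Next Obligation. by move=> * /=; apply: fm_op_res. Qed.

Program Definition ext_d U (f : smooth U) : form U :=
  {| fm_op V h X := vf_op X (osub_refl V) (smooth_res h f) |}.
Next Obligation. by []. Qed.
Next Obligation. by move=> U f V h a X /=; rewrite smooth_res_id. Qed.
Next Obligation.
move=> U f V W hV hW h X /=.
by rewrite (vf_op_res _ _ (osub_trans (osub_refl V) h)) (smooth_res_comp hV h hW) /=;
   congr (vf_op _ _ _); apply: Prop_irrelevance.
Qed.

Definition interior_prod (xi : vfield (otop M)) U (a : form U) : smooth U :=
  fm_op a (osub_refl U) (vf_restr (osub_top U) xi).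

Program Definition lie_deriv (xi : vfield (otop M)) U (a : form U) : form U :=
  {| fm_op V h X := vf_op xi (osub_top V) (fm_op a h X)
       - fm_op a h (vf_bracket (vf_restr (osub_top V) xi) X) |}.
Next Obligation.
move=> xi U a V h X Y /=; rewrite fm_opD vf_opD.
have -> : vf_bracket (vf_restr (osub_top V) xi) (vf_add X Y) =
  vf_add (vf_bracket (vf_restr (osub_top V) xi) X)
         (vf_bracket (vf_restr (osub_top V) xi) Y).
  by apply: vfield_ext => W hW f /=; rewrite !vf_opD; ring.
by rewrite fm_opD; ring.
Qed.
Next Obligation.
move=> xi U a V h f X /=; rewrite fm_opZ vf_opM.
have -> : vf_bracket (vf_restr (osub_top V) xi) (vf_scale f X) =
  vf_add (vf_scale (vf_op xi (osub_top V) f) X)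
         (vf_scale f (vf_bracket (vf_restr (osub_top V) xi) X)).
  apply: vfield_ext => W hW g /=; rewrite !vf_opM.
  rewrite (vf_op_res _ _ (osub_trans (osub_top V) hW)); ring.
by rewrite fm_opD !fm_opZ; ring.
Qed.
Next Obligation.
move=> xi U a V W hV hW h X /=.
rewrite smooth_resB (vf_op_res _ _ (osub_top W)) !(fm_op_res _ hV hW).
congr (_ - fm_op _ _ _); apply: vfield_ext => Z hZ f /=.
by congr (_ - _); [apply: vf_op_irr | rewrite (vf_op_irr xi _ (osub_trans (osub_top W) hZ))].
Qed.

(* The smooth map [c_re + i c_im] to the unit circle of the complex numbers. *)
Record circle U := Circle {
  c_re : smooth U;
  c_im : smooth U;
  c_norm : c_re * c_re + c_im * c_im = 1 }.

HB.instance Definition _ U := gen_eqMixin (circle U).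
HB.instance Definition _ U := gen_choiceMixin (circle U).

Lemma circle_ext U (g h : circle U) : c_re g = c_re h -> c_im g = c_im h -> g = h.
Proof.
case: g h => [a b e] [a' b' e'] /= E F.
by case: a' / E e' => e'; case: b' / F e' => e'; congr Circle; apply: Prop_irrelevance.
Qed.

Program Definition circle_one U : circle U := {| c_re := 1; c_im := 0 |}.
Next Obligation. by move=> * /=; ring. Qed.
Program Definition circle_inv U (g : circle U) : circle U :=
  {| c_re := c_re g; c_im := - c_im g |}.
Next Obligation. by move=> U g; rewrite -[RHS](c_norm g); ring. Qed.
Program Definition circle_mul U (g h : circle U) : circle U :=
  {| c_re := c_re g * c_re h - c_im g * c_im h;
     c_im := c_re g * c_im h + c_im g * c_re h |}.
Next Obligation.
by move=> U g h /=; rewrite -[RHS](mulr1 1) -{1}(c_norm g) -(c_norm h); ring.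
Qed.

Section CircleZmod.
Variable U : opens M.
Lemma circle_mulA : associative (@circle_mul U).
Proof. by move=> a b c; apply: circle_ext => /=; ring. Qed.
Lemma circle_mulC : commutative (@circle_mul U).
Proof. by move=> a b; apply: circle_ext => /=; ring. Qed.
Lemma circle_mul1 : left_id (@circle_one U) (@circle_mul U).
Proof. by move=> a; apply: circle_ext => /=; ring. Qed.
Lemma circle_mulV : left_inverse (@circle_one U) (@circle_inv U) (@circle_mul U).
Proof.
move=> a; apply: circle_ext => /=; last by ring.
by rewrite -[RHS](c_norm a); ring.
Qed.
(* The multiplicative group of circle-valued functions is written additively. *)
HB.instance Definition _ :=
  GRing.isZmodule.Build (circle U) circle_mulA circle_mulC circle_mul1 circle_mulV.
End CircleZmod.

Program Definition circle_res U V (h : V ⊑ U) (g : circle U) : circle V :=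
  {| c_re := smooth_res h (c_re g); c_im := smooth_res h (c_im g) |}.
Next Obligation.
by move=> U V h g /=; rewrite -!smooth_resM -smooth_resD c_norm; apply: smooth_ext.
Qed.

(* For g = a + i b of modulus 1, a da + b db = 0, hence
   g^-1 dg = (a - i b) (da + i db) = i (a db - b da), which is identified with
   the real form a db - b da. *)
Definition dlog U (g : circle U) : form U :=
  fm_scale (c_re g) (ext_d (c_im g)) - fm_scale (c_im g) (ext_d (c_re g)).

Lemma circle_glue U (I : Type) (W : I -> opens M) (g : forall i, circle (W i)) :
  ocover U W ->
  (forall i j V (hi : V ⊑ W i) (hj : V ⊑ W j),
     circle_res hi (g i) = circle_res hj (g j)) ->
  exists! s : circle U, forall i (h : W i ⊑ U), circle_res h s = g i.
Proof.
move=> cov gC.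
have [a [ag _]] := smooth_glue cov
  (fun i j V hi hj => congr1 (@c_re V) (gC i j V hi hj)).
have [b [bg _]] := smooth_glue cov
  (fun i j V hi hj => congr1 (@c_im V) (gC i j V hi hj)).
have ab : a * a + b * b = 1.
  apply: smooth_locP cov _ => i h.
  by rewrite smooth_resD !smooth_resM ag bg c_norm; apply: smooth_ext.
exists (Circle ab); split=> [i h|s sg]; first by apply: circle_ext; [apply: ag|apply: bg].
apply: circle_ext; apply: smooth_locP cov _ => i h.
  by rewrite /= ag -(sg i h).
by rewrite /= bg -(sg i h).
Qed.

Lemma form_glue U (I : Type) (W : I -> opens M) (a : forall i, form (W i)) :
  ocover U W ->
  (forall i j V (hi : V ⊑ W i) (hj : V ⊑ W j),
     fm_res hi (a i) = fm_res hj (a j)) ->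
  exists! s : form U, forall i (h : W i ⊑ U), fm_res h s = a i.
Proof.
move=> [WU cov] aC.
have aE i j Z (hi : Z ⊑ W i) (hj : Z ⊑ W j) X : fm_op (a i) hi X = fm_op (a j) hj X.
  have := congr1 (fun b : form Z => fm_op b (osub_refl Z) X) (aC i j Z hi hj).
  by rewrite /= (Prop_irrelevance (osub_trans hi _) hi)
             (Prop_irrelevance (osub_trans hj _) hj).
pose P V (X : vfield V) (g : smooth V) := forall i Z (hV : Z ⊑ V) (hi : Z ⊑ W i),
  smooth_res hV g = fm_op (a i) hi (vf_restr hV X).
have covV V (h : V ⊑ U) : ocover V (fun i => ocap V (W i)).
  split=> [i|x Vx]; first exact: ocap_l.
  by have [i Wx] := cov x (h _ Vx); exists i.
have uniqP V (h : V ⊑ U) X g g' : P V X g -> P V X g' -> g = g'.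
  move=> Pg Pg'; apply: (smooth_locP (covV V h)) => i k.
  by rewrite (Pg i _ k (ocap_r _ _)) (Pg' i _ k (ocap_r _ _)).
have exP V (h : V ⊑ U) X : exists g, P V X g.
  pose f i := fm_op (a i) (ocap_r V (W i)) (vf_restr (ocap_l V (W i)) X).
  have restrE Z Y (hZ : Z ⊑ V) (hY : Y ⊑ Z) (hYV : Y ⊑ V) :
      vf_restr hY (vf_restr hZ X) = vf_restr hYV X.
    by apply: vfield_ext => Q hQ g /=; apply: vf_op_irr.
  have [i j Z hi hj|g [gf _]] := @smooth_glue V I _ f (covV V h).
    have hiW := osub_trans (ocap_r V (W i)) hi.
    have hjW := osub_trans (ocap_r V (W j)) hj.
    have hZV := osub_trans (ocap_l V (W i)) hi.
    by rewrite (fm_op_res _ _ hiW) (fm_op_res _ _ hjW) !(restrE _ _ _ _ hZV).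
  exists g => i Z hV hi; rewrite -(smooth_res_comp (ocap_l V (W i)) (ocap_sub hV hi)).
  by rewrite gf (fm_op_res _ _ hi) (restrE _ _ _ _ hV).
pose op V (h : V ⊑ U) X := projT1 (cid (exP V h X)).
have opP V (h : V ⊑ U) X : P V X (op V h X) := projT2 (cid (exP V h X)).
have opD V (h : V ⊑ U) X Y : op V h (vf_add X Y) = op V h X + op V h Y.
  apply: (uniqP V h) (opP _ _ _) _ => i Z hV hi.
  rewrite smooth_resD (opP V h X i Z hV hi) (opP V h Y i Z hV hi) -fm_opD.
  by congr fm_op; apply: vfield_ext.
have opZ V (h : V ⊑ U) f X : op V h (vf_scale f X) = f * op V h X.
  apply: (uniqP V h) (opP _ _ _) _ => i Z hV hi.
  rewrite smooth_resM (opP V h X i Z hV hi) -fm_opZ.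
  congr fm_op; apply: vfield_ext => Q hQ g /=.
  by rewrite (smooth_res_comp hV hQ (osub_trans hV hQ)).
have opR V Z (hV : V ⊑ U) (hZ : Z ⊑ U) (h : Z ⊑ V) X :
    smooth_res h (op V hV X) = op Z hZ (vf_restr h X).
  apply: (uniqP Z hZ) (opP _ _ _) => i Y hYZ hi.
  rewrite (smooth_res_comp h hYZ (osub_trans h hYZ)).
  rewrite (opP V hV X i Y _ hi); congr fm_op; apply: vfield_ext => Q hQ g /=.
  exact: vf_op_irr.
exists (Form opD opZ opR); split=> [i h|s sa].
  apply: form_ext => V hV X /=.
  rewrite -[LHS](smooth_res_id (osub_refl V)) (opP _ _ _ i _ _ hV).
  by congr fm_op; apply: vfield_ext => Q hQ g /=; apply: vf_op_irr.
apply: form_ext => V h X /=; apply: (uniqP V h) (opP _ _ _) _ => i Z hV hi.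
rewrite (fm_op_res _ _ (osub_trans h hV)) -(sa i (WU i)) /=.
by congr (fm_op _ _ _); apply: Prop_irrelevance.
Qed.

Definition sheaf_smooth : absheaf M :=
  @AbSheaf M smooth (@smooth_res) (@smooth_resD) (@smooth_res_id) (@smooth_res_comp)
    (@smooth_glue).

Program Definition sheaf_form : absheaf M :=
  @AbSheaf M form (@fm_res) _ _ _ (@form_glue).
Next Obligation. by move=> U V h a b; apply: form_ext. Qed.
Next Obligation.
move=> U h a; apply: form_ext => V hV X /=.
by rewrite (Prop_irrelevance (osub_trans h hV) hV).
Qed.
Next Obligation.
move=> U V W hVU hWV hWU a; apply: form_ext => Z hZ X /=.
by rewrite (Prop_irrelevance (osub_trans hVU _) (osub_trans hWU hZ)).
Qed.

Program Definition sheaf_circle : absheaf M :=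
  @AbSheaf M circle (@circle_res) _ _ _ (@circle_glue).
Next Obligation. by move=> U V h a b; apply: circle_ext; apply: smooth_ext. Qed.
Next Obligation. by move=> U h a; apply: circle_ext; apply: smooth_res_id. Qed.
Next Obligation.
by move=> U V W hVU hWV hWU a; apply: circle_ext; apply: smooth_res_comp.
Qed.

Lemma dlogD U (g h : circle U) : dlog (g + h) = dlog g + dlog h.
Proof.
apply: form_ext => V k X.
rewrite -[LHS]/(smooth_res k (c_re (g + h)) * vf_op X _ (smooth_res k (c_im (g + h)))
  - smooth_res k (c_im (g + h)) * vf_op X _ (smooth_res k (c_re (g + h)))).
rewrite -[RHS]/(smooth_res k (c_re g) * vf_op X _ (smooth_res k (c_im g))
  - smooth_res k (c_im g) * vf_op X _ (smooth_res k (c_re g))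
  + (smooth_res k (c_re h) * vf_op X _ (smooth_res k (c_im h))
  - smooth_res k (c_im h) * vf_op X _ (smooth_res k (c_re h)))).
have := c_norm (circle_res k g); have := c_norm (circle_res k h).
rewrite /= smooth_resB smooth_resD !smooth_resM vf_opB !vf_opD !vf_opM.
move: (smooth_res k (c_re g)) (smooth_res k (c_im g)) => a b.
move: (smooth_res k (c_re h)) (smooth_res k (c_im h)) => c e ce ab.
move: (vf_op X _ a) (vf_op X _ b) (vf_op X _ c) (vf_op X _ e) => a' b' c' e'.
rewrite -[a * b' - b * a']mulr1 -ce -[c * e' - e * c']mul1r -ab.
ring.
Qed.

Lemma dlog_res U V (h : V ⊑ U) (g : circle U) :
  dlog (circle_res h g) = fm_res h (dlog g).
Proof.
apply: form_ext => W k X; rewrite /dlog /=.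
rewrite -[LHS]/(smooth_res k (smooth_res h (c_re g))
    * vf_op X _ (smooth_res k (smooth_res h (c_im g)))
  - smooth_res k (smooth_res h (c_im g))
    * vf_op X _ (smooth_res k (smooth_res h (c_re g)))).
by rewrite !(smooth_res_comp _ _ (osub_trans h k)).
Qed.

Lemma interior_prod_res xi U V (h : V ⊑ U) (a : form U) :
  interior_prod xi (fm_res h a) = smooth_res h (interior_prod xi a).
Proof.
rewrite /interior_prod (fm_op_res _ _ (osub_trans h (osub_refl V))) /=.
by congr fm_op; apply: vfield_ext => W k f /=; apply: vf_op_irr.
Qed.

Program Definition minus_dlog : absheaf_hom sheaf_circle sheaf_form :=
  {| ah_fun U g := - dlog g |}.
Next Obligation. by move=> U g h /=; rewrite dlogD opprD. Qed.
Next Obligation. by move=> U V h g /=; rewrite dlog_res; apply: form_ext. Qed.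

Program Definition minus_iota_dlog (xi : vfield (otop M)) :
    absheaf_hom sheaf_circle sheaf_smooth :=
  {| ah_fun U g := - interior_prod xi (dlog g) |}.
Next Obligation.
move=> xi U g h; have E := dlogD (g : circle U) h.
by apply: etrans (congr1 (fun a => - interior_prod xi a) E) _; apply: opprD.
Qed.
Next Obligation.
move=> xi U V h g; have E := dlog_res h (g : circle U).
apply: etrans (congr1 (fun a => - interior_prod xi a) E) _.
by rewrite interior_prod_res; apply: smooth_ext.
Qed.

Definition loc_const_pred : {pred (M -> R)} :=
  fun c => `[< forall x, \forall y \near x, c y = c x >].

Lemma loc_const_zmod : GRing.zmod_closed loc_const_pred.
Proof.
split=> [|c d /asboolP cc /asboolP dc]; apply/asboolP => x; first exact: nearW.
by near=> y; rewrite -[LHS]/(c y - d y) (near (cc x)) // (near (dc x)).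
Unshelve. all: by end_near.
Qed.
HB.instance Definition _ :=
  GRing.isZmodClosed.Build (M -> R) loc_const_pred loc_const_zmod.

Record loc_const := LocConst {
  lc_fun :> M -> R;
  lc_funP : lc_fun \in loc_const_pred }.
HB.instance Definition _ := [isSub for lc_fun].
HB.instance Definition _ := [Choice of loc_const by <:].
HB.instance Definition _ := [SubChoice_isSubZmodule of loc_const by <:].

Lemma loc_const_is_smooth U (c : loc_const) :
  (fun x : U => c (val x)) \in smooth_pred U.
Proof.
apply/asboolP => ch _; exists (c \o ch_inv ch) => [k|x xc]; last by rewrite /= ch_mapK.
apply: class_C_local => y [cy _].
have cc : nbhs (ch_inv ch y) [set z | c z = c (ch_inv ch y)].
  by have /asboolP := lc_funP c; apply.
have := (ch_inv_cont cy) _ cc; rewrite nbhsE => -[B [oB By] Bc].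
exists B, (cst (c (ch_inv ch y))); split=> //; first by move=> z /Bc.
exact: class_C_cst.
Qed.
Definition loc_const_smooth U (c : loc_const) : smooth U :=
  Smooth (loc_const_is_smooth U c).

End SmoothFunctions.
Record category := Category {
  ob :> Type;
  hom : ob -> ob -> Type;
  idm : forall x, hom x x;
  comp : forall x y z, hom y z -> hom x y -> hom x z;
  comp_idl : forall x y (f : hom x y), comp (idm y) f = f;
  comp_idr : forall x y (f : hom x y), comp f (idm x) = f;
  comp_assoc : forall w x y z (h : hom y z) (g : hom x y) (f : hom w x),
    comp h (comp g f) = comp (comp h g) f }.
Arguments idm {c} x.
Notation "g ⊚ f" := (comp g f) (at level 40, left associativity).

Definition is_iso (C : category) (x y : C) (f : hom x y) : Prop :=
  exists g : hom y x, g ⊚ f = idm x /\ f ⊚ g = idm y.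

Record groupoid := Groupoid {
  gpd_cat :> category;
  ginv : forall x y : gpd_cat, hom x y -> hom y x;
  ginvl : forall (x y : gpd_cat) (f : hom x y), ginv f ⊚ f = idm x;
  ginvr : forall (x y : gpd_cat) (f : hom x y), f ⊚ ginv f = idm y }.

Record functor (C D : category) := Functor {
  fob :> C -> D;
  fhom : forall x y : C, hom x y -> hom (fob x) (fob y);
  fhom_id : forall x : C, fhom (idm x) = idm (fob x);
  fhom_comp : forall (x y z : C) (g : hom y z) (f : hom x y),
    fhom (g ⊚ f) = fhom g ⊚ fhom f }.

Definition is_equivalence (C D : category) (F : functor C D) : Prop :=
  (forall (x y : C) (g : hom (F x) (F y)), exists! f : hom x y, fhom F f = g) /\
  (forall y : D, exists (x : C) (f : hom (F x) y), is_iso f).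

Section FullSub.
Variables (C : category) (P : C -> Prop).
Definition full_sub : category :=
  @Category {x : C | P x} (fun x y => hom (sval x) (sval y))
    (fun x => idm (sval x)) (fun x y z g f => g ⊚ f)
    (fun x y f => comp_idl f) (fun x y f => comp_idr f)
    (fun w x y z h g f => comp_assoc h g f).
End FullSub.

Section GroupoidTheory.
Variable G : groupoid.
Implicit Types x y z : G.

Lemma gcomp_injr x y z (e : hom x y) (f g : hom y z) : f ⊚ e = g ⊚ e -> f = g.
Proof.
by move=> fg; rewrite -(comp_idr f) -(comp_idr g) -(ginvr e) !comp_assoc fg.
Qed.
Lemma gcomp_injl x y z (e : hom y z) (f g : hom x y) : e ⊚ f = e ⊚ g -> f = g.
Proof.
by move=> fg; rewrite -(comp_idl f) -(comp_idl g) -(ginvl e) -!comp_assoc fg.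
Qed.
Lemma gcompK x y z (f : hom y z) (e : hom x y) : f ⊚ e ⊚ ginv e = f.
Proof. by rewrite -comp_assoc ginvr comp_idr. Qed.
Lemma gcompVK x y z (f : hom y z) (e : hom y x) : f ⊚ ginv e ⊚ e = f.
Proof. by rewrite -comp_assoc ginvl comp_idr. Qed.
End GroupoidTheory.

Section Presheaves.
Variable T : topologicalType.

(* Pseudo-functors from the opposite of the category of open sets to groupoids;
   [gp_id] and [gp_cmp] are the structure isomorphisms. The inclusions are
   universally quantified, rather than fixed to reflexivity and composites, since
   any two proofs of an inclusion are equal. *)
Record gpd_presheaf := GpdPresheaf {
  gp_ob :> opens T -> groupoid;
  gp_res : forall U V, V ⊑ U -> functor (gp_ob U) (gp_ob V);
  gp_id : forall U (h : U ⊑ U) (P : gp_ob U), hom (gp_res h P) P;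
  gp_id_nat : forall U (h : U ⊑ U) (P Q : gp_ob U) (f : hom P Q),
    f ⊚ gp_id h P = gp_id h Q ⊚ fhom (gp_res h) f;
  gp_cmp : forall U V W (hVU : V ⊑ U) (hWV : W ⊑ V) (hWU : W ⊑ U) (P : gp_ob U),
    hom (gp_res hWV (gp_res hVU P)) (gp_res hWU P);
  gp_cmp_nat : forall U V W (hVU : V ⊑ U) (hWV : W ⊑ V) (hWU : W ⊑ U)
      (P Q : gp_ob U) (f : hom P Q),
    fhom (gp_res hWU) f ⊚ gp_cmp hVU hWV hWU P =
    gp_cmp hVU hWV hWU Q ⊚ fhom (gp_res hWV) (fhom (gp_res hVU) f);
  gp_unitl : forall U V (hUU : U ⊑ U) (hVU : V ⊑ U) (P : gp_ob U),
    gp_cmp hUU hVU hVU P = fhom (gp_res hVU) (gp_id hUU P);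
  gp_unitr : forall U V (hVU : V ⊑ U) (hVV : V ⊑ V) (P : gp_ob U),
    gp_cmp hVU hVV hVU P = gp_id hVV (gp_res hVU P);
  gp_assoc : forall U V W X (hVU : V ⊑ U) (hWV : W ⊑ V) (hXW : X ⊑ W)
      (hWU : W ⊑ U) (hXV : X ⊑ V) (hXU : X ⊑ U) (P : gp_ob U),
    gp_cmp hWU hXW hXU P ⊚ fhom (gp_res hXW) (gp_cmp hVU hWV hWU P) =
    gp_cmp hVU hXV hXU P ⊚ gp_cmp hWV hXW hXV (gp_res hVU P) }.

Record pseudonat (G H : gpd_presheaf) := Pseudonat {
  gm_fun :> forall U, functor (G U) (H U);
  gm_iso : forall U V (h : V ⊑ U) (P : G U),
    hom (gm_fun V (gp_res G h P)) (gp_res H h (gm_fun U P));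
  gm_nat : forall U V (h : V ⊑ U) (P Q : G U) (f : hom P Q),
    gm_iso h Q ⊚ fhom (gm_fun V) (fhom (gp_res G h) f) =
    fhom (gp_res H h) (fhom (gm_fun U) f) ⊚ gm_iso h P;
  gm_id : forall U (h : U ⊑ U) (P : G U),
    gp_id h (gm_fun U P) ⊚ gm_iso h P = fhom (gm_fun U) (gp_id h P);
  gm_cmp : forall U V W (hVU : V ⊑ U) (hWV : W ⊑ V) (hWU : W ⊑ U) (P : G U),
    gp_cmp hVU hWV hWU (gm_fun U P) ⊚ fhom (gp_res H hWV) (gm_iso hVU P)
      ⊚ gm_iso hWV (gp_res G hVU P) =
    gm_iso hWU P ⊚ fhom (gm_fun W) (gp_cmp hVU hWV hWU P) }.

Record modification (G H : gpd_presheaf) (F F' : pseudonat G H) := Modification {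
  md_hom :> forall U (P : G U), hom (F U P) (F' U P);
  md_nat : forall U (P Q : G U) (f : hom P Q),
    md_hom Q ⊚ fhom (F U) f = fhom (F' U) f ⊚ md_hom P;
  md_res : forall U V (h : V ⊑ U) (P : G U),
    fhom (gp_res H h) (md_hom P) ⊚ gm_iso F h P =
    gm_iso F' h P ⊚ md_hom (gp_res G h P) }.

Section Modifications.
Variables G H : gpd_presheaf.
Implicit Types F : pseudonat G H.

Lemma modification_ext F F' (s t : modification F F') :
  (forall U (P : G U), s U P = t U P) -> s = t.
Proof.
case: s t => [s a b] [t a' b'] /= st.
have E : s = t by apply: functional_extensionality_dep => U;
  apply: functional_extensionality_dep => P; apply: st.
by case: t / E a' b' {st} => *; congr Modification; apply: Prop_irrelevance.
Qed.

Program Definition modification_id F : modification F F := {| md_hom U P := idm (F U P) |}.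
Next Obligation. by move=> * /=; rewrite comp_idl comp_idr. Qed.
Next Obligation. by move=> * /=; rewrite fhom_id comp_idl comp_idr. Qed.

Program Definition modification_comp F1 F2 F3 (t : modification F2 F3) (s : modification F1 F2) :
  modification F1 F3 := {| md_hom U P := t U P ⊚ s U P |}.
Next Obligation.
by move=> F1 F2 F3 t s U P Q f /=; rewrite -comp_assoc md_nat !comp_assoc md_nat.
Qed.
Next Obligation.
move=> F1 F2 F3 t s U V h P /=.
by rewrite fhom_comp -comp_assoc md_res !comp_assoc md_res.
Qed.

Program Definition pseudonat_cat : category :=
  @Category (pseudonat G H) (@modification G H) modification_id modification_comp _ _ _.
Next Obligation. by move=> *; apply: modification_ext => * /=; apply: comp_idl. Qed.
Next Obligation. by move=> *; apply: modification_ext => * /=; apply: comp_idr. Qed.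
Next Obligation. by move=> *; apply: modification_ext => * /=; apply: comp_assoc. Qed.
End Modifications.

Section Stacks.
Variable G : gpd_presheaf.

(* Restriction to [Z] of a morphism over [V] between the restrictions to [V] of an
   object over [U1] and an object over [U2]. *)
Definition hom_res U1 U2 V Z (h1 : V ⊑ U1) (h2 : V ⊑ U2) (P : G U1) (Q : G U2)
    (k : Z ⊑ V) (k1 : Z ⊑ U1) (k2 : Z ⊑ U2)
    (f : hom (gp_res G h1 P) (gp_res G h2 Q)) :
    hom (gp_res G k1 P) (gp_res G k2 Q) :=
  gp_cmp h2 k k2 Q ⊚ fhom (gp_res G k) f ⊚ ginv (gp_cmp h1 k k1 P).

Definition hom_is_sheaf U (P Q : G U) : Prop :=
  forall V (hV : V ⊑ U) (I : Type) (W : I -> opens T) (hW : forall i, W i ⊑ U)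
    (f : forall i, hom (gp_res G (hW i) P) (gp_res G (hW i) Q)),
  ocover V W ->
  (forall i j Z (hi : Z ⊑ W i) (hj : Z ⊑ W j) (hZ : Z ⊑ U),
     hom_res hi hZ hZ (f i) = hom_res hj hZ hZ (f j)) ->
  exists! g : hom (gp_res G hV P) (gp_res G hV Q),
    forall i (h : W i ⊑ V), hom_res h (hW i) (hW i) g = f i.

Section Descent.
Variables (V : opens T) (I : Type) (W : I -> opens T).

Record descent_datum := DescentDatum {
  dd_ob : forall i, G (W i);
  dd_iso : forall i j, hom (gp_res G (ocap_r (W i) (W j)) (dd_ob j))
                           (gp_res G (ocap_l (W i) (W j)) (dd_ob i));
  dd_cocycle : forall i j k Z (hi : Z ⊑ W i) (hj : Z ⊑ W j) (hk : Z ⊑ W k),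
    hom_res (ocap_sub hi hj) hj hi (dd_iso i j) ⊚
    hom_res (ocap_sub hj hk) hk hj (dd_iso j k) =
    hom_res (ocap_sub hi hk) hk hi (dd_iso i k) }.

Definition descent_hom (D E : descent_datum) : Type :=
  {f : forall i, hom (dd_ob D i) (dd_ob E i) |
    forall i j, fhom (gp_res G (ocap_l (W i) (W j))) (f i) ⊚ dd_iso D i j =
                dd_iso E i j ⊚ fhom (gp_res G (ocap_r (W i) (W j))) (f j)}.

Lemma descent_hom_ext D E (f g : descent_hom D E) :
  (forall i, sval f i = sval g i) -> f = g.
Proof.
case: f g => [f fP] [g gP] /= fg.
have E' : f = g by apply: functional_extensionality_dep.
by case: g / E' gP {fg} => gP; congr exist; apply: Prop_irrelevance.
Qed.

Program Definition descent_id D : descent_hom D D := fun i => idm (dd_ob D i).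
Next Obligation. by move=> D i j /=; rewrite !fhom_id comp_idl comp_idr. Qed.

Program Definition descent_comp D E F (g : descent_hom E F) (f : descent_hom D E) :
  descent_hom D F := fun i => sval g i ⊚ sval f i.
Next Obligation.
move=> D E F g f i j /=; rewrite !fhom_comp -comp_assoc (svalP f i j).
by rewrite !comp_assoc (svalP g i j).
Qed.

Program Definition descent_cat : category :=
  @Category descent_datum descent_hom descent_id descent_comp _ _ _.
Next Obligation. by move=> *; apply: descent_hom_ext => i /=; apply: comp_idl. Qed.
Next Obligation. by move=> *; apply: descent_hom_ext => i /=; apply: comp_idr. Qed.
Next Obligation. by move=> *; apply: descent_hom_ext => i /=; apply: comp_assoc. Qed.

Hypothesis cov : ocover V W.

Lemma ocap_cover i j : ocap (W i) (W j) ⊑ V.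
Proof. exact (osub_trans (cov.1 i) (ocap_l (W i) (W j))). Qed.

Arguments ocap_cover : clear implicits.

Program Definition restr_datum (P : G V) : descent_datum :=
  {| dd_ob i := gp_res G (cov.1 i) P;
     dd_iso i j := ginv (gp_cmp (cov.1 i) (ocap_l (W i) (W j)) (ocap_cover i j) P)
                   ⊚ gp_cmp (cov.1 j) (ocap_r (W i) (W j)) (ocap_cover i j) P |}.
Next Obligation.
move=> P i j k Z hi hj hk /=.
have hZ := osub_trans (cov.1 i) hi.
have key a b (ha : Z ⊑ W a) (hb : Z ⊑ W b) :
  hom_res (ocap_sub ha hb) hb ha
    (ginv (gp_cmp (cov.1 a) (ocap_l (W a) (W b)) (ocap_cover a b) P)
     ⊚ gp_cmp (cov.1 b) (ocap_r (W a) (W b)) (ocap_cover a b) P) =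
  ginv (gp_cmp (cov.1 a) ha hZ P) ⊚ gp_cmp (cov.1 b) hb hZ P.
  rewrite /hom_res fhom_comp.
  apply: (gcomp_injl (e := gp_cmp (cov.1 a) ha hZ P)).
  rewrite !comp_assoc ginvr comp_idl.
  rewrite -(gp_assoc _ _ _ (ocap_cover a b)).
  rewrite -(comp_assoc (gp_cmp (ocap_cover a b) _ hZ P)) -fhom_comp ginvr fhom_id comp_idr.
  by rewrite (gp_assoc _ _ _ _ hb) gcompK.
rewrite !key !comp_assoc; congr (_ ⊚ _).
by rewrite gcompK.
Qed.

Program Definition restr_hom (P Q : G V) (f : hom P Q) :
  descent_hom (restr_datum P) (restr_datum Q) := fun i => fhom (gp_res G (cov.1 i)) f.
Next Obligation.
move=> P Q f i j /=.
apply: (gcomp_injl (e := gp_cmp (cov.1 i) (ocap_l (W i) (W j)) (ocap_cover i j) Q)).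
by rewrite !comp_assoc -gp_cmp_nat ginvr comp_idl gcompK gp_cmp_nat.
Qed.

Program Definition descent_functor : functor (G V) descent_cat :=
  @Functor (G V) descent_cat restr_datum restr_hom _ _.
Next Obligation. by move=> P; apply: descent_hom_ext => i /=; apply: fhom_id. Qed.
Next Obligation. by move=> *; apply: descent_hom_ext => i /=; apply: fhom_comp. Qed.
End Descent.

Definition is_stack : Prop :=
  (forall U (P Q : G U), hom_is_sheaf P Q) /\
  (forall V (I : Type) (W : I -> opens T) (cov : ocover V W),
     is_equivalence (descent_functor cov)).
End Stacks.

(* The component over V ⊑ U of the isomorphism of sheaves from Aut(P) to A|U is
   [gb_band] of the restriction of P to V; [gb_band_res] is its naturality. *)
Record gerbe (A : absheaf T) := Gerbe {
  gb_presheaf :> gpd_presheaf;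
  gb_stack : is_stack gb_presheaf;
  gb_band : forall U (P : gb_presheaf U), hom P P -> A U;
  gb_band_bij : forall U (P : gb_presheaf U), bijective (@gb_band U P);
  gb_band_comp : forall U (P : gb_presheaf U) (u v : hom P P),
    gb_band (u ⊚ v) = gb_band u + gb_band v;
  gb_band_res : forall U V (h : V ⊑ U) (P : gb_presheaf U) (u : hom P P),
    gb_band (fhom (gp_res _ h) u) = ab_res h (gb_band u);
  gb_band_conj : forall U (P Q : gb_presheaf U) (f : hom P Q) (u : hom P P),
    gb_band (f ⊚ u ⊚ ginv f) = gb_band u;
  gb_locally_nonempty : forall x : T,
    exists2 U : opens T, op_set U x & inhabited (gb_presheaf U);
  gb_locally_connected : forall U (P Q : gb_presheaf U) x, op_set U x ->
    exists V (h : V ⊑ U), op_set V x /\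
      inhabited (hom (gp_res gb_presheaf h P) (gp_res gb_presheaf h Q)) }.
End Presheaves.

Section Torsors.
Variable T : topologicalType.

Record sheaf_on (U : opens T) := SheafOn {
  sh_sec :> forall V, V ⊑ U -> Type;
  sh_res : forall V W (hV : V ⊑ U) (hW : W ⊑ U), W ⊑ V -> sh_sec hV -> sh_sec hW;
  sh_res_id : forall V (hV : V ⊑ U) (h : V ⊑ V) (s : sh_sec hV),
    sh_res hV h s = s;
  sh_res_comp : forall V W Z (hV : V ⊑ U) (hW : W ⊑ U) (hZ : Z ⊑ U)
      (hWV : W ⊑ V) (hZW : Z ⊑ W) (hZV : Z ⊑ V) (s : sh_sec hV),
    sh_res hZ hZW (sh_res hW hWV s) = sh_res hZ hZV s;
  sh_glue : forall V (hV : V ⊑ U) (I : Type) (W : I -> opens T)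
      (hW : forall i, W i ⊑ U) (s : forall i, sh_sec (hW i)),
    ocover V W ->
    (forall i j Z (hi : Z ⊑ W i) (hj : Z ⊑ W j) (hZ : Z ⊑ U),
       sh_res hZ hi (s i) = sh_res hZ hj (s j)) ->
    exists! t : sh_sec hV, forall i (h : W i ⊑ V), sh_res (hW i) h t = s i }.

Variable A : absheaf T.

Record torsor (U : opens T) := Torsor {
  tor_sheaf :> sheaf_on U;
  tor_act : forall V (hV : V ⊑ U), tor_sheaf V hV -> A V -> tor_sheaf V hV;
  tor_act0 : forall V (hV : V ⊑ U) (s : tor_sheaf V hV), tor_act s 0 = s;
  tor_actD : forall V (hV : V ⊑ U) (s : tor_sheaf V hV) a b,
    tor_act s (a + b) = tor_act (tor_act s a) b;
  tor_act_res : forall V W (hV : V ⊑ U) (hW : W ⊑ U) (h : W ⊑ V)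
      (s : tor_sheaf V hV) a,
    sh_res hW h (tor_act s a) = tor_act (sh_res hW h s) (ab_res h a);
  tor_locally_nonempty : forall x, op_set U x ->
    exists V (hV : V ⊑ U), op_set V x /\ inhabited (tor_sheaf V hV);
  tor_simply_transitive : forall V (hV : V ⊑ U) (s t : tor_sheaf V hV),
    exists! a, tor_act s a = t }.

Record tor_mor (U : opens T) (P Q : torsor U) := TorMor {
  tm_fun :> forall V (hV : V ⊑ U), P V hV -> Q V hV;
  tm_res : forall V W (hV : V ⊑ U) (hW : W ⊑ U) (h : W ⊑ V) (s : P V hV),
    tm_fun (sh_res hW h s) = sh_res hW h (tm_fun s);
  tm_act : forall V (hV : V ⊑ U) (s : P V hV) a,
    tm_fun (tor_act s a) = tor_act (tm_fun s) a }.

Section TorMor.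
Variable U : opens T.
Implicit Types P Q : torsor U.

Lemma tor_mor_ext P Q (f g : tor_mor P Q) :
  (forall V (hV : V ⊑ U) s, f V hV s = g V hV s) -> f = g.
Proof.
case: f g => [f a b] [g a' b'] /= fg.
have E : f = g by apply: functional_extensionality_dep => V;
  apply: functional_extensionality_dep => h; apply/funext; apply: fg.
by case: g / E a' b' {fg} => *; congr TorMor; apply: Prop_irrelevance.
Qed.

Program Definition tor_id P : tor_mor P P := {| tm_fun V hV s := s |}.
Next Obligation. by []. Qed.
Next Obligation. by []. Qed.

Program Definition tor_comp P Q S (g : tor_mor Q S) (f : tor_mor P Q) :
  tor_mor P S := {| tm_fun V hV s := g V hV (f V hV s) |}.
Next Obligation. by move=> * /=; rewrite !tm_res. Qed.
Next Obligation. by move=> * /=; rewrite !tm_act. Qed.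

Lemma tm_inj P Q (f : tor_mor P Q) V (hV : V ⊑ U) (s t : P V hV) :
  f V hV s = f V hV t -> s = t.
Proof.
move=> fst; have [a [sa _]] := tor_simply_transitive s t.
have [b [_ uniq]] := tor_simply_transitive (f V hV s) (f V hV s).
have a0 : a = 0.
  rewrite -(uniq a) ?(uniq 0) ?tor_act0 //.
  by rewrite -tm_act sa -fst.
by rewrite -sa a0 tor_act0.
Qed.

Lemma tm_surj P Q (f : tor_mor P Q) V (hV : V ⊑ U) (t : Q V hV) :
  exists s, f V hV s = t.
Proof.
pose I := {W : {W : opens T | W ⊑ V} & {h : sval W ⊑ U & P (sval W) h}}.
pose W (i : I) : opens T := sval (projT1 i).
pose hW (i : I) : W i ⊑ U := projT1 (projT2 i).
pose hWV (i : I) : W i ⊑ V := svalP (projT1 i).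
have loc (i : I) : exists s : P (W i) (hW i), f _ _ s = sh_res (hW i) (hWV i) t.
  have [a [ta _]] := tor_simply_transitive (f _ _ (projT2 (projT2 i)))
                       (sh_res (hW i) (hWV i) t).
  by exists (tor_act (projT2 (projT2 i)) a); rewrite tm_act.
pose s i := projT1 (cid (loc i)).
have sP i : f _ _ (s i) = sh_res (hW i) (hWV i) t := projT2 (cid (loc i)).
have cov : ocover V W.
  split=> // x Vx; have [Z [hZ [Zx [p]]]] := tor_locally_nonempty P (hV _ Vx).
  have k : ocap Z V ⊑ U := osub_trans hZ (ocap_l Z V).
  by exists (existT _ (exist _ (ocap Z V) (ocap_r Z V))
               (existT _ k (sh_res k (ocap_l Z V) p))).
have [i j Z hi hj hZ|u [us _]] := sh_glue hV (s := s) cov.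
  apply: (tm_inj (f := f)); rewrite !tm_res !sP.
  by rewrite !(sh_res_comp _ _ _ _ (osub_trans (hWV i) hi)).
exists u; have [v [_ uniq]] := sh_glue hV
  (s := fun i => sh_res (hW i) (hWV i) t) cov
  (fun i j Z hi hj hZ => etrans (sh_res_comp _ hZ (hWV i) hi (osub_trans (hWV i) hi) t)
      (esym (sh_res_comp _ hZ (hWV j) hj (osub_trans (hWV i) hi) t))).
rewrite -(uniq t) => [|i h]; last by rewrite (Prop_irrelevance h (hWV i)).
by symmetry; apply: uniq => i h; rewrite -tm_res us sP.
Qed.

Program Definition tor_inv P Q (f : tor_mor P Q) : tor_mor Q P :=
  {| tm_fun V hV t := projT1 (cid (tm_surj f t)) |}.
Next Obligation.
move=> P Q f V W hV hW h t /=; case: (cid _) => s /= sE; case: (cid _) => u /= uE.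
by apply: (tm_inj (f := f)); rewrite tm_res uE.
Qed.
Next Obligation.
move=> P Q f V hV t a /=; case: (cid _) => s /= sE; case: (cid _) => u /= uE.
by apply: (tm_inj (f := f)); rewrite tm_act uE.
Qed.

Program Definition tor_cat : category :=
  @Category (torsor U) (@tor_mor U) tor_id tor_comp _ _ _.
Next Obligation. by move=> *; apply: tor_mor_ext. Qed.
Next Obligation. by move=> *; apply: tor_mor_ext. Qed.
Next Obligation. by move=> *; apply: tor_mor_ext. Qed.

Program Definition tor_gpd : groupoid := @Groupoid tor_cat tor_inv _ _.
Next Obligation.
move=> P Q f; apply: tor_mor_ext => V hV s /=; case: (cid _) => t /= tE.
exact: tm_inj tE.
Qed.
Next Obligation.
by move=> P Q f; apply: tor_mor_ext => V hV s /=; case: (cid _) => t /= tE.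
Qed.
End TorMor.

Section Restriction.
Variables (U V : opens T) (h : V ⊑ U).

Program Definition sheaf_restr (S : sheaf_on U) : sheaf_on V :=
  {| sh_sec W hW := S W (osub_trans h hW);
     sh_res W Z hW hZ k s := sh_res (osub_trans h hZ) k s |}.
Next Obligation. by move=> * /=; apply: sh_res_id. Qed.
Next Obligation. by move=> * /=; apply: sh_res_comp. Qed.
Next Obligation.
move=> S W hW I Z hZ s cov sC /=; apply: sh_glue cov _ => i j Y hi hj hY.
rewrite (Prop_irrelevance hY (osub_trans h (osub_trans (hZ i) hi))).
exact: sC.
Qed.

Program Definition tor_restr (P : torsor U) : torsor V :=
  {| tor_sheaf := sheaf_restr P;
     tor_act W hW s a := tor_act s a |}.
Next Obligation. by move=> * /=; apply: tor_act0. Qed.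
Next Obligation. by move=> * /=; apply: tor_actD. Qed.
Next Obligation. by move=> * /=; apply: tor_act_res. Qed.
Next Obligation.
move=> P x Vx; have [W [hW [Wx [s]]]] := tor_locally_nonempty P (h Vx).
exists (ocap W V), (ocap_r W V); split; first by split.
by constructor; apply: sh_res s; apply: ocap_l.
Qed.
Next Obligation. by move=> * /=; apply: tor_simply_transitive. Qed.

Program Definition tor_mor_restr (P Q : torsor U) (f : tor_mor P Q) :
  tor_mor (tor_restr P) (tor_restr Q) :=
  {| tm_fun W hW s := f W (osub_trans h hW) s |}.
Next Obligation. by move=> * /=; apply: tm_res. Qed.
Next Obligation. by move=> * /=; apply: tm_act. Qed.

Program Definition tor_restr_fun : functor (tor_gpd U) (tor_gpd V) :=
  @Functor (tor_gpd U) (tor_gpd V) tor_restr tor_mor_restr _ _.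
Next Obligation. by move=> *; apply: tor_mor_ext. Qed.
Next Obligation. by move=> *; apply: tor_mor_ext. Qed.
End Restriction.

(* The structure isomorphisms are identities; restricting along [V ⊑ V] only
   replaces a proof of an inclusion by another one. *)
Program Definition tor_restr_id U (h : U ⊑ U) (P : torsor U) :
  tor_mor (tor_restr h P) P :=
  {| tm_fun V hV s :=
       sh_res (hV := osub_trans h hV) hV (osub_refl V) s |}.
Next Obligation. 
move=> U h P V W hV hW k s /=.
exact: etrans (sh_res_comp (s0 := P) _ _ _ _ k s)
  (esym (sh_res_comp (s0 := P) _ _ _ _ k s)).
Qed.
Next Obligation. by move=> * /=; rewrite tor_act_res ab_res_id. Qed.

Program Definition tor_restr_cmp U V W (hVU : V ⊑ U) (hWV : W ⊑ V) (hWU : W ⊑ U)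
    (P : torsor U) : tor_mor (tor_restr hWV (tor_restr hVU P)) (tor_restr hWU P) :=
  {| tm_fun Z hZ s :=
       sh_res (hV := osub_trans hVU (osub_trans hWV hZ))
         (osub_trans hWU hZ) (osub_refl Z) s |}.
Next Obligation.
move=> U V W hVU hWV hWU P Z Y hZ hY k s /=.
exact: etrans (sh_res_comp (s0 := P) _ _ _ _ k s)
  (esym (sh_res_comp (s0 := P) _ _ _ _ k s)).
Qed.
Next Obligation. by move=> * /=; rewrite tor_act_res ab_res_id. Qed.

Program Definition torsors : gpd_presheaf T :=
  @GpdPresheaf T tor_gpd tor_restr_fun tor_restr_id _ tor_restr_cmp _ _ _ _.
Next Obligation. by move=> *; apply: tor_mor_ext => * /=; rewrite tm_res. Qed.
Next Obligation. by move=> *; apply: tor_mor_ext => * /=; rewrite tm_res. Qed.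
Next Obligation. by move=> *; apply: tor_mor_ext. Qed.
Next Obligation. by move=> *; apply: tor_mor_ext. Qed.
Next Obligation.
move=> *; apply: tor_mor_ext => Z hZ s /=.
by rewrite !(sh_res_comp _ _ _ _ (osub_refl Z)).
Qed.

(* The band of [torsors] identifies the automorphism [σ ↦ σ + a] with [a]. *)
Definition acts_by U (P : torsor U) (f : tor_mor P P) (a : A U) : Prop :=
  forall V (hV : V ⊑ U) (s : P V hV), f V hV s = tor_act s (ab_res hV a).
End Torsors.

Definition intertwines (T : topologicalType) (A B : absheaf T) (G : gerbe A)
    (Phi : pseudonat G (torsors B)) (phi : absheaf_hom A B) : Prop :=
  forall U (P : G U) (u : hom P P), acts_by (fhom (Phi U) u) (phi U (gb_band u)).
Section Lifts.
Variables (R : realType) (n : nat) (M : manifold R n).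

Definition dd_gerbe := gerbe (sheaf_circle M).

Record connective_structure (G : dd_gerbe) := ConnectiveStructure {
  cs_mor :> pseudonat G (torsors (sheaf_form M));
  cs_intertwines : intertwines cs_mor (minus_dlog M) }.

(* A connection on the restriction of [P] to [V]. *)
Record connection (U : opens M) (P : torsor (sheaf_smooth M) U) (V : opens M) :=
  Connection {
  cn_form : forall W (hW : W ⊑ U), W ⊑ V -> P W hW -> form W;
  cn_res : forall W Z (hW : W ⊑ U) (hZ : Z ⊑ U) (kW : W ⊑ V) (kZ : Z ⊑ V)
      (h : Z ⊑ W) (s : P W hW),
    cn_form kZ (sh_res hZ h s) = fm_res h (cn_form kW s);
  cn_act : forall W (hW : W ⊑ U) (kW : W ⊑ V) (s : P W hW) (f : smooth W),
    cn_form kW (tor_act s f) = cn_form kW s + ext_d f }.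

Lemma connection_ext (U : opens M) (P : torsor (sheaf_smooth M) U) (V : opens M)
  (p q : connection P V) :
  (forall W (hW : W ⊑ U) (kW : W ⊑ V) (s : P W hW),
     cn_form p kW s = cn_form q kW s) -> p = q.
Proof.
case: p q => [f a b] [g a' b'] /= fg.
have E : f = g by do 3!apply: functional_extensionality_dep => ?;
  apply: functional_extensionality_dep => s; apply: fg.
by case: g / E a' b' {fg} => *; congr Connection; apply: Prop_irrelevance.
Qed.

Program Definition cn_add (U : opens M) (P : torsor (sheaf_smooth M) U)
    (V : opens M) (p : connection P V) (a : form V) : connection P V :=
  {| cn_form W hW kW s := cn_form p kW s + fm_res kW a |}.
Next Obligation.
move=> U P V p a W Z hW hZ kW kZ h s /=; rewrite (cn_res p _ kW).
apply: form_ext => Y hY X /=; congr (_ + fm_op _ _ _); exact: Prop_irrelevance.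
Qed.
Next Obligation. by move=> U P V p a W hW kW s f /=; rewrite cn_act addrAC. Qed.

Variables (G : dd_gerbe) (A : connective_structure G) (xi : vfield (otop M)).

Definition lift_cat : category :=
  @full_sub (pseudonat_cat G (torsors (sheaf_smooth M)))
    (fun F => intertwines F (minus_iota_dlog xi)).

(* The 2-morphism Θ from £_{-ξ}[A] to A⁰ ∘ F, given by its values: a section μ of
   the torsor A(Q) over V is sent to a connection on the restriction of F(Q) to V. *)
Record connective_ext (F : pseudonat G (torsors (sheaf_smooth M))) := ConnectiveExt {
  ce_conn : forall U (Q : G U) V (hV : V ⊑ U),
    (A U Q : torsor (sheaf_form M) U) V hV -> connection (F U Q) V;
  ce_act : forall U (Q : G U) V (hV : V ⊑ U)
      (mu : (A U Q : torsor (sheaf_form M) U) V hV) (a : form V),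
    ce_conn (tor_act mu a) = cn_add (ce_conn mu) (- lie_deriv xi a);
  ce_res : forall U (Q : G U) V V' (hV : V ⊑ U) (hV' : V' ⊑ U) (h : V' ⊑ V)
      (mu : (A U Q : torsor (sheaf_form M) U) V hV)
      W (hW : W ⊑ U) (kW : W ⊑ V) (kW' : W ⊑ V')
      (s : (F U Q : torsor (sheaf_smooth M) U) W hW),
    cn_form (ce_conn (sh_res hV' h mu)) kW' s = cn_form (ce_conn mu) kW s;
  ce_nat : forall U (Q Q' : G U) (f : hom Q Q') V (hV : V ⊑ U)
      (mu : (A U Q : torsor (sheaf_form M) U) V hV)
      W (hW : W ⊑ U) (kW : W ⊑ V)
      (s : (F U Q : torsor (sheaf_smooth M) U) W hW),
    cn_form (ce_conn (tm_fun (fhom (A U) f) mu)) kW (tm_fun (fhom (F U) f) s) =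
    cn_form (ce_conn mu) kW s;
  ce_gp_res : forall U U' (h : U' ⊑ U) (Q : G U) V (hV : V ⊑ U')
      (mu : (A U' (gp_res G h Q) : torsor (sheaf_form M) U') V hV)
      W (hW : W ⊑ U') (kW : W ⊑ V)
      (s : (F U' (gp_res G h Q) : torsor (sheaf_smooth M) U') W hW),
    cn_form (ce_conn (Q := Q) (hV := osub_trans h hV) (tm_fun (gm_iso A h Q) mu))
      (hW := osub_trans h hW) kW (tm_fun (gm_iso F h Q) s) =
    cn_form (ce_conn mu) kW s }.

Program Definition ce_add F (t : connective_ext F) (a : form (otop M)) :
  connective_ext F :=
  {| ce_conn U Q V hV mu := cn_add (ce_conn t mu) (fm_res (osub_top V) a) |}.
Next Obligation.
move=> F t a U Q V hV mu b /=; rewrite ce_act; apply: connection_ext => * /=.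
by rewrite addrAC.
Qed.
Next Obligation.
move=> F t a U Q V V' hV hV' h mu W hW kW kW' s /=; rewrite (ce_res _ _ _ _ kW).
apply: form_ext => Y hY X /=; congr (_ + fm_op _ _ _); exact: Prop_irrelevance.
Qed.
Next Obligation. by move=> * /=; rewrite ce_nat. Qed.
Next Obligation. by move=> * /=; rewrite ce_gp_res. Qed.

Record connective_lift := ConnectiveLift {
  cl_lift : lift_cat;
  cl_ext : connective_ext (sval cl_lift) }.

Definition cl_act (x : connective_lift) (a : form (otop M)) : connective_lift :=
  ConnectiveLift (ce_add (cl_ext x) a).

Definition preserves_ext (x y : connective_lift) (t : hom (cl_lift x) (cl_lift y)) :
    Prop :=
  forall U (Q : G U) V (hV : V ⊑ U) (mu : (A U Q : torsor (sheaf_form M) U) V hV)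
    W (hW : W ⊑ U) (kW : W ⊑ V)
    (s : (sval (cl_lift x) U Q : torsor (sheaf_smooth M) U) W hW),
  cn_form (ce_conn (cl_ext y) mu) kW (tm_fun (md_hom t Q) s) =
  cn_form (ce_conn (cl_ext x) mu) kW s.

Definition cl_hom (x y : connective_lift) : Type :=
  {t : hom (cl_lift x) (cl_lift y) | preserves_ext t}.

Lemma cl_hom_ext x y (s t : cl_hom x y) : sval s = sval t -> s = t.
Proof.
case: s t => [s sP] [t tP] /= E.
by case: t / E tP => tP; congr exist; apply: Prop_irrelevance.
Qed.

Program Definition connective_lift_cat : category :=
  @Category connective_lift cl_hom
    (fun x => exist _ (idm (cl_lift x)) _)
    (fun x y z t s => exist _ (sval t ⊚ sval s) _) _ _ _.
Next Obligation. by []. Qed.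
Next Obligation.
move=> x y z [t tP] [s sP] U Q V hV mu W hW kW r /=.
exact: etrans (tP _ _ _ _ _ _ _ _ _) (sP _ _ _ _ _ _ _ _ _).
Qed.
Next Obligation. by move=> x y f; apply: cl_hom_ext; apply: (comp_idl (sval f)). Qed.
Next Obligation. by move=> x y f; apply: cl_hom_ext; apply: (comp_idr (sval f)). Qed.
Next Obligation.
move=> w x y z h g f; apply: cl_hom_ext.
exact: (comp_assoc (sval h) (sval g) (sval f)).
Qed.

Definition forget_connective : functor connective_lift_cat lift_cat :=
  @Functor connective_lift_cat lift_cat cl_lift (fun x y t => sval t)
    (fun x => erefl) (fun x y z t s => erefl).
End Lifts.

Definition is_torsor_on (A : zmodType) (X : Type) (act : X -> A -> X)
    (S : set X) : Prop :=
  [/\ S !=set0,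
      forall x a, S x -> S (act x a),
      forall x, S x -> act x 0 = x,
      forall x a b, S x -> act x (a + b) = act (act x a) b &
      forall x y, S x -> S y -> exists! a, act x a = y].

Definition aut (C : category) (x : C) : Type := {f : hom x x | is_iso f}.

(* Main.v *)
(* Over a small open set choose an object Q of the gerbe with sections μ of A(Q)
   and σ of F(Q). A 2-morphism Θ is determined there by the form Θ(μ)(σ), and
   replacing (μ, σ) by (μ + a, σ + f) adds df - £_ξ a to it. For another choice
   (Q', μ', σ'), a local isomorphism from Q to Q' compares the data; changing it by
   an automorphism with band g changes (a, f) by (- dlog g, - ι_ξ dlog g), which
   does not affect df - £_ξ a because dlog g is closed. So the local choices give a
   cocycle of 1-forms and an extension Θ is the same as a trivialization of this
   cocycle: one exists by a partition of unity, and two of them differ by a global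
   1-form. An endomorphism of F is a translation by a global function h, and it
   preserves Θ exactly when dh = 0. *)
Require Import Defs.
From HB Require Import structures.
From mathcomp Require Import all_boot all_order all_algebra.
From mathcomp Require Import ring lra.
From mathcomp Require Import boolp classical_sets functions cardinality.
From mathcomp Require Import reals topology normedtype derive.
From mathcomp Require Import landau realfun sequences exp.

Set Implicit Arguments.
Unset Strict Implicit.
Unset Printing Implicit Defensive.

Import Order.TTheory GRing.Theory Num.Theory numFieldNormedType.Exports.
(* MathComp also has constants named [form] and [hom]. *)
Import Defs.
Local Open Scope classical_set_scope.
Local Open Scope ring_scope.

(** * Calculus in several variables *)

(** All local choices are put into one index type, [point]: an object, an open set, and sections μ
    and σ over it. No selection is made, so any two points have to be compared on the whole overlap
    of their domains, where isomorphisms exist only locally. The comparison form is therefore glued,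
    and this is possible because its value does not depend on the isomorphism. In return,
    restriction of sections, the torsor actions, morphisms of the gerbe and restriction of objects
    all become comparisons of two points, and every condition on Θ is an instance of the single
    equation [potential]. The resulting cover is neither countable nor locally finite; second
    countability of M extracts countably many bump functions from it. Forms act on derivations of
    the sheaf of functions, so dh = 0 says something about h in a chart only once the coordinate
    fields are known to be such derivations. That they preserve smooth functions, seen from another
    chart, requires the chain rule for [class_C], a notion made of directional derivatives only. *)

Section Line.
Variables (R : realType) (E : normedModType R).
Implicit Types (f : E -> R) (x v : E).

Lemma is_derive_line (W : normedModType R) (f : E -> W) x v (t : R) :
  derivable f (t *: v + x) v ->
  is_derive t 1 (fun h : R => f (h *: v + x)) ('D_v f (t *: v + x)).
Proof.
move=> df.
have E1 : (fun h : R => h^-1 *: (f ((h *: 1 + t) *: v + x) - f (t *: v + x))) =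
    (fun h : R => h^-1 *: (f (h *: v + (t *: v + x)) - f (t *: v + x))).
  by apply/funext => h; rewrite [h *: 1]mulr1 scalerDl addrA.
by split; [rewrite /derivable E1|rewrite /derive E1].
Qed.

(** Both signs of [b] are allowed because the coordinate steps in [C1_differentiable] have arbitrary
    signs; for [b < 0] the mean value theorem is used on [[b, 0]]. *)
Lemma line_MVT f x v (b : R) :
  (forall t : R, `|t| <= `|b| -> derivable f (t *: v + x) v) ->
  exists2 c : R, `|c| <= `|b| & f (b *: v + x) - f x = b * 'D_v f (c *: v + x).
Proof.
move=> df; pose g (h : R) := f (h *: v + x).
have f0 : f x = g 0 by rewrite /g scale0r add0r.
have dg (t : R) : `|t| <= `|b| -> is_derive t 1 g ('D_v f (t *: v + x)).
  by move=> tb; apply: is_derive_line; apply: df.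
have cg (i : interval R) : {in i, forall t, `|t| <= `|b|} ->
    {within [set` i], continuous g}.
  by move=> ib; apply: derivable_within_continuous => t /ib/dg[].
rewrite f0 -[f (b *: v + x)]/(g b).
have [b0|b0] := leP 0 b.
  have ib t : t \in `[0, b]%R -> `|t| <= `|b|.
    by rewrite in_itv /= => /andP[t0 tb]; rewrite !ger0_norm.
  have [t /subset_itv_oo_cc/ib/dg//||c /ib cb ->] := MVT_segment b0 (f := g)
    (df := fun c => 'D_v f (c *: v + x)).
    exact: cg.
  by exists c => //; rewrite subr0 mulrC.
have ib t : t \in `[b, 0]%R -> `|t| <= `|b|.
  by rewrite in_itv /= => /andP[bt t0]; rewrite !ler0_norm ?lerN2 // ltW.
have [t /subset_itv_oo_cc/ib/dg//||c /ib cb e] := MVT_segment (ltW b0) (f := g)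
  (df := fun c => 'D_v f (c *: v + x)).
  exact: cg.
by exists c => //; rewrite -[LHS]opprB e sub0r mulrN opprK mulrC.
Qed.
End Line.

Section C1.
Variables (R : realType) (n : nat).
Local Notation E := 'rV[R]_n.

Lemma class_C_le j k (A : set E) (f : E -> R) : (j <= k)%N ->
  class_C k A f -> class_C j A f.
Proof.
elim: k => [|k IH]; first by rewrite leqn0 => /eqP ->.
by rewrite leq_eqVlt => /predU1P[->//|jk] /class_CW; apply: IH.
Qed.

(** The chain rule needs a differential, while [class_C] gives only directional derivatives. Along
    each coordinate the increment of [f] is a step times a partial derivative at an intermediate
    point, which continuity brings close to its value at [x]. *)
Lemma C1_differentiable (A : set E) (f : E -> R) x : open A -> A x ->
  (forall v y, A y -> derivable f y v) ->
  (forall v, {for x, continuous ('D_v f)}) ->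
  differentiable f x.
Proof.
move=> oA Ax df cf.
pose L (h : E) : R := \sum_(i < n) h ord0 i * 'D_(delta_mx ord0 i) f x.
have linL : linear L.
  move=> a u v; rewrite /L scaler_sumr -big_split /=; apply: eq_bigr => i _.
  by rewrite !mxE mulrDl -mulrA.
pose LL := GRing.isLinear.Build _ _ _ _ _ linL.
pose L' : {linear E -> R} := HB.pack L LL.
have cL : continuous L'.
  have ci i c (y : E) : {for y, continuous (fun h : E => h ord0 i * c : R)}.
    by apply: continuousM; [apply: coord_continuous|apply: cst_continuous].
  by apply: continuous_big => [|i _ y]; [exact: add_continuous|exact: ci].
suff key : f \o shift x = cst (f x) + L' +o_ (0 : E) id.
  by apply/diff_locallyP; rewrite (diff_unique cL key).
apply/eqaddoP => e e0.
(* The error [e'] occurs once for each of the [n] coordinates; [n.+1] keeps the quotient meaningful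
   for [n = 0]. *)
pose e' : R := e / n.+1%:R.
have e'0 : 0 < e' by rewrite divr_gt0.
have /nbhs_ballP[r /= r0 rP] : \forall y \near x, A y /\ forall i : 'I_n,
    `|'D_(delta_mx ord0 i) f y - 'D_(delta_mx ord0 i) f x| <= e'.
  apply: filterI; first by apply: open_nbhs_nbhs.
  apply: (@filter_forall E _ (fun i y => `|'D_(delta_mx ord0 i) f y - 'D_(delta_mx
    ord0 i) f x| <= e') _ (nbhs_filter x)) => i.
  have /cvgrPdist_le/(_ _ e'0) := cf (delta_mx ord0 i).
  by apply: filterS => y; rewrite distrC.
have bnd (h : E) i : `|h ord0 i| <= `|h|.
  by rewrite [leRHS]/Num.Def.normr /= mx_normrE; apply/bigmax_geP; right => /=;
    exists (ord0, i).
apply/nbhs_ballP; exists r => //= h; rewrite -ball_normE /= sub0r normrN => hr.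
(* Mean value theorem along one coordinate at a time: [p k] keeps the first [k]
   coordinates of the step [h]. *)
pose p k : E := \row_(j < n) (if (j < k)%N then h ord0 j else 0).
(* The norm is the sup norm, so a point whose displacement from [x] is coordinatewise bounded by [h]
   stays in the ball. *)
have pbnd (i : 'I_n) (c : R) : `|c| <= `|h ord0 i| -> ball x r (c *:
  delta_mx ord0 i + (p i + x)).
  move=> ch; rewrite -ball_normE /= opprD addrA addrC opprD addrA subrK.
  rewrite -opprD normrN addrC; apply: le_lt_trans hr.
  rewrite [leLHS]/Num.Def.normr /= mx_normrE; apply: bigmax_le => //= -[j k] _ /=.
  rewrite !mxE ord1 /= ; case: eqP => [->|_]; rewrite ?ltnn ?mulr1 ?mulr0 ?addr0 ?add0r.
    exact: le_trans ch (bnd _ _).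
  by case: ifP => // _; rewrite normr0.
have step (i : 'I_n) : exists2 d : R, `|d - 'D_(delta_mx ord0 i) f x| <= e' &
    f (p i.+1 + x) - f (p i + x) = h ord0 i * d.
  have -> : p i.+1 + x = h ord0 i *: delta_mx ord0 i + (p i + x).
    rewrite addrA; congr (_ + _); apply/rowP => j; rewrite !mxE ltnS leq_eqVlt.
    rewrite eqxx /= -val_eqE /=; case: ltngtP => /=;
      rewrite ?mulr0 ?mulr1 ?add0r ?addr0 //.
    by move=> /val_inj ->.
  have [|c ch ->] := @line_MVT R E f (p i + x) (delta_mx ord0 i) (h ord0 i).
    by move=> t th; apply: df; apply: (rP _ (pbnd i t th)).1.
  exists ('D_(delta_mx ord0 i) f (c *: delta_mx ord0 i + (p i + x))) => //.
  exact: (rP _ (pbnd i c ch)).2.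
have pn : p n = h by apply/rowP => j; rewrite !mxE ltn_ord.
have p0 : p 0 = 0 by apply/rowP => j; rewrite !mxE.
have -> : (f \o shift x - (cst (f x) + L')) h = f (p n + x) - f (p 0%N + x) - L h.
  by rewrite pn p0 add0r -addrA -opprD.
rewrite -(telescope_sumr (fun k => f (p k + x))) // big_mkord -sumrB.
apply: (@le_trans _ _ (\sum_(i < n) e' * `|h|)).
  apply: (le_trans (ler_norm_sum _ _ _)); apply: ler_sum => i _.
  have [d dP ->] := step i; rewrite -mulrBr normrM mulrC.
  by apply: ler_pM.
rewrite sumr_const card_ord -mulr_natr mulrAC ler_wpM2r //.
by rewrite /e' mulrAC ler_pdivrMr // ler_pM2l // ler_nat.
Qed.

Lemma class_C1_differentiable (A : set E) f x : open A -> A x ->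
  class_C 1 A f -> differentiable f x.
Proof.
move=> oA Ax [_ fD]; apply: (C1_differentiable oA Ax) => [v y Ay|v].
  by apply: (fD v).1 Ay.
by apply: (fD v).2.1 Ax.
Qed.
End C1.

Section Composition.
Variables (R : realType) (m n : nat).
Local Notation E := 'rV[R]_n.
Local Notation F := 'rV[R]_m.

(** Only the derivative of [t] along [v] is given, so [t] is replaced by the curve
    [s |-> t (s v + x)], which is differentiable at 0; [g], of class C1, has a full differential at
    [t x]. *)
Lemma is_derive_comp (B : set F) (g : F -> R) (t : E -> F) x v :
  open B -> B (t x) -> class_C 1 B g ->
  (forall i, derivable (fun y => t y ord0 i) x v) ->
  is_derive x v (g \o t)
    (\sum_(i < m) 'D_(delta_mx ord0 i) g (t x) * 'D_v (fun y => t y ord0 i) x).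
Proof.
move=> oB Bx gC td.
have dt : derivable t x v by apply/derivable_mxP => i j; rewrite ord1; apply: td.
have dg := class_C1_differentiable oB Bx gC.
pose h (s : R) := t (s *: v + x).
have hE : h 0 = t x by rewrite /h scale0r add0r.
have dh : differentiable h 0.
  by apply/derivable1_diffP; exact: (derivable1P t x v).1 dt.
have dg0 : differentiable g (h 0) by rewrite hE.
have dgh : differentiable (g \o h) 0 by apply: differentiable_comp.
have dgt : derivable (g \o t) x v by apply/derivable1P;
  exact: (derivable1_diffP (g \o h) 0).2 dgh.
split=> //.
have line (W : normedModType R) (k : E -> W) : derivable k x v ->
    'D_v k x = 'D_1 (fun s : R => k (s *: v + x)) 0.
  move=> dk; have := @is_derive_line R E W k x v 0.
  by rewrite scale0r add0r => /(_ dk)[].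
rewrite line //; have h' : 'd h 0 1 = 'D_v t x by rewrite -deriveE // line.
have e1 : 'D_1 (g \o h) 0 = 'd (g \o h) 0 1  by apply: deriveE.
apply: (etrans e1); rewrite diff_comp //=.
rewrite h' hE derive_mx //.
set w := \matrix_(i, j) _.
have -> : w = \sum_(i < m) w ord0 i *: delta_mx ord0 i.
  by rewrite [LHS]matrix_sum_delta big_ord1.
rewrite linear_sum; apply: eq_bigr => i _.
by rewrite linearZ /= -deriveE // mulrC mxE.
Qed.

Lemma class_C_sum k (A : set E) (I : Type) (r : seq I) (f : I -> E -> R) :
  open A -> (forall i, class_C k A (f i)) ->
  class_C k A (fun x => \sum_(i <- r) f i x).
Proof.
move=> oA fC; elim: r => [|i r IH].
  by apply: class_C_eq (class_C_cst k A 0) => // x _; rewrite big_nil.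
by apply: class_C_eq (class_CD oA (fC i) IH) => // x _ /=; rewrite big_cons.
Qed.

(** A derivative of [g \o t] is a sum of products of partial derivatives of [g], composed with [t],
    and derivatives of [t]; so the induction runs over all [g]. The drop by one order is harmless
    for smooth functions. *)
Lemma class_C_comp k (A : set E) (B : set F) (g : F -> R) (t : E -> F) :
  open A -> open B -> (forall x, A x -> B (t x)) -> class_C k.+1 B g ->
  (forall i, class_C k A (fun y => t y ord0 i)) -> class_C k A (g \o t).
Proof.
move=> oA oB AB; elim: k g => [|k IH] g gC tC.
  split=> // x Ax; apply: continuous_comp; last exact:
    class_C_continuous gC _ (AB _ Ax).
  apply: (@cvgrPdist_le _ _ _ _ (nbhs_filter x) t (t x)).2 => e e0.
  have tC' : \forall y \near x, forall j, `|t x ord0 j - t y ord0 j| <= e.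
    apply: (@filter_forall E _ (fun j y => `|t x ord0 j - t y ord0 j| <= e) _
      (nbhs_filter x)) => j.
    by have /cvgrPdist_le/(_ _ e0) := class_C_continuous (tC j) Ax.
  apply: filterS tC' => y ty.
  rewrite [leLHS]/Num.Def.normr /= mx_normrE; apply: bigmax_le; first exact: ltW.
  by move=> [i j] _; rewrite /= !mxE ord1.
split=> [|v].
  by apply: (class_C_continuous (IH _ (class_CW gC) (fun i => class_CW (tC i)))).
have tD i := (tC i).2 v.
have H x : A x -> is_derive x v (g \o t)
    (\sum_(i < m) 'D_(delta_mx ord0 i) g (t x) * 'D_v (fun y => t y ord0 i) x).
  move=> Ax; apply: (is_derive_comp oB (AB _ Ax)) => [|i]; last exact: (tD i).1.
  exact: class_C_le gC.
split=> [x /H[]//|].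
apply: (@class_C_eq _ _ _ _ _ (fun x => \sum_(i < m) 'D_(delta_mx ord0 i) g
  (t x) * 'D_v (fun y => t y ord0 i) x)) => //.
  by move=> x /H[_ ->].
apply: class_C_sum => // i; apply: class_CM => //; last exact: (tD i).2.
exact: IH (gC.2 _).2 (fun i => class_CW (tC i)).
Qed.

End Composition.

(** * Inverses, flat functions and functions with zero derivatives *)

Section FlatFunctions.
Variables (R : realType) (n : nat).
Local Notation E := 'rV[R]_n.

Lemma class_CV k (A : set E) (f : E -> R) : open A ->
  (forall x, A x -> f x != 0) -> class_C k A f -> class_C k A (fun x => (f x)^-1).
Proof.
move=> oA f0; elim: k => [|k IH] fC.
  split=> // x Ax; apply: continuousV (f0 x Ax) _.
  by apply: (class_C_continuous fC).
have IH' := IH (class_CW fC).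
split=> [x Ax|v]; first by apply: (class_C_continuous IH').
have [df Df] := fC.2 v.
split=> [x Ax|]; first exact: derivableV (f0 x Ax) (df x Ax).
have H := class_CM oA (class_CM oA (class_C_cst k A (-1)) (class_CM oA IH' IH')) Df.
apply: class_C_eq H => // x Ax /=.
by rewrite (deriveV (f0 x Ax) (df x Ax)) mulN1r -expr2 exprVn.
Qed.

(* The functions [flat j] span a space closed under differentiation. *)
Definition flat (j : nat) (t : R) : R :=
  if 0 < t then t^-1 ^+ j * expR (- t^-1) else 0.

Lemma flat_gt0 j t : 0 < t -> 0 < flat j t.
Proof. by move=> t0; rewrite /flat t0 mulr_gt0 ?expR_gt0 ?exprn_gt0 ?invr_gt0. Qed.

Lemma flat_ge0 j t : 0 <= flat j t.
Proof. by have [t0|t0] := ltP 0 t; [exact/ltW/flat_gt0|rewrite /flat ltNge t0]. Qed.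

Lemma flat_eq0 j t : t <= 0 -> flat j t = 0.
Proof. by move=> t0; rewrite /flat ltNge t0. Qed.

(** Comes from exp s >= s^(j+2) / (j+2)! at s = 1/t. The two extra powers leave the factor t^2,
    which forces the derivative at 0 to vanish. *)
Lemma flat_bound j t : flat j t <= j.+2`!%:R * t ^+ 2.
Proof.
have [t0|t0] := ltP 0 t; last by rewrite flat_eq0 // mulr_ge0 ?sqr_ge0.
have s0 : 0 <= t^-1 by rewrite invr_ge0 ltW.
have := expR_ge1Dxn j.+1 s0; rewrite /flat t0.
have f0 : 0 < j.+2`!%:R :> R by rewrite ltr0n fact_gt0.
move: s0; have : t^-1 * t = 1 by rewrite mulVf ?gt_eqF.
rewrite expRN; move: (expR_gt0 t^-1); move: (expR _) => e e0.
move: (t^-1) => s st s0 H.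
have {}H : s ^+ j.+2 <= e * j.+2`!%:R.
  rewrite -ler_pdivrMr //; apply: le_trans H; by rewrite lerDr.
have -> : s ^+ j = s ^+ j.+2 * t ^+ 2.
  by rewrite -addn2 exprD -mulrA -exprMn st expr1n mulr1.
by rewrite ler_pdivrMr // [leRHS]mulrAC; apply: ler_wpM2r; rewrite ?sqr_ge0 // mulrC.
Qed.

Lemma is_derive_flat j (t : R) :
  is_derive t 1 (flat j) (flat j.+2 t - j%:R * flat j.+1 t).
Proof.
have [t0|t0|->] := ltrgt0P t.
- have fE : \forall y \near t, y^-1 ^+ j * expR (- y^-1) = flat j y.
    near=> y; rewrite /flat; case: ifPn => // /negP[]; near: y.
    exact: lt_nbhsr.
  apply: near_eq_is_derive fE _.
  have tn0 : t != 0 by rewrite gt_eqF.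
  have dV : is_derive t 1 (fun y : R => y^-1) (- t ^- 2).
    by apply: is_derive_eq (is_deriveV (f := id) tn0 (is_derive_id _ _)) _;
      rewrite [_ *: _]mulr1.
  have dE : is_derive t 1 (fun y : R => expR (- y^-1)) (expR (- t^-1) * t ^- 2).
    have dN : is_derive t 1 (fun y : R => - y^-1) (- - t ^- 2) by exact: is_deriveN.
    have := is_derive1_comp (f := expR) (g := fun y :
      R => - y^-1) (is_derive_expR _) dN.
    by rewrite opprK.
  have := is_deriveM (is_deriveX j dV) dE.
  rewrite exprfctE => H.
  split; [by case: H|apply: etrans (@derive_val _ _ _ _ _ _ _ H) _].
  rewrite /flat t0 /= /GRing.scale /= -exprVn.
  case: j {H} => [|j] /=.
    by rewrite !expr0 expr1 !mul0r; ring.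
  by rewrite -mulr_natl !exprS; ring.
- have fE : \forall y \near t, cst 0 y = flat j y.
    near=> y; rewrite flat_eq0 //; apply: ltW; near: y.
    exact: lt_nbhsl.
  apply: near_eq_is_derive fE _.
  by rewrite !flat_eq0 ?ltW // mulr0 subrr; exact: is_derive_cst.
(* At 0 the difference quotient is bounded by a constant times [|h|], by [flat_bound]. *)
have lim0 : (fun h : R => h^-1 *: (flat j (h *: 1 + 0) - flat j 0)) @ 0^' --> (0 : R).
  apply/cvgrPdist_le => e e0; near=> h.
  have hn0 : h != 0 by near: h; exact: nbhs_dnbhs_neq.
  rewrite addr0 [_ *: 1]mulr1 [flat j 0]flat_eq0 // subr0 sub0r normrN normrM.
  rewrite normfV (ger0_norm (flat_ge0 _ _)) mulrC ler_pdivrMr ?normr_gt0 //.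
  apply: (le_trans (flat_bound _ _)).
  rewrite -real_normK ?num_real // expr2 mulrA ler_wpM2r //.
  rewrite mulrC -ler_pdivlMr ?ltr0n ?fact_gt0 //.
  near: h; apply: dnbhs0_le; by rewrite divr_gt0 // ltr0n fact_gt0.
rewrite !flat_eq0 // mulr0 subrr; split; first by apply/cvg_ex; exists 0.
exact: cvg_lim lim0.
Unshelve. all: by end_near.
Qed.

(** The induction on [k] treats all [j] at once, since differentiating [flat j] produces [flat j.+1]
    and [flat j.+2]. *)
Lemma class_C_flat k j (A : set E) (f : E -> R) : open A ->
  class_C k A f -> class_C k A (flat j \o f).
Proof.
move=> oA; elim: k j => [|k IH] j fC.
  split=> // x Ax; apply: continuous_comp; first by apply: (class_C_continuous fC).
  by apply/differentiable_continuous/derivable1_diffP;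
    have [] := is_derive_flat j (f x).
split=> [x Ax|v]; first by apply: (class_C_continuous (IH j (class_CW fC))).
have [df Df] := fC.2 v.
have H x : A x -> is_derive x v (flat j \o f)
    ((flat j.+2 (f x) - j%:R * flat j.+1 (f x)) * 'D_v f x).
  move=> Ax; pose h (s : R) := f (s *: v + x).
  have h0 : h 0 = f x by rewrite /h scale0r add0r.
  have dh : is_derive (0 : R) (1 : R) h ('D_v f x).
    by have := @is_derive_line R E _ f x v 0; rewrite scale0r add0r; apply; apply: df.
  have d := is_derive1_comp (is_derive_flat j (h 0)) dh.
  have dg : derivable (flat j \o f) x v by apply/derivable1P; case: d.
  split=> //.
  have := @is_derive_line R E _ (flat j \o f) x v 0;
    rewrite scale0r add0r => /(_ dg)[_ <-].
  by case: d => _ ->; rewrite h0.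
split=> [x /H[]//|].
apply: (@class_C_eq _ _ _ _ _ (fun x => (flat j.+2 (f x) - j%:R * flat j.+1
  (f x)) * 'D_v f x)) => //.
  by move=> x /H[_ ->].
apply: class_CM => //; have fW := class_CW fC.
have := class_CD oA (IH j.+2 fW) (class_CM oA (class_C_cst k A (- j%:R)) (IH j.+1 fW)).
by apply: class_C_eq => // x Ax /=; rewrite mulNr.
Qed.

Lemma derive0_near_cst (A : set E) (f : E -> R) x : open A -> A x ->
  (forall v y, A y -> is_derive y v f 0) -> \forall y \near x, f y = f x.
Proof.
move=> oA Ax df; have /nbhs_ballP[r /= r0 rA] : nbhs x A by apply: open_nbhs_nbhs.
apply/nbhs_ballP; exists r => //= y xy.
have yA t : `|t| <= `|1 : R| -> A (t *: (y - x) + x).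
  rewrite normr1 => t1; apply: rA; move: xy; rewrite -ball_normE /=.
  rewrite distrC opprD addrCA subrr addr0 normrN normrZ; apply: le_lt_trans.
  by rewrite -[leRHS]mul1r ler_wpM2r.
have [t /yA/(df (y - x))[]//|t /yA/(df (y - x))[_ ->]] :=
  @line_MVT R E f x (y - x) 1.
by rewrite scale1r subrK mulr0 => /eqP; rewrite subr_eq0 => /eqP.
Qed.
End FlatFunctions.

(** * Partitions of unity and cocycles of 1-forms *)

Section AbSheafTheory.
Variables (T : topologicalType) (A : absheaf T).
Implicit Types U V W Z : opens T.

Lemma ab_res0 U V (h : V ⊑ U) : ab_res h (0 : A U) = 0.
Proof. by apply: (addrI (ab_res h 0)); rewrite -ab_resD !addr0. Qed.

Lemma ab_resN U V (h : V ⊑ U) (a : A U) : ab_res h (- a) = - ab_res h a.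
Proof. by apply: (addrI (ab_res h a)); rewrite -ab_resD !subrr ab_res0. Qed.

Lemma ab_resB U V (h : V ⊑ U) (a b : A U) :
  ab_res h (a - b) = ab_res h a - ab_res h b.
Proof. by rewrite ab_resD ab_resN. Qed.

Lemma ab_res_sum U V (h : V ⊑ U) (I : Type) (r : seq I) (a : I -> A U) :
  ab_res h (\sum_(i <- r) a i) = \sum_(i <- r) ab_res h (a i).
Proof.
by elim: r => [|i r IH]; rewrite ?big_nil ?ab_res0 // !big_cons ab_resD IH.
Qed.

Lemma ab_res_irr U V (h k : V ⊑ U) (a : A U) : ab_res h a = ab_res k a.
Proof. by rewrite (Prop_irrelevance h k). Qed.

Lemma ab_sep U (I : Type) (W : I -> opens T) (a b : A U) : ocover U W ->
  (forall i (h : W i ⊑ U), ab_res h a = ab_res h b) -> a = b.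
Proof.
move=> cov ab.
have [i j V hi hj|s [_ us]] := ab_glue (a := fun i => ab_res (cov.1 i) b) cov.
  by rewrite !(ab_res_comp _ _ (osub_trans (cov.1 i) hi)).
by rewrite -(us a) ?(us b) // => i h; rewrite ?ab; apply: ab_res_irr.
Qed.

Lemma ocover_ocap U (I : Type) (W : I -> opens T) :
  (forall x, op_set U x -> exists i, op_set (W i) x) -> ocover U (fun i => ocap U
    (W i)).
Proof. by move=> cov; split=> [i|x Ux]; [apply: ocap_l|have [i ?] := cov x Ux;
  exists i]. Qed.

(** Suited to equalities that hold only after shrinking around each point until isomorphisms exist.
    The cover consists of all the sets [W] that work, so none has to be chosen. *)
Lemma ab_sep_local U (a b : A U) :
  (forall x, op_set U x -> exists W, op_set W x /\
     forall Z (h : Z ⊑ U), Z ⊑ W -> ab_res h a = ab_res h b) -> a = b.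
Proof.
move=> loc; pose I := {W | forall Z (h : Z ⊑ U), Z ⊑ W -> ab_res h a = ab_res h b}.
apply: (@ab_sep U I (fun i => ocap U (sval i))) => [|i h].
  by apply: ocover_ocap => x /loc[W [Wx WP]]; exists (exist _ W WP).
by apply: (svalP i); apply: ocap_r.
Qed.

End AbSheafTheory.

(** * Bump functions *)

Section Bumps.
Variables (R : realType) (n : nat) (M : manifold R n).
Implicit Types U V W Z : opens M.
Local Notation E := 'rV[R]_n.

Definition chart_dom (c : chart R M n) : opens M := Opens (ch_dom_open c).

Lemma smooth_inv U (f : smooth U) : (forall x, f x != 0) ->
  exists g : smooth U, forall x, g x = (f x)^-1.
Proof.
move=> f0; suff gs : (fun x => (f x)^-1) \in smooth_pred (U := U) by exists (Smooth gs).
apply/asboolP => c ca; have [h hs hf] := smoothP f ca.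
exists (fun y => (h y)^-1) => [k|x xc]; last by rewrite hf.
apply: class_CV (hs k); first exact: chart_open.
move=> y [cy Uy]; have := f0 (oelt Uy); rewrite hf /= ?ch_invK //.
exact: ch_inv_fun.
Qed.

Lemma smooth_flat U j (f : smooth U) :
  exists g : smooth U, forall x, g x = flat j (f x).
Proof.
suff gs : (flat j \o f) \in smooth_pred (U := U) by exists (Smooth gs).
apply/asboolP => c ca; have [h hs hf] := smoothP f ca.
exists (flat j \o h) => [k|x xc]; last by rewrite /= hf.
by apply: class_C_flat (hs k); apply: chart_open.
Qed.

Lemma smooth_coord c (i : 'I_n) : mf_atlas c ->
  exists g : smooth (chart_dom c), forall x, g x = ch_map c (val x) ord0 i.
Proof.
move=> ca.
suff gs : (fun x : chart_dom c => ch_map c (val x) ord0 i) \in smooth_pred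
  (U := chart_dom c) by exists (Smooth gs).
apply/asboolP => d da; exists (fun y => ch_map c (ch_inv d y) ord0 i).
  exact: mf_compat.
by move=> x xd; rewrite ch_mapK.
Qed.

Lemma smooth_sum U (I : Type) (r : seq I) (f : I -> smooth U) x :
  (\sum_(i <- r) f i) x = \sum_(i <- r) f i x.
Proof. by elim: r => [|i r IH]; rewrite ?big_nil // !big_cons -IH. Qed.

(** The open set [C], which covers M together with [U], expresses that the support of [f] lies in
    [U] in a form suited to gluing with 0. *)
Lemma bump x U : op_set U x -> exists (f : smooth (otop M)) V C,
  [/\ op_set V x, smooth_res (osub_top V) f = 1, smooth_res (osub_top C) f = 0 &
      forall y, op_set U y \/ op_set C y].
Proof.
move=> Ux; have [c ca cx] := mf_cover x.
pose p := ch_map c x.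
have [r r0 rU] : exists2 r : R, 0 < r & forall y, `|p - y| <= r -> ch_cod c y /\
  op_set U (ch_inv c y).
  have : nbhs p (ch_cod c `&` ch_inv c @^-1` op_set U).
    apply: open_nbhs_nbhs; split; first exact: chart_open.
    by split; [exact: ch_map_fun|rewrite /= ch_mapK].
  move=> /nbhs_ballP[e /= e0 eU]; exists (e / 2); first by rewrite divr_gt0.
  move=> y ye; apply: eU; rewrite -ball_normE /=; apply: le_lt_trans ye _.
  by rewrite ltr_pdivrMr // ltr_pMr // ltr1n.
(* [K] is compact, hence closed because M is Hausdorff. Its complement [C] and the chart domain
   cover M, so a function on the chart domain that vanishes over [C] extends by 0. *)
pose K := ch_inv c @` closed_ball p r.
have Kcl : closed K.
  apply: compact_closed; first exact: mf_hausdorff.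
  apply: continuous_compact.
    apply: continuous_in_subspaceT => y; rewrite inE closed_ballE // => yr.
    exact: ch_inv_cont (rU y yr).1.
  apply: bounded_closed_compact; last exact: closed_ball_closed.
  exists (`|p| + r); split; first exact: num_real.
  move=> m pm y; rewrite closed_ballE //= /closed_ball_ /= => yr.
  apply: le_trans (ltW pm); rewrite -[y](subrK p) addrC.
  by apply: (le_trans (ler_normD _ _)); rewrite lerD2l distrC.
pose C := Opens (closed_openC Kcl).
have [co coE] := choice (fun i => smooth_coord i ca).
(* The squared Euclidean distance to [p] is smooth, unlike the sup norm that defines the balls.
   Outside the closed sup-ball of radius [r] some coordinate alone makes [q] exceed [r ^+ 2]. *)
pose q := \sum_(i < n) (co i - smooth_cst _ (p ord0 i)) * (co i - smooth_cst _
  (p ord0 i)).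
have qE y : q y = \sum_(i < n) (ch_map c (val y) ord0 i - p ord0 i) ^+ 2.
  rewrite smooth_sum; apply: eq_bigr => i _.
  by rewrite -[LHS]/((co i y - p ord0 i) * (co i y - p ord0 i)) coE.
pose s := r ^+ 2.
have s0 : 0 < s by rewrite exprn_gt0.
have [a aE] := smooth_flat 0 (smooth_cst (chart_dom c) s - q).
have [b bE] := smooth_flat 0 (q - smooth_cst (chart_dom c) (s / 2)).
have {}aE y : a y = flat 0 (s - q y) by exact: aE.
have {}bE y : b y = flat 0 (q y - s / 2) by exact: bE.
have ab0 y : (a + b) y != 0.
  rewrite -[(a + b) y]/(a y + b y) aE bE.
  have [qs|qs] := ltP (q y) s.
    by rewrite gt_eqF // ltr_pwDl ?flat_ge0 // flat_gt0 // subr_gt0.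
  rewrite gt_eqF // ltr_wpDl ?flat_ge0 // flat_gt0 // subr_gt0.
  by apply: lt_le_trans qs; rewrite ltr_pdivrMr // ltr_pMr // ltr1n.
have [g gE] := smooth_inv ab0.
(* [u = a / (a + b)] is 0 where [q >= s] and 1 where [q <= s / 2]. *)
pose u := a * g.
have uE y : u y = a y / (a y + b y) by rewrite -[u y]/(a y * g y) gE.
have u0 y : op_set C (val y) -> u y = 0.
  move=> Cy; rewrite uE aE flat_eq0 ?mul0r // subr_le0 leNgt.
  apply/negP => qs; apply: Cy; exists (ch_map c (val y)); last first.
    by rewrite ch_mapK //; exact: (set_mem (valP y)).
  rewrite closed_ballE //= /closed_ball_ /= leNgt; apply/negP.
  rewrite [ltRHS]/Num.Def.normr /= mx_normrE => /bigmax_gtP[|[[j i] _ /=]].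
    by rewrite ltNge ltW.
  rewrite ord1 !mxE => ri.
  move: qs; rewrite qE ltNge => /negP; apply.
  rewrite (bigD1 i) //= -[leLHS]addr0 lerD //.
    rewrite distrC in ri; rewrite -[leRHS]real_normK ?num_real // lerXn2r ?nnegrE ?ltW
      //.
    exact: lt_trans ri.
  by apply: sumr_ge0 => k _; rewrite sqr_ge0.
(* On the sup-ball of radius [t], [q] is at most [n t^2], and this [t] makes [n t^2 <= r^2 / 2]. *)
pose t := r / (2 * n.+1%:R).
have t0 : 0 < t by rewrite divr_gt0 // mulr_gt0.
have oV : open (ch_dom c `&` ch_map c @^-1` ball p t).
  rewrite openE => y [cy ty]; apply: filterI.
    by apply: open_nbhs_nbhs; split=> //; apply: ch_dom_open.
  have H : nbhs (ch_map c y) (ball p t).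
    by apply: open_nbhs_nbhs; split=> //; apply: ball_open.
  exact: (ch_map_cont cy) H.
pose V := Opens oV.
have u1 y : op_set V (val y) -> u y = 1.
  move=> [cy yt]; have {}yt : `|p - ch_map c (val y)| < t.
    by move: yt; rewrite /= -ball_normE.
  have b0 : b y = 0.
    rewrite bE flat_eq0 // subr_le0 qE.
    apply: (@le_trans _ _ (\sum_(i < n) t ^+ 2)).
      apply: ler_sum => i _; rewrite -[leLHS]real_normK ?num_real //.
      rewrite lerXn2r ?nnegrE // ?ltW //; apply: le_lt_trans yt.
      rewrite distrC [leRHS]/Num.Def.normr /= mx_normrE; apply/bigmax_geP; right => /=.
      by exists (ord0, i) => //; rewrite !mxE.
    rewrite sumr_const card_ord -[_ *+ n]mulr_natr /t /s.
    rewrite expr_div_n -mulrA; apply: ler_wpM2l; first exact: sqr_ge0.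
    rewrite ler_pdivrMl; last by rewrite exprn_gt0 // mulr_gt0.
    have : (n%:R : R) <= n.+1%:R by rewrite ler_nat.
    have : 1 <= n.+1%:R :> R by rewrite ler1n.
    by move: (n%:R : R) (n.+1%:R : R) => ? ?; nra.
  by move: (ab0 y); rewrite uE -[(a + b) y]/(a y + b y) b0 addr0 => a0; rewrite divff.
have cov : ocover (otop M) (fun i : bool => if i then chart_dom c else C).
  split=> [i z _ //|z _].
  have [Kz|Kz] := pselect (K z); last by exists false.
  by exists true; case: Kz => w; rewrite closed_ballE // => wr <-;
    exact: ch_inv_fun (rU w wr).1.
have [|f [fE _]] := smooth_glue (f := fun i => if i as i return smooth
  (if i then chart_dom c else C) then u else 0) cov.
  move=> [] [] Z hi hj; apply: smooth_ext => z /=.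
  - by congr (u _); apply: val_inj.
  - by apply: u0; apply: hj; exact: (set_mem (valP z)).
  - by apply/esym/u0; apply: hi; exact: (set_mem (valP z)).
  - by [].
have fc (y : chart_dom c) : f (oincl (osub_top _) y) = u y.
  by rewrite -(fE true (osub_top _)).
have fC (y : C) : f (oincl (osub_top _) y) = 0.
  by rewrite -[RHS]/((0 : smooth C) y) -(fE false (osub_top _)).
exists f, V, C; split.
- by split=> //=; exact: ballxx.
- apply: smooth_ext => y; rewrite -[RHS]/(1 : R) /=.
  have cy : op_set (chart_dom c) (val y) := (set_mem (valP y)).1.
  have := fc (oelt cy); rewrite u1; last exact: (set_mem (valP y)).
  by move=> <-; congr (f _); apply: val_inj.
- by apply: smooth_ext => y; rewrite -[RHS](fC y).
- move=> y; have [Ky|Ky] := pselect (K y); last by right.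
  by left; case: Ky => w; rewrite closed_ballE // => wr <-; exact: (rU w wr).2.
Qed.

End Bumps.

Section Partition.
Variables (R : realType) (n : nat) (M : manifold R n).
Implicit Types U V W Z : opens M.

(** Shows that the weights of [partition_of_unity] add up to 1 wherever one of the factors [1 - f j]
    vanishes. *)
Lemma sumr_telescope_prod (A : comPzRingType) (f : nat -> A) m :
  \sum_(k < m) f k * \prod_(j < k) (1 - f j) = 1 - \prod_(j < m) (1 - f j).
Proof.
elim: m => [|m IH]; first by rewrite !big_ord0 subrr.
by rewrite big_ord_recr /= IH big_ord_recr /=; ring.
Qed.

Lemma smooth_res_sum U V (h : V ⊑ U) (I : Type) (r : seq I) (f : I -> smooth U) :
  smooth_res h (\sum_(i <- r) f i) = \sum_(i <- r) smooth_res h (f i).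
Proof. exact: (@ab_res_sum _ (sheaf_smooth M)). Qed.

Lemma smooth_res1 U V (h : V ⊑ U) : smooth_res h 1 = 1.
Proof. exact: smooth_ext. Qed.

Lemma smooth_res_prod U V (h : V ⊑ U) (I : Type) (r : seq I) (f : I -> smooth U) :
  smooth_res h (\prod_(i <- r) f i) = \prod_(i <- r) smooth_res h (f i).
Proof.
by elim: r => [|i r IH]; rewrite ?big_nil ?smooth_res1 // !big_cons smooth_resM IH.
Qed.

(** Second countability takes the place of paracompactness: each point has a basic neighbourhood on
    which some bump is equal to 1, so one bump per basic open set is enough. Local finiteness is not
    obtained here but from the products in [partition_of_unity]. *)
Lemma countable_bumps (I : Type) (U : I -> opens M) (i0 : I) :
  (forall x, exists i, op_set (U i) x) ->
  exists (i_ : nat -> I) (f : nat -> smooth (otop M)) (V C : nat -> opens M),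
    [/\ forall k, smooth_res (osub_top (V k)) (f k) = 1,
        forall k, smooth_res (osub_top (C k)) (f k) = 0,
        forall k x, op_set (U (i_ k)) x \/ op_set (C k) x &
        forall x, exists k, op_set (V k) x].
Proof.
move=> cov; have [B cB [oB BP]] := @mf_second_countable _ _ M.
have [e eB] : exists e : nat -> set M, forall b, B b -> exists k, e k = b.
  have [->|/set0P[b0 Bb0]] := eqVneq B set0; first by exists (fun=> set0).
  have /countable_injP[g gI] := cB.
  exists (fun k => if pselect (exists2 b, B b & g b = k) is left H then projT1
    (cid2 H) else set0).
  move=> b Bb; exists (g b); case: pselect => [H|[]]; last by exists b.
  case: (cid2 H) => b' /= Bb' gb.
  by apply: gI gb; rewrite inE.
(* [d k] is a bump equal to 1 on the [k]-th basic open set, if there is one. *)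
pose good (d : I * smooth (otop M) * opens M * opens M) :=
  [/\ smooth_res (osub_top d.1.2) d.1.1.2 = 1, smooth_res (osub_top d.2) d.1.1.2 = 0 &
      forall x, op_set (U d.1.1.1) x \/ op_set d.2 x].
(* Default for basic sets that no bump serves: the zero function, equal to 1 on the empty set and to
   0 on all of M. *)
have good0 : good (i0, 0, Opens open0, otop M).
  split=> /=; last by right.
    by apply: smooth_ext => y; case: (set_mem (valP y)).
  exact: smooth_ext.
have /choice[d dP] : forall k, exists dk, good dk /\
    ((exists2 d', good d' & e k `<=` op_set d'.1.2) -> e k `<=` op_set dk.1.2).
  move=> k.
  have [[d' gd' ed']|nd] := pselect (exists2 d', good d' & e k `<=` op_set d'.1.2).
    by exists d'.
  by exists (i0, 0, Opens open0, otop M); split.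
exists (fun k => (d k).1.1.1), (fun k => (d k).1.1.2), (fun k => (d k).1.2),
  (fun k => (d k).2).
split=> [k|k|k|x]; try by have [[]] := dP k.
have [i Ux] := cov x; have [f [V [C [Vx fV fC UC]]]] := bump Ux.
have nV : nbhs x (op_set V) by apply: open_nbhs_nbhs; split=> //; apply: op_open.
have [b [Bb bx] bV] := BP x _ nV; have [k ek] := eB b Bb.
exists k; apply: (dP k).2; last by rewrite ek.
by exists (i, f, V, C); rewrite ?ek.
Qed.

(* The weights [f k * \prod_(j < k) (1 - f j)] vanish wherever an earlier bump is
   equal to 1; thus they are locally finite and need no normalization. *)
Lemma partition_of_unity (I : Type) (U : I -> opens M) (i0 : I) :
  (forall x, exists i, op_set (U i) x) ->
  exists (i_ : nat -> I) (f : nat -> smooth (otop M)) (V C : nat -> opens M),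
    [/\ forall k, smooth_res (osub_top (C k)) (f k) = 0,
        forall k x, op_set (U (i_ k)) x \/ op_set (C k) x,
        forall x, exists k, op_set (V k) x,
        forall k m, (m < k)%N -> smooth_res (osub_top (V m)) (f k) = 0 &
        forall m, \sum_(k < m.+1) smooth_res (osub_top (V m)) (f k) = 1].
Proof.
move=> cov; have [i_ [f [V [C [fV fC UC Vcov]]]]] := countable_bumps i0 cov.
exists i_, (fun k => f k * \prod_(j < k) (1 - f j)), V, C; split=> //.
- by move=> k; rewrite smooth_resM fC mul0r.
- move=> k m mk; rewrite smooth_resM smooth_res_prod (bigD1 (Ordinal mk)) //=.
  by rewrite smooth_resB fV smooth_res1 subrr mul0r mulr0.
- move=> m; rewrite -smooth_res_sum sumr_telescope_prod smooth_resB smooth_res1.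
  by rewrite smooth_res_prod big_ord_recr /= smooth_resB fV smooth_res1 subrr mulr0
    subr0.
Qed.

Local Notation Om := (sheaf_form M).

Lemma fm_res_id U (h : U ⊑ U) (a : form U) : fm_res h a = a.
Proof. exact: (@ab_res_id _ Om). Qed.

Lemma fm_res_comp U V W (hVU : V ⊑ U) (hWV : W ⊑ V) (hWU : W ⊑ U) (a : form U) :
  fm_res hWV (fm_res hVU a) = fm_res hWU a.
Proof. exact: (@ab_res_comp _ Om). Qed.

Lemma fm_res0 U V (h : V ⊑ U) : fm_res h 0 = 0.
Proof. exact: (@ab_res0 _ Om). Qed.

Lemma fm_resD U V (h : V ⊑ U) (a b : form U) :
  fm_res h (a + b) = fm_res h a + fm_res h b.
Proof. exact: (@ab_resD _ Om). Qed.

Lemma fm_resB U V (h : V ⊑ U) (a b : form U) :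
  fm_res h (a - b) = fm_res h a - fm_res h b.
Proof. exact: (@ab_resB _ Om). Qed.

Lemma fm_res_sum U V (h : V ⊑ U) (I : Type) (r : seq I) (a : I -> form U) :
  fm_res h (\sum_(i <- r) a i) = \sum_(i <- r) fm_res h (a i).
Proof. exact: (@ab_res_sum _ Om). Qed.

Lemma fm_sep U (I : Type) (W : I -> opens M) (a b : form U) :
  (forall x, op_set U x -> exists i, op_set (W i) x) ->
  (forall i Z (h : Z ⊑ U), Z ⊑ W i -> fm_res h a = fm_res h b) -> a = b.
Proof.
move=> cov ab; apply: (@ab_sep _ Om U I _ a b (ocover_ocap cov)) => i h.
by apply: (ab i); apply: ocap_r.
Qed.

Lemma fm_sep_local U (a b : form U) :
  (forall x, op_set U x -> exists W, op_set W x /\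
     forall Z (h : Z ⊑ U), Z ⊑ W -> fm_res h a = fm_res h b) -> a = b.
Proof. exact: (@ab_sep_local _ Om). Qed.

Lemma fm_scale_res U V (h : V ⊑ U) (f : smooth U) (a : form U) :
  fm_res h (fm_scale f a) = fm_scale (smooth_res h f) (fm_res h a).
Proof. by apply: form_ext => W k X /=; rewrite (smooth_res_comp h k
  (osub_trans h k)). Qed.

Lemma fm_scaleB U (f : smooth U) (a b : form U) :
  fm_scale f (a - b) = fm_scale f a - fm_scale f b.
Proof. by apply: form_ext => W k X /=; rewrite -mulrBr. Qed.

Lemma fm_scale0 U (a : form U) : fm_scale 0 a = 0.
Proof. by apply: form_ext => W k X /=; rewrite -[RHS](mul0r (fm_op a k X));
  congr (_ * _); apply: smooth_ext. Qed.

Lemma fm_scale_suml U m (f : 'I_m -> smooth U) (a : form U) :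
  fm_scale (\sum_i f i) a = \sum_i fm_scale (f i) a.
Proof.
apply: (big_ind2 (fun g b => fm_scale g a = b)) => // [|g b h c <- <-].
  exact: fm_scale0.
by apply: form_ext => W k X /=; rewrite smooth_resD mulrDl.
Qed.

Lemma fm_scale1 U (a : form U) : fm_scale 1 a = a.
Proof. by apply: form_ext => W k X /=; rewrite smooth_res1 mul1r. Qed.

(** The product of [f] and [a] vanishes over [C], hence glues with the zero form there. *)
Lemma form_extend0 U N C (f : smooth (otop M)) (a : form (ocap U N)) :
  smooth_res (osub_top C) f = 0 -> (forall x, op_set N x \/ op_set C x) ->
  exists b : form U, (forall Z (h : Z ⊑ U) (k : Z ⊑ N),
      fm_res h b = fm_scale (smooth_res (osub_top Z) f) (fm_res (ocap_sub h k) a)) /\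
    (forall Z (h : Z ⊑ U), Z ⊑ C -> fm_res h b = 0).
Proof.
move=> fC NC.
have fCZ Z : Z ⊑ C -> smooth_res (osub_top Z) f = 0.
  by move=> k; rewrite -(smooth_res_comp (osub_top C) k) fC; apply: smooth_ext.
have cov : ocover U (fun i : bool => ocap U (if i then N else C)).
  by apply: ocover_ocap => // x _; have [?|?] := NC x; [exists true|exists false].
pose c (i : bool) : form (ocap U (if i then N else C)) :=
  if i as i return form (ocap U (if i then N else C))
  then fm_scale (smooth_res (osub_top _) f) a else 0.
have [|b [bE _]] := form_glue (a := c) cov.
  move=> [] [] Z hi hj /=; rewrite ?fm_scale_res ?fm_res0 //.
  - by rewrite (Prop_irrelevance hi hj).
  - rewrite (smooth_res_comp _ hi (osub_top Z)) fCZ ?fm_scale0 //.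
    exact: osub_trans (ocap_r _ _) hj.
  - rewrite (smooth_res_comp _ hj (osub_top Z)) fCZ ?fm_scale0 //.
    exact: osub_trans (ocap_r _ _) hi.
exists b; split=> Z h k.
  have bN := bE true (ocap_l _ _).
  have := congr1 (fm_res (ocap_sub h k)) bN.
  rewrite (fm_res_comp _ _ h) => ->.
  by rewrite fm_scale_res (smooth_res_comp _ _ (osub_top Z)).
have bC := bE false (ocap_l _ _).
have := congr1 (fm_res (ocap_sub h k)) bC.
by rewrite (fm_res_comp _ _ h) => ->; rewrite fm_res0.
Qed.

(** With weights [f k] supported in [U (i_ k)], take for [t i] the sum over [k] of [f k] times
    [c i (i_ k)]. The cocycle identity turns [c i (i_ k) - c j (i_ k)] into [c i j], and the weights
    add up to 1. *)
Lemma form_cocycle_trivial (I : Type) (U : I -> opens M)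
    (c : forall i j, form (ocap (U i) (U j))) :
  (forall x, exists i, op_set (U i) x) ->
  (forall i j k Z (hi : Z ⊑ U i) (hj : Z ⊑ U j) (hk : Z ⊑ U k),
     fm_res (ocap_sub hi hj) (c i j) + fm_res (ocap_sub hj hk) (c j k) =
     fm_res (ocap_sub hi hk) (c i k)) ->
  exists t : forall i, form (U i), forall i j Z (hi : Z ⊑ U i) (hj : Z ⊑ U j),
    fm_res hi (t i) - fm_res hj (t j) = fm_res (ocap_sub hi hj) (c i j).
Proof.
(* The partition of unity needs a default index, which exists when M is nonempty; over an empty M
   all forms agree. *)
move=> cov cC; have [[x0 _]|noM] := pselect (exists x : M, True); last first.
  exists (fun=> 0) => i j Z hi hj; apply: form_ext => V k X; apply: smooth_ext => x.
  by case: noM; exists (val x).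
have [i0 _] := cov x0.
have [i_ [f [V [C [fC UC Vcov fV fV1]]]]] := partition_of_unity i0 cov.
have ex i k : exists b : form (U i),
    (forall Z (h : Z ⊑ U i) (hk : Z ⊑ U (i_ k)), fm_res h b =
      fm_scale (smooth_res (osub_top Z) (f k)) (fm_res (ocap_sub h hk) (c i (i_ k)))) /\
    (forall Z (h : Z ⊑ U i), Z ⊑ C k -> fm_res h b = 0).
  by apply: form_extend0.
pose e i k := projT1 (cid (ex i k)).
have eN i k Z (h : Z ⊑ U i) (hk : Z ⊑ U (i_ k)) : fm_res h (e i k) =
    fm_scale (smooth_res (osub_top Z) (f k)) (fm_res (ocap_sub h hk) (c i (i_ k))).
  exact: (projT2 (cid (ex i k))).1.
have eC i k Z (h : Z ⊑ U i) : Z ⊑ C k -> fm_res h (e i k) = 0.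
  exact: (projT2 (cid (ex i k))).2.
have UC' k x : exists b : bool, op_set (if b then U (i_ k) else C k) x.
  by have [?|?] := UC k x; [exists true|exists false].
have e0 i k m Z (h : Z ⊑ U i) : Z ⊑ V m -> (m < k)%N -> fm_res h (e i k) = 0.
  move=> ZV mk.
  apply: (fm_sep (fun x _ => UC' k x)) => -[] W hW hk;
    rewrite fm_res0 (fm_res_comp _ _ (osub_trans h hW)).
    rewrite (eN _ _ _ _ hk) -(smooth_res_comp (osub_top (V m))
      (osub_trans ZV hW)) fV //.
    by rewrite -[RHS](fm_scale0 (fm_res (ocap_sub (osub_trans h hW) hk) (c i (i_ k))));
      congr fm_scale; apply: smooth_ext.
  exact: eC.
(* The sum over all [k] of the forms [f k * c i (i_ k)], extended by 0. *)
pose s i m := \sum_(k < m.+1) e i k.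
have sE i m m' Z (h : Z ⊑ U i) : Z ⊑ V m -> (m <= m')%N -> fm_res h
  (s i m') = fm_res h (s i m).
  move=> ZV; elim: m' => [|m' IH]; first by rewrite leqn0 => /eqP ->.
  rewrite leq_eqVlt => /predU1P[->//|mm'].
  by rewrite /s big_ord_recr /= fm_resD IH // (e0 _ _ _ _ _ ZV) // addr0.
have ex_t i : exists t : form (U i), forall m Z (h : Z ⊑ U i),
  Z ⊑ V m -> fm_res h t = fm_res h (s i m).
  have cov_i : ocover (U i) (fun m => ocap (U i) (V m)) by apply: ocover_ocap => x _.
  have [m m' Z hm hm'|t [tE _]] := form_glue (a := fun m => fm_res (ocap_l _ _)
    (s i m)) cov_i.
    rewrite !(fm_res_comp _ _ (osub_trans (ocap_l _ _) hm)).
    have Zm : Z ⊑ V m := osub_trans (ocap_r _ _) hm.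
    have Zm' : Z ⊑ V m' := osub_trans (ocap_r _ _) hm'.
    by have [mm'|/ltnW m'm] := leqP m m'; [rewrite (sE _ m m')|rewrite (sE _ m' m)].
  exists t => m Z h hm; rewrite -(fm_res_comp (ocap_l _ (V m)) (ocap_sub h hm)) tE.
  by rewrite (fm_res_comp _ _ h).
pose t i := projT1 (cid (ex_t i)); exists t => i j Z hi hj.
have tE l m W (h : W ⊑ U l) : W ⊑ V m -> fm_res h (t l) = fm_res h (s l m).
  exact: (projT2 (cid (ex_t l))).
apply: (fm_sep (fun x _ => Vcov x)) => m W h Wm; rewrite fm_resB.
rewrite !(fm_res_comp _ _ (osub_trans hi h)) !(fm_res_comp _ _
  (osub_trans hj h)) !(tE _ m) //.
rewrite (fm_res_comp _ _ (ocap_sub (osub_trans hi h) (osub_trans hj h))).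
rewrite !fm_res_sum -sumrB -[RHS]fm_scale1.
have -> : 1 = \sum_(k < m.+1) smooth_res (osub_top W) (f k).
  rewrite -(smooth_res1 Wm) -(fV1 m) smooth_res_sum; apply: eq_bigr => k _.
  by rewrite (smooth_res_comp _ _ (osub_top W)).
rewrite fm_scale_suml; apply: eq_bigr => k _.
apply: (fm_sep (fun x _ => UC' k x)) => -[] Y hY hk; rewrite fm_resB fm_scale_res.
  rewrite !(fm_res_comp _ _ (osub_trans (osub_trans hi h) hY)) !(fm_res_comp _ _
    (osub_trans (osub_trans hj h) hY)).
  rewrite !(eN _ _ _ _ hk) -fm_scaleB (smooth_res_comp _ _ (osub_top Y));
    congr fm_scale.
  rewrite (fm_res_comp _ _ (ocap_sub (osub_trans (osub_trans hi h) hY) (osub_trans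
    (osub_trans hj h) hY))).
  by rewrite -(cC i j (i_ k) _ _ (osub_trans (osub_trans hj h) hY) hk) addrK.
rewrite !(fm_res_comp _ _ (osub_trans (osub_trans hi h) hY)) !(fm_res_comp _ _
  (osub_trans (osub_trans hj h) hY)).
rewrite !eC // subrr (smooth_res_comp _ _ (osub_top Y)) -(smooth_res_comp (osub_top
  (C k)) hk) fC.
by rewrite -[LHS](fm_scale0 (fm_res hY (fm_res (ocap_sub (osub_trans hi h)
  (osub_trans hj h)) (c i j)))); congr fm_scale; apply: smooth_ext.
Qed.
End Partition.

(** * Functions with zero differential *)

Section CoordinateFields.
Variables (R : realType) (n : nat) (M : manifold R n).
Implicit Types U V W Z : opens M.
Local Notation E := 'rV[R]_n.
Variables (c : chart R M n) (ca : mf_atlas c).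

Definition chart_set V : set E := ch_cod c `&` ch_inv c @^-1` op_set V.

Definition in_chart V (f : smooth V) (y : E) : R :=
  if pselect (op_set V (ch_inv c y)) is left Vy then f (oelt Vy) else 0.

Lemma chart_setP V (x : V) : ch_dom c (val x) -> chart_set V (ch_map c (val x)).
Proof.
move=> cx; split; first exact: ch_map_fun.
by rewrite /= ch_mapK //; exact: (set_mem (valP x)).
Qed.

Lemma in_chartE V (f : smooth V) (x : V) : ch_dom c (val x) ->
  in_chart f (ch_map c (val x)) = f x.
Proof.
move=> cx; rewrite /in_chart; case: pselect => [Vx|[]].
  by congr (f _); apply: val_inj; rewrite /= ch_mapK.
by rewrite ch_mapK //; exact: (set_mem (valP x)).
Qed.

Lemma in_chart_smooth V (f : smooth V) : smooth_on (chart_set V) (in_chart f).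
Proof.
move=> k; have [h hs hf] := smoothP f ca; apply: class_C_eq (hs k).
  exact: chart_open.
move=> y [cy Vy]; rewrite /in_chart; case: pselect => // Vy'.
by rewrite hf /= ?ch_invK //; apply: ch_inv_fun.
Qed.

Lemma in_chart_derivable V (f : smooth V) v y : chart_set V y ->
  derivable (in_chart f) y v.
Proof. exact: ((in_chart_smooth f 1).2 v).1. Qed.

Lemma in_chart_res V W (h : W ⊑ V) (f : smooth V) y : chart_set W y ->
  {near y, in_chart (smooth_res h f) =1 in_chart f}.
Proof.
move=> Wy; have : nbhs y (chart_set W).
  by apply: open_nbhs_nbhs; split=> //; apply: chart_open.
apply: filterS => z [cz Wz]; rewrite /in_chart.
case: pselect => [Wz'|[]] //; case: pselect => [Vz|[]]; last exact: h.
by congr (f _); apply: val_inj.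
Qed.

Variable v : E.

(** Read in another chart [d], this function is a derivative of the coordinate expression of [f]
    composed with the transition map from [d] to [c]. *)
Lemma coord_op_smooth V (hV : V ⊑ chart_dom c) (f : smooth V) :
  (fun x : V => 'D_v (in_chart f) (ch_map c (val x))) \in smooth_pred (U := V).
Proof.
apply/asboolP => d da.
exists ('D_v (in_chart f) \o (ch_map c \o ch_inv d)) => [k|x xd];
  last by rewrite /= ch_mapK.
apply: (@class_C_comp _ _ _ _ _ (chart_set V)); try exact: chart_open.
- by move=> y [dy Vy]; apply: (@chart_setP _ (oelt Vy)); exact: hV Vy.
- exact: ((in_chart_smooth f k.+2).2 v).2.
- move=> i; apply: class_C_sub (mf_compat da ca i k) => y [dy Vy]; split=> //.
  exact: hV Vy.
Qed.

Definition coord_op V (hV : V ⊑ chart_dom c) (f : smooth V) : smooth V :=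
  Smooth (coord_op_smooth hV f).

(** A test field for 1-forms. It may live on the chart domain only, since a form over M is evaluated
    on fields over any open set, so no cut-off is needed. *)
Program Definition coord_field : vfield (chart_dom c) := {| vf_op := coord_op |}.
Next Obligation.
move=> V h f g; apply: smooth_ext => x; rewrite -[RHS]/(coord_op h f x + coord_op h g
  x) /=.
have Vx := chart_setP (h _ (set_mem (valP x))).
rewrite -deriveD; try exact: in_chart_derivable.
congr ('D_v _ _); apply/funext => y.
rewrite -[RHS]/(in_chart f y + in_chart g y) /in_chart.
by case: pselect => // _; rewrite addr0.
Qed.
Next Obligation.
move=> V h f g; apply: smooth_ext => x.
rewrite -[RHS]/(coord_op h f x * g x + f x * coord_op h g x) /=.
have cx := h _ (set_mem (valP x)); have Vx := chart_setP cx.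
have -> : in_chart (f * g) = in_chart f * in_chart g.
  apply/funext => y; rewrite -[RHS]/(in_chart f y * in_chart g y) /in_chart.
  by case: pselect => // _; rewrite mulr0.
rewrite deriveM; try exact: in_chart_derivable.
by rewrite !in_chartE // addrC [_ *: _]mulrC.
Qed.
Next Obligation.
move=> V h a; apply: smooth_ext => x /=.
have cx := h _ (set_mem (valP x)); have Vx := chart_setP cx.
rewrite -[RHS](derive_cst a (ch_map c (val x)) v); apply: near_eq_derive.
have : nbhs (ch_map c (val x)) (chart_set V).
  by apply: open_nbhs_nbhs; split=> //; apply: chart_open.
by apply: filterS => z [cz Vz]; rewrite /in_chart; case: pselect.
Qed.
Next Obligation.
move=> V W hV hW h f; apply: smooth_ext => x /=.
have Wx := chart_setP (hW _ (set_mem (valP x))).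
by apply: near_eq_derive; have := in_chart_res h f Wx; apply: filterS => z ->.
Qed.

End CoordinateFields.

Section LocallyConstant.
Variables (R : realType) (n : nat) (M : manifold R n).

(** Evaluating [ext_d f] on the coordinate fields kills every directional derivative of [f] in a
    chart; the mean value theorem on a ball then makes [f] constant there. *)
Lemma ext_d_eq0_loc_const (f : smooth (otop M)) : ext_d f = 0 ->
  exists c : loc_const M, loc_const_smooth (otop M) c = f.
Proof.
move=> df0; pose g (x : M) : R := f (oelt (U := otop M) (x := x) I).
have gE (x : otop M) : f x = g (val x) by congr (f _); apply: val_inj.
suff gP : g \in @loc_const_pred R n M.
  by exists (LocConst gP); apply: smooth_ext => x; exact/esym/gE.
apply/asboolP => x; have [c ca cx] := mf_cover x.
pose h := in_chart c f.
have hE y : ch_cod c y -> h y = g (ch_inv c y).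
  by move=> cy; rewrite /h /in_chart; case: pselect => [?|[]//]; exact: gE.
have dh v y : ch_cod c y -> is_derive y v h 0.
  move=> cy; have hy : chart_set c (otop M) y by split.
  split; first exact: in_chart_derivable.
  have ey : op_set (chart_dom c) (ch_inv c y) by apply: ch_inv_fun.
  have := congr1 (fun a : form (otop M) => fm_op a (osub_top (chart_dom c))
    (coord_field ca v) (oelt ey)) df0.
  rewrite /= ch_invK // => e; rewrite -[RHS]e; apply: near_eq_derive.
  have : nbhs y (chart_set c (chart_dom c)).
    by apply: open_nbhs_nbhs; split; [apply: chart_open|split].
  move=> dy; have := in_chart_res (osub_top (chart_dom c)) f (y := y).
  by move=> /(_ c (conj cy ey)); apply: filterS => z ->.
have := derive0_near_cst (@ch_cod_open _ _ _ c) (ch_map_fun cx) dh.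
move=> /(ch_map_cont cx) /= H; near=> y.
have cy : ch_dom c y.
  by near: y; apply: open_nbhs_nbhs; split=> //; apply: ch_dom_open.
have : h (ch_map c y) = h (ch_map c x) by near: y; exact: H.
by rewrite !hE ?ch_mapK //; apply: ch_map_fun.
Unshelve. all: by end_near.
Qed.

(** Derivations commute with restriction, so the value at a point can be computed on a neighbourhood
    where the function is constant. *)
Lemma ext_d_loc_const U (c : loc_const M) : ext_d (loc_const_smooth U c) = 0.
Proof.
apply: form_ext => V h X; apply: smooth_ext => x /=.
have cc : nbhs (val x) [set y | c y = c (val x)] by have /asboolP := lc_funP c; apply.
have : nbhs (val x) ([set y | c y = c (val x)] `&` op_set V).
  apply: filterI => //; apply: open_nbhs_nbhs; split; first exact: op_open.
  exact: (set_mem (valP x)).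
rewrite nbhsE => -[B [oB Bx] BP].
pose W := Opens oB; have hW : W ⊑ V by move=> y /BP[].
have E : smooth_res hW (smooth_res h (loc_const_smooth U c)) = smooth_cst W (c (val x)).
  by apply: smooth_ext => y /=; apply: (BP _ (set_mem (valP y))).1.
have := vf_op_res X (osub_refl V) hW hW (smooth_res h (loc_const_smooth U c)).
rewrite E vf_op_cst => /(congr1 (fun k : smooth W => k (oelt (Bx :
  op_set W (val x))))) e.
by apply: etrans e; congr (vf_op _ _ _ _); apply: val_inj.
Qed.
End LocallyConstant.

(** * Transport along local isomorphisms *)

Section TorsorDifference.
Variables (T : topologicalType) (B : absheaf T) (U : opens T) (P : torsor B U).

Definition tor_sub V (hV : V ⊑ U) (t s : P V hV) : B V :=
  projT1 (cid (tor_simply_transitive s t)).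

Lemma tor_subK V (hV : V ⊑ U) (t s : P V hV) : tor_act s (tor_sub t s) = t.
Proof. exact: (projT2 (cid (tor_simply_transitive s t))).1. Qed.

Lemma tor_sub_eq V (hV : V ⊑ U) (t s : P V hV) a : tor_act s a = t -> tor_sub t s = a.
Proof. exact: (projT2 (cid (tor_simply_transitive s t))).2. Qed.

Lemma tor_act_inj V (hV : V ⊑ U) (s : P V hV) a b : tor_act s a = tor_act s b -> a = b.
Proof. by move=> ab; rewrite -(tor_sub_eq ab); apply: tor_sub_eq. Qed.
End TorsorDifference.

Lemma tm_congr (T : topologicalType) (B : absheaf T) (U : opens T) (P Q : torsor B U)
    (f g : tor_mor P Q) : f = g ->
  forall V (hV : V ⊑ U) (s : P V hV), tm_fun f s = tm_fun g s.
Proof. by move=> ->. Qed.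

Section Transport.
Variables (T : topologicalType) (B : absheaf T) (G : gpd_presheaf T).
Variable Phi : pseudonat G (torsors B).

(** [Phi] sends [f] to a map between the torsors of the restricted objects; the coherence
    isomorphisms move it to the restrictions of the torsors of [Q] and [Q'], where μ and σ live. *)
Definition transport U U' W (h : W ⊑ U) (h' : W ⊑ U') (Q : G U) (Q' : G U')
    (f : hom (gp_res G h Q) (gp_res G h' Q')) :
    hom (gp_res (torsors B) h (Phi U Q)) (gp_res (torsors B) h' (Phi U' Q')) :=
  gm_iso Phi h' Q' ⊚ fhom (Phi W) f ⊚ ginv (gm_iso Phi h Q).

Lemma transport_iso U U' W (h : W ⊑ U) (h' : W ⊑ U') (Q : G U) (Q' : G U')
    (f : hom (gp_res G h Q) (gp_res G h' Q')) :
  transport f ⊚ gm_iso Phi h Q = gm_iso Phi h' Q' ⊚ fhom (Phi W) f.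
Proof. exact: gcompVK. Qed.

Lemma transport_eq U U' W (h : W ⊑ U) (h' : W ⊑ U') (Q : G U) (Q' : G U')
    (f : hom (gp_res G h Q) (gp_res G h' Q')) g :
  g ⊚ gm_iso Phi h Q = gm_iso Phi h' Q' ⊚ fhom (Phi W) f -> transport f = g.
Proof. by rewrite -transport_iso => /gcomp_injr. Qed.

Lemma transport_id U W (h : W ⊑ U) (Q : G U) : transport (idm (gp_res G h Q)) = idm _.
Proof. by apply: transport_eq; rewrite fhom_id comp_idl comp_idr. Qed.

Lemma transport_comp U U' U'' W (h : W ⊑ U) (h' : W ⊑ U') (h'' : W ⊑ U'')
    (Q : G U) (Q' : G U') (Q'' : G U'')
    (g : hom (gp_res G h' Q') (gp_res G h'' Q'')) (f :
      hom (gp_res G h Q) (gp_res G h' Q')) :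
  transport (g ⊚ f) = transport g ⊚ transport f.
Proof.
apply: transport_eq.
by rewrite -comp_assoc transport_iso comp_assoc transport_iso fhom_comp comp_assoc.
Qed.

(** Composing both sides with coherence isomorphisms cancels the inverses hidden in [transport] and
    [hom_res]; what remains is [gm_cmp] and [gm_nat]. *)
Lemma transport_res U1 U2 V Z (h1 : V ⊑ U1) (h2 : V ⊑ U2) (P : G U1) (Q : G U2)
    (k : Z ⊑ V) (k1 : Z ⊑ U1) (k2 : Z ⊑ U2) (f : hom (gp_res G h1 P) (gp_res G h2 Q)) :
  transport (hom_res k k1 k2 f) ⊚ gp_cmp (g := torsors B) h1 k k1 (Phi U1 P) =
  gp_cmp (g := torsors B) h2 k k2 (Phi U2 Q) ⊚ fhom (gp_res (torsors B) k)
    (transport f).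
Proof.
apply: (gcomp_injr (e := fhom (gp_res (torsors B) k) (gm_iso Phi h1 P)
                          ⊚ gm_iso Phi k (gp_res G h1 P))).
rewrite -[LHS]comp_assoc -[RHS]comp_assoc.
have -> : gp_cmp (g := torsors B) h1 k k1 (Phi U1 P)
    ⊚ (fhom (gp_res (torsors B) k) (gm_iso Phi h1 P) ⊚ gm_iso Phi k (gp_res G h1 P)) =
    gm_iso Phi k1 P ⊚ fhom (Phi Z) (gp_cmp h1 k k1 P).
  by rewrite comp_assoc gm_cmp.
rewrite [LHS]comp_assoc transport_iso -[LHS]comp_assoc -fhom_comp /hom_res gcompVK
  fhom_comp.
rewrite [LHS]comp_assoc -gm_cmp -!(comp_assoc (gp_cmp _ _ _ _)); congr (_ ⊚ _).
by rewrite -comp_assoc gm_nat !comp_assoc -!fhom_comp transport_iso.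
Qed.

Lemma transport_fhom U W (h : W ⊑ U) (Q Q' : G U) (f : hom Q Q') :
  transport (fhom (gp_res G h) f) = fhom (gp_res (torsors B) h) (fhom (Phi U) f).
Proof. by apply: transport_eq; rewrite -gm_nat. Qed.

Lemma transport_cmp U V W (hVU : V ⊑ U) (hWV : W ⊑ V) (hWU : W ⊑ U) (Q : G U) :
  transport (gp_cmp hVU hWV hWU Q) =
  gp_cmp (g := torsors B) hVU hWV hWU (Phi U Q) ⊚ fhom (gp_res (torsors B) hWV)
    (gm_iso Phi hVU Q).
Proof. by apply: transport_eq; rewrite gm_cmp. Qed.

(* [transport] on sections, for arbitrary proofs of the inclusions. *)
Definition trs U U' W (h : W ⊑ U) (h' : W ⊑ U') (Q : G U) (Q' : G U')
    (f : hom (gp_res G h Q) (gp_res G h' Q')) Z (kW : Z ⊑ W) (k : Z ⊑ U) (k' : Z ⊑ U')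
    (s : (Phi U Q : torsor B U) Z k) : (Phi U' Q' : torsor B U') Z k' :=
  sh_res k' (osub_refl Z)
    (tm_fun (transport f) (hV := kW) (sh_res (osub_trans h kW) (osub_refl Z) s)).

Section Trs.
Variables (U U' W : opens T) (h : W ⊑ U) (h' : W ⊑ U') (Q : G U) (Q' : G U').
Variable f : hom (gp_res G h Q) (gp_res G h' Q').

Lemma trsE Z (kW : Z ⊑ W) (s : (Phi U Q : torsor B U) Z (osub_trans h kW)) :
  trs f kW (osub_trans h' kW) s = tm_fun (transport f) (hV := kW) s.
Proof. by rewrite /trs !sh_res_id. Qed.

Lemma trs_act Z (kW : Z ⊑ W) (k : Z ⊑ U) (k' : Z ⊑ U')
    (s : (Phi U Q : torsor B U) Z k) (a : B Z) :
  trs f kW k' (tor_act s a) = tor_act (trs f kW k' s) a.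
Proof.
by rewrite /trs tor_act_res ab_res_id [tm_fun _ _]tm_act /= tor_act_res ab_res_id.
Qed.

Lemma trs_res Z Y (kW : Z ⊑ W) (k : Z ⊑ U) (k' : Z ⊑ U') (l : Y ⊑ Z)
    (lW : Y ⊑ W) (lU : Y ⊑ U) (l' : Y ⊑ U') (s : (Phi U Q : torsor B U) Z k) :
  trs f lW l' (sh_res lU l s) = sh_res l' l (trs f kW k' s).
Proof.
rewrite /trs !(sh_res_comp _ _ _ _ l).
have := tm_res (transport f) (hV := kW) lW l (sh_res (osub_trans h kW) (osub_refl Z) s).
rewrite /= !(sh_res_comp _ _ _ _ l) => ->.
by rewrite !(sh_res_comp _ _ _ _ l).
Qed.
End Trs.

Lemma trs_comp U U' U'' W (h : W ⊑ U) (h' : W ⊑ U') (h'' : W ⊑ U'')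
    (Q : G U) (Q' : G U') (Q'' : G U'')
    (g : hom (gp_res G h' Q') (gp_res G h'' Q'')) (f :
      hom (gp_res G h Q) (gp_res G h' Q'))
    Z (kW : Z ⊑ W) (k : Z ⊑ U) (k' : Z ⊑ U') (k'' : Z ⊑ U'')
    (s : (Phi U Q : torsor B U) Z k) :
  trs (g ⊚ f) kW k'' s = trs g kW k'' (trs f kW k' s).
Proof.
rewrite /trs transport_comp; congr sh_res; rewrite /=.
by rewrite (sh_res_comp _ _ _ _ (osub_refl Z)) sh_res_id.
Qed.

Lemma trs_id U W (h : W ⊑ U) (Q : G U) Z (kW : Z ⊑ W) (k k' : Z ⊑ U)
    (s : (Phi U Q : torsor B U) Z k) :
  trs (idm (gp_res G h Q)) kW k' s = sh_res k' (osub_refl Z) s.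
Proof. by rewrite /trs transport_id /= (sh_res_comp _ _ _ _ (osub_refl Z)). Qed.

Lemma trs_hom_res U1 U2 V Z (h1 : V ⊑ U1) (h2 : V ⊑ U2) (P : G U1) (Q : G U2)
    (k : Z ⊑ V) (k1 : Z ⊑ U1) (k2 : Z ⊑ U2) (f : hom (gp_res G h1 P) (gp_res G h2 Q))
    Y (kZ : Y ⊑ Z) (kV : Y ⊑ V) (l1 : Y ⊑ U1) (l2 : Y ⊑ U2) (s : (Phi U1 P :
      torsor B U1) Y l1) :
  trs (hom_res k k1 k2 f) kZ l2 s = trs f kV l2 s.
Proof.
rewrite (Prop_irrelevance kV (osub_trans k kZ)).
have E : osub_trans h1 (osub_trans k kZ) = l1 by apply: Prop_irrelevance.
case: _ / E s => s; rewrite /trs.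
have := tm_congr (transport_res k k1 k2 f) (hV := kZ)
  (sh_res (osub_trans h1 (osub_trans k kZ)) (osub_refl Y) s).
rewrite /= (sh_res_comp _ _ _ _ (osub_refl Y)) => ->.
by rewrite (sh_res_comp _ _ _ _ (osub_refl Y)).
Qed.

Lemma trs_fhom U W (h : W ⊑ U) (Q Q' : G U) (f : hom Q Q') Z (kW : Z ⊑ W) (k : Z ⊑ U)
    (s : (Phi U Q : torsor B U) Z k) :
  trs (fhom (gp_res G h) f) kW k s = tm_fun (fhom (Phi U) f) s.
Proof.
by rewrite /trs transport_fhom /= tm_res (sh_res_comp _ _ _ _ (osub_refl Z)) sh_res_id.
Qed.

(** The coherence isomorphism of [Phi] is itself a transport, along [gp_cmp]. So passing from an
    object to its restriction is a special case of comparing two objects. *)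
Lemma trs_cmp U V W (hVU : V ⊑ U) (hWV : W ⊑ V) (hWU : W ⊑ U) (Q : G U)
    Z (kW : Z ⊑ W) (kV : Z ⊑ V)
    (s : (Phi V (gp_res G hVU Q) : torsor B V) Z kV) :
  trs (gp_cmp hVU hWV hWU Q) kW (osub_trans hVU kV) s = tm_fun (gm_iso Phi hVU Q) s.
Proof.
rewrite /trs transport_cmp /= (sh_res_comp _ _ _ _ (osub_refl Z)).
have := tm_res (gm_iso Phi hVU Q) (osub_trans hWV kW) (osub_refl Z) s => /= ->.
by rewrite (sh_res_comp _ _ _ _ (osub_refl Z)) sh_res_id.
Qed.

Lemma trs_iso U U' W (h : W ⊑ U) (h' : W ⊑ U') (Q : G U) (Q' : G U')
    (f : hom (gp_res G h Q) (gp_res G h' Q')) Z (kW : Z ⊑ W)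
    (s : (Phi W (gp_res G h Q) : torsor B W) Z kW) :
  trs f kW (osub_trans h' kW) (tm_fun (gm_iso Phi h Q) s : (Phi U Q :
    torsor B U) Z (osub_trans h kW)) =
  tm_fun (gm_iso Phi h' Q') (tm_fun (fhom (Phi W) f) s).
Proof.
rewrite trsE.
by have := tm_congr (transport_iso f) s.
Qed.

(** Every section is the image of one under the equivariant map [gm_iso], which carries the
    translation by [a] over. *)
Lemma trs_aut U W (h : W ⊑ U) (Q : G U) (u : hom (gp_res G h Q) (gp_res G h Q)) (a :
  B W)
    Z (kW : Z ⊑ W) (k : Z ⊑ U) (s : (Phi U Q : torsor B U) Z k) :
  acts_by (fhom (Phi W) u) a -> trs u kW k s = tor_act s (ab_res kW a).
Proof.
move=> ua; have E : osub_trans h kW = k by apply: Prop_irrelevance.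
case: _ / E s => s; have [t ts] := tm_surj (gm_iso Phi h Q) (hV := kW) s.
by rewrite -ts trs_iso ua [LHS]tm_act.
Qed.
End Transport.

Section TransportModification.
Variables (T : topologicalType) (B : absheaf T) (G : gpd_presheaf T).
Variables (Phi Psi : pseudonat G (torsors B)) (t : modification Phi Psi).

Lemma trs_modification U U' W (h : W ⊑ U) (h' : W ⊑ U') (Q : G U) (Q' : G U')
    (f : hom (gp_res G h Q) (gp_res G h' Q')) Z (kW : Z ⊑ W) (k : Z ⊑ U) (k' : Z ⊑ U')
    (s : (Phi U Q : torsor B U) Z k) :
  tm_fun (md_hom t Q') (trs f kW k' s) = trs f kW k' (tm_fun (md_hom t Q) s).
Proof.
have E : osub_trans h kW = k by apply: Prop_irrelevance.
case: _ / E s => s; have E : osub_trans h' kW = k' by apply: Prop_irrelevance.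
case: _ / E; have [r rs] := tm_surj (gm_iso Phi h Q) (hV := kW) s.
have R Z' (Q0 : G Z') (l : W ⊑ Z') r' : tm_fun (md_hom t Q0) (tm_fun (gm_iso Phi l Q0)
  (hV := kW) r') =
    tm_fun (gm_iso Psi l Q0) (tm_fun (md_hom t (gp_res G l Q0)) r').
  by have := tm_congr (md_res t l Q0) r'.
rewrite -rs trs_iso (R _ _ h) (R _ _ h') trs_iso.
exact: (congr1 (tm_fun (gm_iso Psi h' Q') (hV := kW)) (tm_congr (md_nat t f) r)).
Qed.
End TransportModification.

(** * The Lie derivative and the closedness of dlog *)

Section Cartan.
Variables (R : realType) (n : nat) (M : manifold R n).
Implicit Types U V W Z : opens M.

Lemma ext_dD U (f g : smooth U) : ext_d (f + g) = ext_d f + ext_d g.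
Proof. by apply: form_ext => V h X /=; rewrite smooth_resD vf_opD. Qed.

Lemma ext_d_res U V (h : V ⊑ U) (f : smooth U) :
  fm_res h (ext_d f) = ext_d (smooth_res h f).
Proof. by apply: form_ext => W k X /=; rewrite (smooth_res_comp h k
  (osub_trans h k)). Qed.

Variable xi : vfield (otop M).

Lemma lie_derivD U (a b : form U) : lie_deriv xi (a + b) = lie_deriv xi a + lie_deriv
  xi b.
Proof. by apply: form_ext => V h X /=; rewrite vf_opD; ring. Qed.

Lemma lie_deriv_res U V (h : V ⊑ U) (a : form U) :
  fm_res h (lie_deriv xi a) = lie_deriv xi (fm_res h a).
Proof. exact: form_ext. Qed.

(** Half the derivative of the constant function [a * a + b * b]. *)
Lemma vf_op_norm1 U (X : vfield U) (a b : smooth U) : a * a + b * b = 1 ->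
  forall x, a x * vf_op X (osub_refl U) a x + b x * vf_op X (osub_refl U) b x = 0.
Proof.
move=> ab x; have := vf_op_cst X (osub_refl U) 1.
have -> : smooth_cst U 1 = a * a + b * b by rewrite ab; apply: smooth_ext.
rewrite vf_opD !vf_opM => /(congr1 (fun k : smooth U => k x)) e.
have {}e : (vf_op X (osub_refl U) a x * a x + a x * vf_op X (osub_refl U) a x) +
  (vf_op X (osub_refl U) b x * b x + b x * vf_op X (osub_refl U) b x) = 0 :> R := e.
lra.
Qed.

(* Cartan's formula for [dlog g], which is closed. *)
Lemma lie_deriv_dlog U (g : circle U) :
  lie_deriv xi (dlog g) = ext_d (interior_prod xi (dlog g)).
Proof.
apply: form_ext => V h X; rewrite -[RHS]/(vf_op X (osub_refl V) (smooth_res h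
  (interior_prod xi (dlog g)))).
rewrite -interior_prod_res -dlog_res.
pose a := smooth_res h (c_re g); pose b := smooth_res h (c_im g).
have ab : a * a + b * b = 1 := c_norm (circle_res h g).
pose i := osub_refl V; pose j := osub_trans (osub_top V) i.
rewrite -[LHS]/(vf_op xi (osub_top V) (a * vf_op X i b - b * vf_op X i a)
  - (a * (vf_op xi j (vf_op X i b) - vf_op X i (vf_op xi j b))
   - b * (vf_op xi j (vf_op X i a) - vf_op X i (vf_op xi j a)))).
rewrite -[interior_prod _ _]/(smooth_res i a * vf_op xi j (smooth_res i b)
  - smooth_res i b * vf_op xi j (smooth_res i a)).
clearbody a b.
rewrite !smooth_res_id !(vf_op_irr xi _ (osub_top V)) !vf_opB !vf_opM.
have nX := vf_op_norm1 X ab.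
have nxi := vf_op_norm1 (vf_restr (osub_top V) xi) ab.
rewrite /= !(vf_op_irr xi _ (osub_top V)) in nxi.
move: (vf_op xi (osub_top V) (vf_op X _ a)) (vf_op xi (osub_top V)
  (vf_op X _ b)) => ca cb.
move: (vf_op X _ (vf_op xi (osub_top V) a)) (vf_op X _ (vf_op xi
  (osub_top V) b)) => da db.
move: nxi nX; move: (vf_op xi (osub_top V) a) (vf_op xi (osub_top V) b) => p q.
move: (vf_op X _ a) (vf_op X _ b) => r s nxi nX.
(* The vectors [(p, q)] and [(r, s)] of derivatives along [xi] and [X] are both orthogonal to the
   unit vector [(a, b)] of the plane, hence proportional. This is the vanishing of da ∧ db. *)
have psqr : p * s = q * r.
  apply: smooth_ext => x; rewrite -[LHS]/(p x * s x) -[RHS]/(q x * r x).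
  have := congr1 (fun k : smooth V => k x) ab; rewrite -[LHS]/(a x * a x + b x * b x)
    -[RHS]/(1 : R).
  move: (nxi x) (nX x); move: (a x) (b x) (p x) (q x) (r x)
    (s x) => a' b' p' q' r' s' e1 e2 e3.
  rewrite -[LHS]mul1r -[RHS]mul1r -e3.
  have : a' * p' = - (b' * q') by lra.
  have : a' * r' = - (b' * s') by lra.
  move=> e4 e5.
  have e6 : a' * a' * (p' * s') = a' * a' * (q' * r').
    transitivity (a' * s' * (a' * p')); first by ring.
    by transitivity (a' * q' * (a' * r')); [rewrite e5 e4; ring|ring].
  have e7 : b' * b' * (p' * s') = b' * b' * (q' * r').
    have e8 : b' * s' = - (a' * r') by lra.
    have e9 : b' * q' = - (a' * p') by lra.
    transitivity (b' * p' * (b' * s')); first by ring.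
    by transitivity (b' * r' * (b' * q')); [rewrite e8 e9; ring|ring].
  by rewrite !mulrDl e6 e7.
have qsr : s * p = q * r by rewrite mulrC.
rewrite qsr psqr; ring.
Qed.
End Cartan.

(** * Comparison of local data *)

Section LocalIsomorphisms.
Variables (T : topologicalType) (B : absheaf T) (G : gerbe B).

Lemma local_iso U U' Z (h : Z ⊑ U) (h' : Z ⊑ U') (Q : G U) (Q' : G U') x :
  op_set Z x -> exists W, op_set W x /\ forall Y, Y ⊑ W ->
    forall (l : Y ⊑ U) (l' : Y ⊑ U'), inhabited (hom (gp_res G l Q) (gp_res G l' Q')).
Proof.
move=> Zx; have [W [k [Wx [f]]]] := gb_locally_connected (gp_res G h Q)
  (gp_res G h' Q') Zx.
exists W; split=> // Y kY l l'; constructor.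
pose g := gp_cmp h' k (osub_trans h' k) Q' ⊚ f ⊚ ginv (gp_cmp h k (osub_trans h k) Q).
exact: (hom_res kY l l' g).
Qed.
End LocalIsomorphisms.

Section Compare.
Variables (R : realType) (n : nat) (M : manifold R n) (G : dd_gerbe M).
Variables (A : connective_structure G) (xi : vfield (otop M)).
Variable F : pseudonat G (torsors (sheaf_smooth M)).
Implicit Types U V W Z Y : opens M.

(* The effect on [Θ(μ)(σ)] of replacing [μ] by [μ + a] and [σ] by [σ + f]. *)
Definition shift_form U (a : form U) (f : smooth U) : form U :=
  ext_d f - lie_deriv xi a.

Lemma shift_formD U (a b : form U) (f g : smooth U) :
  shift_form (a + b) (f + g) = shift_form a f + shift_form b g.
Proof. by rewrite /shift_form ext_dD lie_derivD opprD addrACA. Qed.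

Lemma shift_form0l U (f : smooth U) : shift_form 0 f = ext_d f.
Proof.
rewrite /shift_form; have /eqP := lie_derivD xi (0 : form U) 0.
by rewrite addr0 -subr_eq0 opprD addrA subrr sub0r oppr_eq0 => /eqP ->; rewrite subr0.
Qed.

Lemma shift_form0r U (a : form U) : shift_form a 0 = - lie_deriv xi a.
Proof.
rewrite /shift_form; have /eqP := ext_dD (0 : smooth U) 0.
by rewrite addr0 -subr_eq0 opprD addrA subrr sub0r oppr_eq0 => /eqP ->; rewrite sub0r.
Qed.

Lemma shift_form_res U V (h : V ⊑ U) (a : form U) (f : smooth U) :
  fm_res h (shift_form a f) = shift_form (fm_res h a) (smooth_res h f).
Proof. by rewrite /shift_form fm_resB ext_d_res lie_deriv_res. Qed.

Lemma shift_form0 U : shift_form (0 : form U) 0 = 0.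
Proof. by apply: (addrI (shift_form 0 0)); rewrite -shift_formD !addr0. Qed.

Lemma shift_form_dlog U (g : circle U) :
  shift_form (- dlog g) (- interior_prod xi (dlog g)) = 0.
Proof.
apply: (addrI (shift_form (dlog g) (interior_prod xi (dlog g)))).
by rewrite -shift_formD !subrr shift_form0 /shift_form lie_deriv_dlog subrr addr0.
Qed.

(** The sections are defined over [pt_dom], while the object stays over the larger [pt_base]:
    shrinking the domain of the sections then leaves the object as it is and brings in no coherence
    isomorphism. *)
Record point := Point {
  pt_dom : opens M;
  pt_base : opens M;
  pt_sub : pt_dom ⊑ pt_base;
  pt_obj : G pt_base;
  pt_mu : (A pt_base pt_obj : torsor (sheaf_form M) pt_base) pt_dom pt_sub;
  pt_sec : (F pt_base pt_obj : torsor (sheaf_smooth M) pt_base) pt_dom pt_sub }.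

Arguments pt_sub : clear implicits.

Lemma point_cover x : exists p : point, op_set (pt_dom p) x.
Proof.
have [U Ux [Q]] := gb_locally_nonempty G x.
have [V [hV [Vx [mu]]]] := tor_locally_nonempty (A U Q) Ux.
have [W [hW [Wx [s]]]] := tor_locally_nonempty (F U Q) Ux.
have k : ocap V W ⊑ U := osub_trans hV (ocap_l V W).
by exists (@Point _ _ k Q (sh_res k (ocap_l V W) mu) (sh_res k (ocap_r V W) s)).
Qed.

Section Pair.
Variables (p q : point) (Z : opens M) (kp : Z ⊑ pt_dom p) (kq : Z ⊑ pt_dom q).
Variables (hp : Z ⊑ pt_base p) (hq : Z ⊑ pt_base q).

Definition differ_by (f : hom (gp_res G hp (pt_obj p)) (gp_res G hq (pt_obj q)))
    (a : form Z) (g : smooth Z) : Prop :=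
  trs f (osub_refl Z) hq (sh_res hp kp (pt_mu p)) = tor_act (sh_res hq kq (pt_mu q))
    (a : sheaf_form M Z) /\
  trs f (osub_refl Z) hq (sh_res hp kp (pt_sec p)) = tor_act (sh_res hq kq (pt_sec q))
    (g : sheaf_smooth M Z).

Lemma differ_by_ex f : exists a g, differ_by f a g.
Proof.
exists (tor_sub (trs f (osub_refl Z) hq (sh_res hp kp (pt_mu p))) (sh_res hq kq
  (pt_mu q))).
exists (tor_sub (trs f (osub_refl Z) hq (sh_res hp kp (pt_sec p))) (sh_res hq kq
  (pt_sec q))).
by split; rewrite tor_subK.
Qed.

Lemma differ_by_inj f a g a' g' : differ_by f a g -> differ_by f a' g' -> a = a' /\ g
  = g'.
Proof.
move=> [ea eg] [ea' eg']; split.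
  by apply: tor_act_inj (etrans (esym ea) ea').
by apply: tor_act_inj (etrans (esym eg) eg').
Qed.
End Pair.

Lemma differ_by_comp p q r Z (kp : Z ⊑ pt_dom p) (kq : Z ⊑ pt_dom q) (kr : Z ⊑ pt_dom r)
    (hp : Z ⊑ pt_base p) (hq : Z ⊑ pt_base q) (hr : Z ⊑ pt_base r)
    (f : hom (gp_res G hp (pt_obj p)) (gp_res G hq (pt_obj q)))
    (f' : hom (gp_res G hq (pt_obj q)) (gp_res G hr (pt_obj r))) a g a' g' :
  differ_by kp kq f a g -> differ_by kq kr f' a' g' ->
  differ_by kp kr (f' ⊚ f) (a' + a) (g' + g).
Proof.
move=> [fa fg] [fa' fg']; split.
  by rewrite (trs_comp _ _ _ hq) fa trs_act fa' -tor_actD.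
by rewrite (trs_comp _ _ _ hq) fg trs_act fg' -tor_actD.
Qed.

Lemma differ_by_res p q Z Y (kp : Z ⊑ pt_dom p) (kq : Z ⊑ pt_dom q)
    (hp : Z ⊑ pt_base p) (hq : Z ⊑ pt_base q)
    (lp : Y ⊑ pt_dom p) (lq : Y ⊑ pt_dom q) (mp : Y ⊑ pt_base p) (mq : Y ⊑ pt_base q)
    (l : Y ⊑ Z) (f : hom (gp_res G hp (pt_obj p)) (gp_res G hq (pt_obj q))) a g :
  differ_by kp kq f a g ->
  differ_by lp lq (hom_res l mp mq f) (fm_res l a) (smooth_res l g).
Proof.
move=> [fa fg]; split; rewrite (trs_hom_res _ _ _ _ _ l) -(sh_res_comp hp mp kp l).
  by rewrite (trs_res _ (osub_refl Z) hq) fa tor_act_res (sh_res_comp _ _ _ _ lq).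
by rewrite (trs_res _ (osub_refl Z) hq) fg tor_act_res (sh_res_comp _ _ _ _ lq).
Qed.

Hypothesis Fxi : intertwines F (minus_iota_dlog xi).

Lemma differ_by_shift_eq p q Z (kp : Z ⊑ pt_dom p) (kq : Z ⊑ pt_dom q)
    (hp : Z ⊑ pt_base p) (hq : Z ⊑ pt_base q)
    (f f' : hom (gp_res G hp (pt_obj p)) (gp_res G hq (pt_obj q))) a g a' g' :
  differ_by kp kq f a g -> differ_by kp kq f' a' g' -> shift_form a g = shift_form a'
    g'.
Proof.
move=> fag fag'; pose u := f ⊚ ginv f'.
have fE : f = u ⊚ f' by rewrite gcompVK.
have uP : differ_by kq kq u (- dlog (gb_band u)) (- interior_prod xi (dlog
  (gb_band u))).
  split.
    rewrite (trs_aut _ _ (@cs_intertwines _ _ _ _ A _ _ u)); congr tor_act;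
      exact: ab_res_id.
  rewrite (trs_aut _ _ (@Fxi _ _ u)); congr tor_act; exact: ab_res_id.
have := differ_by_comp fag' uP; rewrite -fE => /(differ_by_inj fag)[-> ->].
by rewrite shift_formD shift_form_dlog add0r.
Qed.

Lemma local_differ_by p q Z (kp : Z ⊑ pt_dom p) (kq : Z ⊑ pt_dom q) x : op_set Z x ->
  exists W, op_set W x /\ forall Y, Y ⊑ W ->
    forall (lp : Y ⊑ pt_dom p) (lq : Y ⊑ pt_dom q) (mp : Y ⊑ pt_base p) (mq :
      Y ⊑ pt_base q),
    exists (f : hom (gp_res G mp (pt_obj p)) (gp_res G mq (pt_obj q))) a g,
      differ_by lp lq f a g.
Proof.
move=> Zx; have [W [Wx WP]] := local_iso (osub_trans (pt_sub p) kp) (osub_trans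
  (pt_sub q) kq)
  (pt_obj p) (pt_obj q) Zx.
exists W; split=> // Y YW lp lq mp mq; have [f] := WP Y YW mp mq.
by have [a [g H]] := differ_by_ex lp lq f; exists f, a, g.
Qed.

(** The gluing uses the family of all open sets with a form that some isomorphism produces there. By
    [local_differ_by] these sets cover the overlap, and by [differ_by_shift_eq] the forms agree. *)
Lemma comparison_form p q : exists c : form (ocap (pt_dom p) (pt_dom q)),
  forall Z (kp : Z ⊑ pt_dom p) (kq : Z ⊑ pt_dom q) (hp : Z ⊑ pt_base p) (hq :
    Z ⊑ pt_base q)
    (f : hom (gp_res G hp (pt_obj p)) (gp_res G hq (pt_obj q))) a g,
  differ_by kp kq f a g -> fm_res (ocap_sub kp kq) c = shift_form a g.
Proof.
pose good Z (b : form Z) := exists (kp : Z ⊑ pt_dom p) (kq : Z ⊑ pt_dom q)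
  (hp : Z ⊑ pt_base p) (hq : Z ⊑ pt_base q)
  (f : hom (gp_res G hp (pt_obj p)) (gp_res G hq (pt_obj q))) a g,
  differ_by kp kq f a g /\ b = shift_form a g.
pose I := {Z : opens M & {b : form Z | good Z b}}.
pose W (i : I) := projT1 i; pose b (i : I) : form (W i) := sval (projT2 i).
have [||c [cE _]] := @form_glue _ _ _ (ocap (pt_dom p) (pt_dom q)) I W b.
- split=> [i|x pqx]; first by have [kp [kq _]] := svalP (projT2 i);
  exact: (ocap_sub kp kq).
  have [Y [Yx YP]] := local_differ_by (ocap_l (pt_dom p) (pt_dom q)) (ocap_r _ _) pqx.
  pose Z := ocap Y (ocap (pt_dom p) (pt_dom q)).
  have kp : Z ⊑ pt_dom p := osub_trans (ocap_l _ _) (ocap_r _ _).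
  have kq : Z ⊑ pt_dom q := osub_trans (ocap_r _ _) (ocap_r _ _).
  have hp := osub_trans (pt_sub p) kp; have hq := osub_trans (pt_sub q) kq.
  have [f [a [g H]]] := YP Z (ocap_l _ _) kp kq hp hq.
  have gd : good Z (shift_form a g) by exists kp, kq, hp, hq, f, a, g.
  by exists (existT _ Z (exist _ _ gd)).
- move=> i j Y l l'.
  have [kp [kq [hp [hq [f [a [g [H e]]]]]]]] := svalP (projT2 i).
  have [kp' [kq' [hp' [hq' [f' [a' [g' [H' e']]]]]]]] := svalP (projT2 j).
  rewrite [b i]e [b j]e' !shift_form_res.
  have lp := osub_trans kp l; have lq := osub_trans kq l.
  have mp := osub_trans hp l; have mq := osub_trans hq l.
  apply: differ_by_shift_eq (differ_by_res lp lq mp mq l H)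
    (differ_by_res lp lq mp mq l' H').
- exists c => Z kp kq hp hq f a g H.
  have gd : good Z (shift_form a g) by exists kp, kq, hp, hq, f, a, g.
  exact: cE (existT _ Z (exist _ _ gd)) _.
Qed.

(* The values [Θ(μ)(σ)] of a 2-morphism Θ. *)
Definition potential (t : forall p : point, form (pt_dom p)) : Prop :=
  forall p q Z (kp : Z ⊑ pt_dom p) (kq : Z ⊑ pt_dom q) (hp : Z ⊑ pt_base p) (hq :
    Z ⊑ pt_base q)
    (f : hom (gp_res G hp (pt_obj p)) (gp_res G hq (pt_obj q))) a g,
  differ_by kp kq f a g -> fm_res kp (t p) = fm_res kq (t q) + shift_form a g.

(** Isomorphisms compose and so do displacements, which yields the cocycle identity on small sets; a
    trivialization of the comparison forms is then a potential. *)
Lemma potential_ex : exists t, potential t.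
Proof.
pose c p q := projT1 (cid (comparison_form p q)).
have cP p q := projT2 (cid (comparison_form p q)).
have [|t tP] := form_cocycle_trivial (c := c) point_cover.
  move=> p q r Z kp kq kr.
  apply: fm_sep_local => x Zx.
  have [W [Wx WP]] := local_differ_by kp kq Zx.
  have [W' [Wx' WP']] := local_differ_by kq kr Zx.
  exists (ocap W W'); split=> [//|Y h hW].
  have lp := osub_trans kp h; have lq := osub_trans kq h; have lr := osub_trans kr h.
  have mp := osub_trans (pt_sub p) lp; have mq := osub_trans (pt_sub q) lq.
  have mr := osub_trans (pt_sub r) lr.
  have [f [a [g H]]] := WP Y (osub_trans (ocap_l _ _) hW) lp lq mp mq.
  have [f' [a' [g' H']]] := WP' Y (osub_trans (ocap_r _ _) hW) lq lr mq mr.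
  rewrite fm_resD (fm_res_comp _ _ (ocap_sub lp lq)) (fm_res_comp _ _ (ocap_sub lq lr)).
  rewrite (fm_res_comp _ _ (ocap_sub lp lr)) (cP _ _ _ _ _ _ _ _ _ _ H)
    (cP _ _ _ _ _ _ _ _ _ _ H').
  by rewrite (cP _ _ _ _ _ _ _ _ _ _ (differ_by_comp H H')) shift_formD addrC.
exists t => p q Z kp kq hp hq f a g H.
have := tP p q Z kp kq; rewrite (cP _ _ _ _ _ _ _ _ _ _ H) => <-.
by rewrite addrC subrK.
Qed.

(** Both potentials change by the same [shift_form] from one point to another, so it cancels in
    [t' p - t p]. *)
Lemma potential_diff t t' : potential t -> potential t' ->
  exists! a : form (otop M), forall p, t' p = t p + fm_res (osub_top (pt_dom p)) a.
Proof.
move=> tP t'P.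
have cov : ocover (otop M) pt_dom by split=> // x _; apply: point_cover.
have [p q Z kp kq|a [aE aU]] := form_glue (a := fun p => t' p - t p) cov.
  apply: fm_sep_local => x Zx; have [W [Wx WP]] := local_differ_by kp kq Zx.
  exists W; split=> // Y h hW.
  have lp := osub_trans kp h; have lq := osub_trans kq h.
  have mp := osub_trans (pt_sub p) lp; have mq := osub_trans (pt_sub q) lq.
  have [f [b [g H]]] := WP Y hW lp lq mp mq.
  rewrite (fm_res_comp _ _ lp) (fm_res_comp _ _ lq) !fm_resB.
  by rewrite (tP _ _ _ _ _ _ _ _ _ _ H) (t'P _ _ _ _ _ _ _ _ _ _ H) opprD addrACA
    subrr addr0.
exists a; split=> [p|b bP]; first by rewrite aE addrC subrK.
by apply: aU => p h; rewrite (Prop_irrelevance h (osub_top _)) bP addrC addKr.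
Qed.
End Compare.
Arguments pt_sub {R n M G A F} p.

(** * Connective lifts *)

Section Extensions.
Variables (R : realType) (n : nat) (M : manifold R n) (G : dd_gerbe M).
Variables (A : connective_structure G) (xi : vfield (otop M)).
Variable F : pseudonat G (torsors (sheaf_smooth M)).
Implicit Types U V W Z Y : opens M.
Local Notation point := (point A F).

Lemma connective_ext_eq (t t' : connective_ext A xi F) :
  (forall U (Q : G U) V (hV : V ⊑ U) (mu : (A U Q : torsor (sheaf_form M) U) V hV),
     ce_conn t mu = ce_conn t' mu) -> t = t'.
Proof.
case: t t' => [c a1 a2 a3 a4] [c' b1 b2 b3 b4] /= cc.
have E : c = c' by do 4!apply: functional_extensionality_dep => ?; apply/funext;
  apply: cc.
by case: c' / E b1 b2 b3 b4 {cc} => *; congr ConnectiveExt; apply: Prop_irrelevance.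
Qed.

Definition ext_value (t : connective_ext A xi F) (p : point) : form (pt_dom p) :=
  cn_form (ce_conn t (pt_mu p)) (osub_refl (pt_dom p)) (pt_sec p).

(** A transport goes back along one coherence isomorphism, applies [f], and goes forward along the
    other: [ce_gp_res] handles the two outer moves and [ce_nat] the middle one. *)
Lemma ce_conn_trs (t : connective_ext A xi F) U U' W (h : W ⊑ U) (h' : W ⊑ U') (Q :
  G U) (Q' : G U')
    (f : hom (gp_res G h Q) (gp_res G h' Q')) Z (kW : Z ⊑ W) (k : Z ⊑ U) (k' : Z ⊑ U')
    (mu : (A U Q : torsor (sheaf_form M) U) Z k) (s : (F U Q :
      torsor (sheaf_smooth M) U) Z k) :
  cn_form (ce_conn t (trs f kW k' mu)) (osub_refl Z) (trs f kW k' s) =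
  cn_form (ce_conn t mu) (osub_refl Z) s.
Proof.
have E : osub_trans h kW = k by apply: Prop_irrelevance.
case: _ / E mu s => mu s; have E : osub_trans h' kW = k' by apply: Prop_irrelevance.
case: _ / E.
have [mu' <-] := tm_surj (gm_iso A h Q) (hV := kW) mu.
have [s' <-] := tm_surj (gm_iso F h Q) (hV := kW) s.
rewrite !trs_iso.
have H := @ce_gp_res _ _ _ _ _ _ _ t.
by rewrite H H ce_nat.
Qed.

Lemma ext_value_potential t : potential xi (ext_value t).
Proof.
move=> p q Z kp kq hp hq f a g [fa fg].
have res (r : point) (kr : Z ⊑ pt_dom r) (hr : Z ⊑ pt_base r) :
  fm_res kr (ext_value t r) =
    cn_form (ce_conn t (sh_res hr kr (pt_mu r))) (osub_refl Z) (sh_res hr kr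
      (pt_sec r)).
  by rewrite (ce_res _ _ _ _ kr); apply/esym/cn_res.
rewrite (res p _ hp) (res q _ hq) -(ce_conn_trs t f (osub_refl Z) hq) fa fg.
rewrite ce_act /= cn_act fm_res_id.
by rewrite /shift_form addrA.
Qed.

(** Θ(μ) commutes with restriction of μ, so Θ is determined by its values on pairs with a common
    domain, that is, on points. *)
Lemma cn_form_value (t : connective_ext A xi F) U (Q : G U) V (hV : V ⊑ U)
    (mu : (A U Q : torsor (sheaf_form M) U) V hV) W (hW : W ⊑ U) (kW : W ⊑ V)
    (s : (F U Q : torsor (sheaf_smooth M) U) W hW) :
  cn_form (ce_conn t mu) kW s = ext_value t (@Point _ _ _ _ A F _ _ hW Q
    (sh_res hW kW mu) s).
Proof. by rewrite /ext_value /= (ce_res _ _ _ _ kW). Qed.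

Lemma differ_by_id U (Q : G U) V (hV : V ⊑ U) mu s V' (hV' : V' ⊑ U) mu' s'
    Z (k : Z ⊑ V) (k' : Z ⊑ V') (hZ : Z ⊑ U) a g :
  sh_res hZ k mu = tor_act (sh_res hZ k' mu') (a : sheaf_form M Z) ->
  sh_res hZ k s = tor_act (sh_res hZ k' s') (g : sheaf_smooth M Z) ->
  differ_by (p := @Point _ _ _ _ A F _ _ hV Q mu s)
    (q := @Point _ _ _ _ A F _ _ hV' Q mu' s')
    k k' (idm (gp_res G hZ Q)) a g.
Proof. by move=> ma sg; split; rewrite trs_id sh_res_id. Qed.

(** Each law is an instance of [potential]: along identities for restrictions and for the actions of
    functions and forms, along a restricted morphism for naturality, along [gp_cmp] for restriction
    of objects. *)
Lemma ext_of_potential (t : forall p : point, form (pt_dom p)) : potential xi t ->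
  inhabited (connective_ext A xi F).
Proof.
move=> tP.
have tS U (Q : G U) V (hV : V ⊑ U) mu s V' (hV' : V' ⊑ U) mu' s'
    Z (k : Z ⊑ V) (k' : Z ⊑ V') (hZ : Z ⊑ U) a g :
    sh_res hZ k mu = tor_act (sh_res hZ k' mu') (a : sheaf_form M Z) ->
    sh_res hZ k s = tor_act (sh_res hZ k' s') (g : sheaf_smooth M Z) ->
    fm_res k (t (@Point _ _ _ _ A F _ _ hV Q mu s)) =
    fm_res k' (t (@Point _ _ _ _ A F _ _ hV' Q mu' s')) + shift_form xi a g.
  by move=> ma sg; apply: tP (differ_by_id ma sg).
pose val U (Q : G U) V (hV : V ⊑ U) (mu : (A U Q : torsor (sheaf_form M) U) V hV)
  W (hW : W ⊑ U) (kW : W ⊑ V) (s : (F U Q : torsor (sheaf_smooth M) U) W hW) : form W :=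
  t (@Point _ _ _ _ A F _ _ hW Q (sh_res hW kW mu) s).
have val_res U (Q : G U) V (hV : V ⊑ U) (mu : (A U Q : torsor (sheaf_form M) U) V hV)
    W Z (hW : W ⊑ U) (hZ : Z ⊑ U) (kW : W ⊑ V) (kZ : Z ⊑ V) (h : Z ⊑ W)
    (s : (F U Q : torsor (sheaf_smooth M) U) W hW) :
    val _ _ _ _ mu _ hZ kZ (sh_res hZ h s) = fm_res h (val _ _ _ _ mu _ hW kW s).
  rewrite -[LHS](fm_res_id (osub_refl Z)) -[RHS]addr0 -(shift_form0 xi Z).
  by apply: (tS _ _ _ _ _ _ _ _ _ _ _ _ _ hZ); rewrite tor_act0 ?sh_res_id //
    !(sh_res_comp _ _ _ _ kZ).
have val_act U (Q : G U) V (hV : V ⊑ U) (mu : (A U Q : torsor (sheaf_form M) U) V hV)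
    W (hW : W ⊑ U) (kW : W ⊑ V) (s : (F U Q : torsor (sheaf_smooth M) U) W hW) (f :
      smooth W) :
    val _ _ _ _ mu _ hW kW (tor_act s (f : sheaf_smooth M W)) = val _ _ _ _ mu _ hW kW
      s + ext_d f.
  rewrite -[LHS](fm_res_id (osub_refl W)) -[val _ _ _ _ _ _ _ _ s](fm_res_id
    (osub_refl W)).
  rewrite -(shift_form0l xi).
  by apply: (tS _ _ _ _ _ _ _ _ _ _ _ _ _ hW); rewrite ?tor_act0 ?sh_res_id.
pose conn U (Q : G U) V (hV : V ⊑ U) (mu : (A U Q : torsor (sheaf_form M) U) V hV) :
    connection (F U Q) V :=
  @Connection _ _ _ U (F U Q) V (fun W hW kW s => val U Q V hV mu W hW kW s)
    (fun W Z hW hZ kW kZ h s => val_res U Q V hV mu W Z hW hZ kW kZ h s)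
    (fun W hW kW s f => val_act U Q V hV mu W hW kW s f).
constructor; apply: (@ConnectiveExt _ _ _ _ _ _ _ conn).
- move=> U Q V hV mu a; apply: connection_ext => W hW kW s /=; rewrite /val.
  rewrite tor_act_res -[LHS](fm_res_id (osub_refl W)).
  rewrite -[X in _ = X + _](fm_res_id (osub_refl W)).
  have -> : fm_res kW (- lie_deriv xi a) = shift_form xi (fm_res kW a) 0.
    rewrite shift_form0r -lie_deriv_res; exact: form_ext.
  by apply: (tS _ _ _ _ _ _ _ _ _ _ _ _ _ hW); rewrite ?tor_act0 ?sh_res_id.
- move=> U Q V V' hV hV' h mu W hW kW kW' s; rewrite /= /val.
  by rewrite (sh_res_comp _ _ _ _ kW).
- move=> U Q Q' f V hV mu W hW kW s; rewrite /= /val.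
  rewrite -[RHS](fm_res_id (osub_refl W)) -[LHS](fm_res_id (osub_refl W)).
  symmetry; rewrite -[RHS]addr0 -(shift_form0 xi W).
  pose p := @Point _ _ _ _ A F _ _ hW Q (sh_res hW kW mu) s.
  pose q := @Point _ _ _ _ A F _ _ hW Q' (sh_res hW kW (tm_fun (fhom (A U) f) mu))
    (tm_fun (fhom (F U) f) s).
  apply: (tP p q W _ _ hW hW (fhom (gp_res G hW) f)); split.
    by rewrite /= tor_act0 !sh_res_id trs_fhom tm_res.
  by rewrite /= tor_act0 !sh_res_id trs_fhom.
- move=> U U' h Q V hV mu W hW kW s; rewrite /= /val.
  rewrite -[RHS](fm_res_id (osub_refl W)) -[LHS](fm_res_id (osub_refl W)).
  symmetry; rewrite -[RHS]addr0 -(shift_form0 xi W).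
  pose p := @Point _ _ _ _ A F _ _ hW (gp_res G h Q) (sh_res hW kW mu) s.
  pose q := @Point _ _ _ _ A F _ _ (osub_trans h hW) Q
    (sh_res (osub_trans h hW) kW (tm_fun (gm_iso A h Q) mu : (A U Q :
      torsor _ _) V (osub_trans h hV))) (tm_fun (gm_iso F h Q) s).
  apply: (tP p q W _ _ hW (osub_trans h hW) (gp_cmp h hW (osub_trans h hW) Q)); split.
    rewrite /= tor_act0 !sh_res_id trs_cmp.
    exact: (tm_res (gm_iso A h Q) hW kW mu).
  by rewrite /= tor_act0 !sh_res_id trs_cmp.
Qed.

Hypothesis Fxi : intertwines F (minus_iota_dlog xi).

Lemma connective_ext_ex : inhabited (connective_ext A xi F).
Proof. by have [t /ext_of_potential] := potential_ex A Fxi. Qed.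

Lemma ce_add_eqP (t t' : connective_ext A xi F) (a : form (otop M)) :
  ce_add t a = t' <->
  forall p, ext_value t' p = ext_value t p + fm_res (osub_top (pt_dom p)) a.
Proof.
split=> [<- p|tt'].
  by rewrite /ext_value /= fm_res_id.
apply: connective_ext_eq => U Q V hV mu; apply: connection_ext => W hW kW s /=.
by rewrite !cn_form_value tt' (fm_res_comp _ _ (osub_top W)).
Qed.

Lemma ce_add_transitive (t t' : connective_ext A xi F) : exists! a, ce_add t a = t'.
Proof.
have [a [aP aU]] := potential_diff (ext_value_potential t) (ext_value_potential t').
exists a; split=> [|b /ce_add_eqP]; first exact/ce_add_eqP.
exact: aU.
Qed.
End Extensions.

(** * Automorphisms of connective lifts *)

Section Automorphisms.
Variables (R : realType) (n : nat) (M : manifold R n) (G : dd_gerbe M).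
Variables (A : connective_structure G) (xi : vfield (otop M)).
Implicit Types U V W Z Y : opens M.
Implicit Types F : pseudonat G (torsors (sheaf_smooth M)).

Lemma loc_const_smoothD U (c d : loc_const M) :
  loc_const_smooth U (c + d) = loc_const_smooth U c + loc_const_smooth U d.
Proof. exact: smooth_ext. Qed.

Lemma loc_const_smooth0 U : loc_const_smooth U (0 : loc_const M) = 0.
Proof. exact: smooth_ext. Qed.

Program Definition tor_translation U (P : torsor (sheaf_smooth M) U) (c : loc_const M) :
  tor_mor P P := {| tm_fun V hV s := tor_act s (loc_const_smooth V c :
    sheaf_smooth M V) |}.
Next Obligation.
move=> U P c V W hV hW h s; rewrite tor_act_res; congr tor_act; exact: smooth_ext.
Qed.
Next Obligation. by move=> U P c V hV s a; rewrite -!tor_actD addrC. Qed.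

Program Definition translation (F : pseudonat G (torsors (sheaf_smooth M))) (c :
  loc_const M) :
  modification F F := {| md_hom U Q := tor_translation (F U Q) c |}.
Next Obligation. by move=> F c U P Q f; apply: tor_mor_ext => V hV s;
  rewrite /= tm_act. Qed.
Next Obligation.
move=> F c U V h P; apply: tor_mor_ext => W hW s /=.
exact/esym/(tm_act (gm_iso F h P) s).
Qed.

Lemma translationD F (c d : loc_const M) :
  translation F (c + d) = modification_comp (translation F c) (translation F d).
Proof.
apply: modification_ext => U P; apply: tor_mor_ext => V hV s /=.
by rewrite -tor_actD addrC loc_const_smoothD.
Qed.

Lemma translation0 F : translation F 0 = modification_id F.
Proof.
apply: modification_ext => U P; apply: tor_mor_ext => V hV s /=.
by rewrite loc_const_smooth0 tor_act0.
Qed.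

Lemma tor_sub_res (T : topologicalType) (B : absheaf T) (U V W : opens T) (P :
  torsor B U)
    (hV : V ⊑ U) (hW : W ⊑ U) (h : W ⊑ V) (t s : P V hV) :
  ab_res h (tor_sub t s) = tor_sub (sh_res hW h t) (sh_res hW h s).
Proof. by apply/esym/tor_sub_eq; rewrite -tor_act_res tor_subK. Qed.

(** At each point [t] displaces σ by some function. Since [t] commutes with transports and
    translations, the displacement [g] between two points cancels and these functions glue over
    M. *)
Lemma modification_translation F (t : modification F F) :
  exists h : smooth (otop M), forall U (Q : G U) V (hV : V ⊑ U)
    (s : (F U Q : torsor (sheaf_smooth M) U) V hV),
  tm_fun (md_hom t Q) s = tor_act s (smooth_res (osub_top V) h : sheaf_smooth M V).
Proof.
pose b (p : point A F) : sheaf_smooth M (pt_dom p) := tor_sub (tm_fun (md_hom t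
  (pt_obj p)) (pt_sec p)) (pt_sec p).
have bE (p : point A F) Z (k : Z ⊑ pt_dom p) (h : Z ⊑ pt_base p) :
    tm_fun (md_hom t (pt_obj p)) (sh_res h k (pt_sec p)) = tor_act (sh_res h k
      (pt_sec p)) (ab_res k (b p)).
  by rewrite (tor_sub_res h) -tm_res tor_subK.
have cov : ocover (otop M) (@pt_dom _ _ _ _ A F) by split=> // x _; apply: point_cover.
have [p q Z kp kq|h [hE _]] := ab_glue (a := b) cov.
  apply: ab_sep_local => x Zx; have [W [Wx WP]] := local_differ_by kp kq Zx.
  exists W; split=> // Y h hW.
  have lp := osub_trans kp h; have lq := osub_trans kq h.
  have mp := osub_trans (pt_sub p) lp; have mq := osub_trans (pt_sub q) lq.
  have [f [a [g [_ H]]]] := WP Y hW lp lq mp mq.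
  rewrite !(ab_res_comp _ _ lp) !(ab_res_comp _ _ lq).
  have := trs_modification t f (osub_refl Y) mq (sh_res mp lp (pt_sec p)).
  rewrite bE trs_act H tm_act bE -!tor_actD => /tor_act_inj.
  by rewrite addrC => /addrI ->.
exists h => U Q V hV s.
rewrite -[LHS](tor_subK _ s); congr tor_act.
(* A point contains a section μ besides σ, so one is taken near [x] to turn [s] into a point. *)
apply: ab_sep_local => x Vx; have [Z [hZ [Zx [mu]]]] := tor_locally_nonempty (A U Q)
  (hV _ Vx).
exists Z; split=> // Y k l; have hY := osub_trans hV k.
rewrite (tor_sub_res hY) -tm_res.
have := hE (@Point _ _ _ _ A F _ _ hY Q (sh_res hY l mu) (sh_res hY k s)) (osub_top _).
rewrite /b /= => <-; exact/esym/smooth_res_comp.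
Qed.

(** Translating σ by [h] adds dh to Θ(μ)(σ), so preserving Θ forces dh = 0 on the domain of every
    point, and these domains cover M. *)
Lemma preserving_translation (x : connective_lift A xi) (t : cl_hom x x) :
  exists c : loc_const M, sval t = translation (sval (cl_lift x)) c.
Proof.
have [h hE] := modification_translation (sval t).
have [|c cE] := @ext_d_eq0_loc_const _ _ _ h.
  have cov y := point_cover A (sval (cl_lift x)) y.
  apply: (fm_sep_local) => y _; have [p py] := cov y; exists (pt_dom p);
    split=> // Z k kp.
  rewrite fm_res0 -(fm_res_comp (osub_top (pt_dom p)) kp) -[RHS](fm_res0 kp);
    congr fm_res.
  have := svalP t _ _ _ _ (pt_mu p) _ _ (osub_refl _) (pt_sec p).
  rewrite hE cn_act ext_d_res => /eqP; rewrite -subr_eq0 addrAC subrr add0r => /eqP ->.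
  by [].
exists c; apply: modification_ext => U Q; apply: tor_mor_ext => V hV s.
by rewrite hE /= -cE; congr tor_act; apply: smooth_ext.
Qed.

Lemma translation_preserves (x : connective_lift A xi) (c : loc_const M) :
  preserves_ext (x := x) (y := x) (translation (sval (cl_lift x)) c).
Proof. by move=> U Q V hV mu W hW kW s /=; rewrite cn_act ext_d_loc_const addr0. Qed.

Definition cl_translation (x : connective_lift_cat A xi) (c : loc_const M) : hom x x :=
  exist _ (translation (sval (cl_lift x)) c) (translation_preserves c).

Lemma cl_translationD x c d : cl_translation x (c + d) = cl_translation x c ⊚
  cl_translation x d.
Proof. by apply: cl_hom_ext; apply: translationD. Qed.

Lemma cl_translation_iso x c : is_iso (cl_translation x c).
Proof.
have t0 : cl_translation x 0 = idm x by apply: cl_hom_ext; apply: translation0.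
by exists (cl_translation x (- c)); rewrite -!cl_translationD addNr addrN t0.
Qed.

Lemma translation_inj F : injective (translation F).
Proof.
move=> c d cd; apply: val_inj; apply/funext => y.
have [p py] := point_cover A F y.
have := congr1 (fun t : modification F F => tm_fun (md_hom t (pt_obj p)) (pt_sec p)) cd.
by move=> /= /tor_act_inj /(congr1 (fun f : smooth (pt_dom p) => f (oelt py))).
Qed.
End Automorphisms.

(** The type of [cl_ext] depends on [cl_lift], so equal records give equal extensions only up to
    transport along a proof of [F = F]; by proof irrelevance that transport is the identity. *)
Lemma ConnectiveLift_inj (R : realType) (n : nat) (M : manifold R n) (G : dd_gerbe M)
    (A : connective_structure G) (xi : vfield (otop M)) (F : lift_cat G xi)
    (t t' : connective_ext A xi (sval F)) : ConnectiveLift t = ConnectiveLift t' -> t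
      = t'.
Proof.
have cast (x y : connective_lift A xi) (e : x = y) (l : cl_lift x = cl_lift y) :
    ecast F (connective_ext A xi (sval F)) l (cl_ext x) = cl_ext y.
  by case: y / e l => l; rewrite (Prop_irrelevance l erefl).
by move=> /cast/(_ erefl).
Qed.

Theorem corollary10p46 (R : realType) (n : nat) (M : manifold R n)
    (G : dd_gerbe M) (A : connective_structure G) :
  (forall (xi : vfield (otop M)) (F : lift_cat G xi),
     is_torsor_on (@cl_act R n M G A xi)
       [set x : connective_lift_cat A xi | forget_connective A xi x = F]) /\
  (forall (xi : vfield (otop M)) (x : connective_lift_cat A xi),
     exists Psi : loc_const M -> aut x,
       [/\ bijective Psi,
           forall c d, sval (Psi (c + d)) = sval (Psi c) ⊚ sval (Psi d) &
           forall (c : loc_const M) U (Q : G U) V (hV : V ⊑ U)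
             (s : (sval (cl_lift x) U Q : torsor (sheaf_smooth M) U) V hV),
             tm_fun (md_hom (sval (sval (Psi c))) Q) s =
             tor_act s (loc_const_smooth V c)]).
Proof.
split=> xi.
  move=> F; have actP (t t' : connective_ext A xi (sval F)) a :
      cl_act (ConnectiveLift t) a = ConnectiveLift t' <-> ce_add t a = t'.
    by split=> [/ConnectiveLift_inj|<-].
  split.
  - by have [t] := connective_ext_ex A (svalP F); exists (ConnectiveLift t).
  - by [].
  - move=> [F' t] /= _; rewrite /cl_act /=; congr ConnectiveLift.
    by apply/ce_add_eqP => p; rewrite fm_res0 addr0.
  - move=> [F' t] a b _; rewrite /cl_act /=; congr ConnectiveLift.
    by apply/ce_add_eqP => p; rewrite /ext_value /= !fm_res_id fm_resD addrA.
  - move=> [F1 t] [F2 t'] /= e1 e2; move: t t'; rewrite e1 e2 => t t'.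
    have [a [aP aU]] := ce_add_transitive t t'; exists a; split.
      by rewrite /cl_act /= aP.
    by move=> b /actP/aU.
move=> x; exists (fun c => exist _ (cl_translation x c) (cl_translation_iso x c));
  split=> //.
- have surj (t : aut x) : exists c, cl_translation x c = sval t.
    have [c cE] := preserving_translation (sval t).
    by exists c; apply: cl_hom_ext; rewrite cE.
  exists (fun t => projT1 (cid (surj t))) => [c|t].
    case: cid => d /= dc; apply: (@translation_inj _ _ _ _ A (sval (cl_lift x))).
    exact: (congr1 (fun t : cl_hom x x => sval t) dc).
  case: cid => d /= dt; case: t dt => t tP /= dt; case: t / dt tP => tP.
  by congr exist; apply: Prop_irrelevance.
- by move=> c d; apply: cl_translationD.
Qed.
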